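(* Let $X$ be a real smooth manifold of dimension $6$ and let $(\Omega,\omega_0)$ be a non-degenerate (elliptic or hyperbolic) Monge-Ampère structure on $X$. Then the almost (pseudo) Calabi-Yau structure $(q_\omega,K_\omega,\Omega,\alpha,\beta)$ associated with $(\Omega,\omega_0)$ is integrable if and only if $$ d\left(\frac{\omega_0}{\sqrt[4]{|\lambda(\omega_0)|}}\right)=0\quad\text{and}\quad d\left(\frac{\hat{\omega}_0}{\sqrt[4]{|\lambda(\omega_0)|}}\right)=0 . $$
   Context: Linear algebra. Let $V$ be a $6$-dimensional real vector space with symplectic form $\Omega$, and fix the volume form $\theta=-\frac{\Omega^3}{6}$. Let $A:\Lambda^5(V^* )\to V\otimes\Lambda^6(V^* )$ be the isomorphism induced by the exterior product: $A(\sigma)=Y\otimes\theta$, where $\eta\wedge\sigma=\eta(Y)\,\theta$ for all $\eta\in V^*$. For $\omega\in\Lambda^3(V^* )$ define the endomorphism $K_\omega:V\to V$ by $K_\omega(X)\otimes\theta=A(i_X\omega\wedge\omega)$, and the Hitchin pfaffian $\lambda(\omega)=\frac16\mathrm{Tr}(K_\omega^2)$. The form $\omega$ is non-degenerate if $\lambda(\omega)\neq0$. The following facts are known (Hitchin): $K_\omega^2=\lambda(\omega)\,\mathrm{Id}$ when $\lambda(\omega)\ne 0$; if $\lambda(\omega)>0$ there are unique real decomposable $3$-forms $a,b$ with $\omega=a+b$ and $\frac{a\wedge b}{\theta}>0$; if $\lambda(\omega)<0$ there is a unique complex decomposable $3$-form $a$ with $\omega=a+\overline a$ and $\frac{a\wedge\overline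 a}{i\theta}>0$. The dual form is $\hat\omega=a-b$ if $\lambda(\omega)>0$ and $\hat\omega=i(\overline a-a)$ if $\lambda(\omega)<0$. Write $K_\omega^*(\omega)(X,Y,Z)=\omega(K_\omega X,K_\omega Y,K_\omega Z)$. Monge-Ampère structures. A Monge-Ampère structure on a $6$-manifold $X$ is a pair $(\Omega,\omega_0)$ where $\Omega$ is a symplectic form on $X$ and $\omega_0$ is a differential $3$-form on $X$ with $\omega_0\wedge\Omega=0$. All constructions above are applied pointwise on $(T_xX,\Omega_x)$. The structure is elliptic if $\lambda(\omega_0)<0$ everywhere and hyperbolic if $\lambda(\omega_0)>0$ everywhere. Associated almost (pseudo) Calabi-Yau structure. Put $\omega=\frac{\omega_0}{\sqrt[4]{|\lambda(\omega_0)|}}$ (so $\lambda(\omega)=\pm1$) and $q_\omega=\Omega(K_\omega\cdot,\cdot)$, a possibly indefinite metric. - Elliptic case: $K_\omega$ is an almost complex structure, $\alpha=\frac43(\omega+iK_\omega^*(\omega))$, which is of type $(3,0)$ for $K_\omega$, and $\beta=\overline\alpha$. The structure is called integrable (i.e. is a (pseudo) Calabi-Yau structure) if the almost complex structure $K_\omega$ is integrable and $\alpha$ is holomorphic for it. - Hyperbolic case: $K_\omega$ is an almost product structure ($K_\omega^2=\mathrm{Id}$), $\alpha=\frac12(\omega+K_\omega^*(\omega))$ and $\beta=\frac12(\omega-K_\omega^*(\omega))$, decomposable forms whose kernels are the eigendistributions of $K_\omega$. The structure is called integrable (i.e. is a real pseudo Calabi-Yau structure) if $K_\omega$ is integrable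 (both its eigendistributions are involutive) and $\alpha$ and $\beta$ are closed. *)

(* Defs.v *)
From HB Require Import structures.
From mathcomp Require Import all_boot all_order all_fingroup all_algebra.
From mathcomp Require Import all_classical all_reals all_analysis.
From mathcomp Require Import complex.

Set Implicit Arguments.
Unset Strict Implicit.
Unset Printing Implicit Defensive.

Import Order.TTheory GRing.Theory Num.Theory numFieldNormedType.Exports.

Local Open Scope classical_set_scope.
Local Open Scope ring_scope.

(* A k-form on R^n with values in F (F = R or R[i]) is a function of the
   k x n matrix whose rows are its k arguments. *)
Definition form (F : Type) (R : realType) (n k : nat) := 'M[R]_(k, n) -> F.

Section Forms.
Variables (R : realType) (n : nat).

Definition multilinear k (a : form R R n k) : Prop :=
  forall (i : 'I_k) (A B C : 'M[R]_(k, n)) (b c : R),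
    row i A = b *: row i B + c *: row i C ->
    row' i B = row' i A -> row' i C = row' i A ->
    a A = b * a B + c * a C.

Definition alternating k (a : form R R n k) : Prop :=
  forall (A : 'M[R]_(k, n)) (i j : 'I_k), i != j -> row i A = row j A -> a A = 0.

Definition is_form k (a : form R R n k) : Prop := multilinear a /\ alternating a.

Definition re_form k (a : form R[i] R n k) : form R R n k :=
  fun M => complex.Re (a M).

Definition im_form k (a : form R[i] R n k) : form R R n k :=
  fun M => complex.Im (a M).

Definition is_cform k (a : form R[i] R n k) : Prop :=
  is_form (re_form a) /\ is_form (im_form a).

(* Determinant convention: (e1 /\ ... /\ ek)(v1, ..., vk) = det (ei(vj)). *)
Definition wedge (F : fieldType) k l (a : form F R n k) (b : form F R n l) :
    form F R n (k + l) :=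
  fun M => (k`! * l`!)%:R^-1 *
    \sum_(s : 'S_(k + l))
       (-1) ^+ s * a (usubmx (row_perm s M)) * b (dsubmx (row_perm s M)).

Definition contract k (X : 'rV[R]_n) (a : form R R n k.+1) : form R R n k :=
  fun M => a (col_mx X M).

Definition pullback (F : Type) k (K : 'rV[R]_n -> 'rV[R]_n) (a : form F R n k) :
    form F R n k :=
  fun M => a (\matrix_(i < k) K (row i M)).

Definition decomposable3 (a : form R R n 3) : Prop :=
  exists e1 e2 e3 : form R R n 1,
    [/\ is_form e1, is_form e2, is_form e3 & a = wedge (wedge e1 e2) e3].

Definition cdecomposable3 (a : form R[i] R n 3) : Prop :=
  exists e1 e2 e3 : form R[i] R n 1,
    [/\ is_cform e1, is_cform e2, is_cform e3 & a = wedge (wedge e1 e2) e3].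

End Forms.

Section HitchinAlgebra.
Variable R : realType.
Local Notation V := 'rV[R]_6.
Implicit Types (Om : form R R 6 2) (w : form R R 6 3).

Definition volume Om : form R R 6 6 :=
  fun M => - (6%:R^-1 * wedge (wedge Om Om) Om M).

(* The vector Y such that A(sigma) = Y (x) theta. *)
Definition contract5 (theta : form R R 6 6) (sigma : form R R 6 5) : V :=
  get [set Y : V | forall eta : form R R 6 1, is_form eta ->
                     forall M, wedge eta sigma M = eta Y * theta M].

Definition hitchinK Om w (X : V) : V :=
  contract5 (volume Om) (wedge (contract X w) w).

Definition pfaffian Om w : R :=
  6%:R^-1 * \tr (lin1_mx (hitchinK Om w \o hitchinK Om w)).

Definition hyperbolic_dual Om w (w' : form R R 6 3) : Prop :=
  exists a b : form R R 6 3,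
    [/\ decomposable3 a, decomposable3 b,
        forall M, w M = a M + b M,
        exists2 c : R, 0 < c & forall M, wedge a b M = c * volume Om M &
        forall M, w' M = a M - b M].

Definition elliptic_dual Om w (w' : form R R 6 3) : Prop :=
  exists a : form R[i] R 6 3,
    [/\ cdecomposable3 a,
        forall M, (w M)%:C%C = a M + conjc (a M),
        exists2 c : R, 0 < c & forall M,
          wedge a (conjc \o a) M = c%:C%C * ('i%C * (volume Om M)%:C%C) &
        forall M, (w' M)%:C%C = 'i%C * (conjc (a M) - a M)].

Definition hitchin_dual Om w : form R R 6 3 :=
  get [set w' | (0 < pfaffian Om w /\ hyperbolic_dual Om w w') \/
                (pfaffian Om w < 0 /\ elliptic_dual Om w w')].

(* w' / |lambda(w)|^(1/4) *)
Definition normalize Om w (w' : form R R 6 3) : form R R 6 3 :=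
  fun M => w' M / (`|pfaffian Om w| `^ (4%:R^-1)).

End HitchinAlgebra.

Section Calculus.
Variables (R : realType) (n : nat).
Local Notation E := 'rV[R]_n.

Fixpoint iter_partial (s : seq 'I_n) (f : E -> R) : E -> R :=
  if s is i :: s' then fun p => 'D_(delta_mx 0 i) (iter_partial s' f) p else f.

(* C^oo on the open set U: all iterated partial derivatives exist and are
   continuous on U. *)
Definition smooth_on (U : set E) (f : E -> R) : Prop :=
  forall (s : seq 'I_n) (p : E), U p ->
    {for p, continuous (iter_partial s f)} /\
    forall i : 'I_n, derivable (iter_partial s f) p (delta_mx 0 i).

Definition smooth_map_on m (U : set E) (f : E -> 'rV[R]_m) : Prop :=
  forall j : 'I_m, smooth_on U (fun p => f p 0 j).

Definition ext_d k (a : E -> form R R n k) : E -> form R R n k.+1 :=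
  fun p M =>
    \sum_(i < k.+1)
       (-1) ^+ i * 'D_(row i M) (fun q => a q (row' i M : 'M[R]_(k, n))) p.

Definition ext_dC k (a : E -> form R[i] R n k) : E -> form R[i] R n k.+1 :=
  fun p M => (ext_d (fun q => re_form (a q)) p M)%:C%C
             + 'i%C * (ext_d (fun q => im_form (a q)) p M)%:C%C.

Definition lie_bracket (X Y : E -> E) : E -> E :=
  fun p => 'D_(X p) Y p - 'D_(Y p) X p.

Definition re_vec (z : 'rV[R[i]]_n) : E := map_mx (@complex.Re R) z.
Definition im_vec (z : 'rV[R[i]]_n) : E := map_mx (@complex.Im R) z.
Definition cvec (u v : E) : 'rV[R[i]]_n :=
  map_mx (real_complex R) u + 'i%C *: map_mx (real_complex R) v.

(* The C-bilinear extension of the bracket. *)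
Definition clie_bracket (Z W : E -> 'rV[R[i]]_n) : E -> 'rV[R[i]]_n :=
  fun p =>
    let x := re_vec \o Z in let y := im_vec \o Z in
    let u := re_vec \o W in let v := im_vec \o W in
    cvec (lie_bracket x u p - lie_bracket y v p)
         (lie_bracket x v p + lie_bracket y u p).

Definition complexify_end (K : E -> E) (z : 'rV[R[i]]_n) : 'rV[R[i]]_n :=
  cvec (K (re_vec z)) (K (im_vec z)).

(* The C-multilinear extension of an R-multilinear form to (R^n) (x) C, expanded
   over the set S of the arguments whose imaginary part is taken. *)
Definition complexify_form k (a : form R[i] R n k) (N : 'M[R[i]]_(k, n)) : R[i] :=
  \sum_(S : {set 'I_k})
     'i%C ^+ #|S| *
     a (\matrix_(r < k) (if r \in S then im_vec (row r N) else re_vec (row r N))).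

Definition part10 (K : E -> E) (v : E) : 'rV[R[i]]_n := 2%:R^-1 *: cvec v (- K v).
Definition part01 (K : E -> E) (v : E) : 'rV[R[i]]_n := 2%:R^-1 *: cvec v (K v).

(* The component of type (k - q, q) of a k-form, for a complex structure K;
   S is the set of the arguments replaced by their (0,1) part. *)
Definition type_part k (K : E -> E) (q : nat) (a : form R[i] R n k) :
    form R[i] R n k :=
  fun M => \sum_(S : {set 'I_k} | #|S| == q)
    complexify_form a
      (\matrix_(r < k) (if r \in S then part01 K (row r M) else part10 K (row r M))).

(* On forms of type (k - q, q). *)
Definition dbar k (q : nat) (K : E -> E -> E) (a : E -> form R[i] R n k) :
    E -> form R[i] R n k.+1 :=
  fun p => type_part (K p) q.+1 (ext_dC a p).

End Calculus.

Record manifold (R : realType) (n : nat) := Manifold {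
  mpoint :> topologicalType;
  mpoint_hausdorff : hausdorff_space mpoint;
  mpoint_second_countable : @second_countable mpoint;
  chart : Type;
  chart_dom : chart -> set mpoint;
  chart_map : chart -> mpoint -> 'rV[R]_n;
  chart_inv : chart -> 'rV[R]_n -> mpoint;
  chart_dom_open : forall c, open (chart_dom c);
  chart_img_open : forall c, open (chart_map c @` chart_dom c);
  chart_mapK : forall c x, chart_dom c x -> chart_inv c (chart_map c x) = x;
  chart_map_cont : forall c, {within chart_dom c, continuous (chart_map c)};
  chart_inv_cont : forall c,
    {within chart_map c @` chart_dom c, continuous (chart_inv c)};
  chart_cover : forall x, exists c, chart_dom c x;
  chart_smooth : forall c d,
    smooth_map_on (chart_map c @` (chart_dom c `&` chart_dom d))
                  (chart_map d \o chart_inv c)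
}.

Section ManifoldTensors.
Variables (R : realType) (n : nat) (X : manifold R n).
Local Notation E := 'rV[R]_n.

Definition chart_img (c : chart X) : set E := chart_map c @` chart_dom c.

(* A field of objects of type T on X, given by its expression in each chart of
   the atlas; only the values on [chart_img c] are meaningful. *)
Definition tensor_field (T : Type) := chart X -> E -> T.

Record diff_form (k : nat) := DiffForm {
  coefs :> chart X -> E -> form R R n k;
  coefs_form : forall c p, chart_img c p -> is_form (coefs c p);
  coefs_smooth : forall c (M : 'M[R]_(k, n)),
    smooth_on (chart_img c) (fun p => coefs c p M);
  coefs_compat : forall c d x, chart_dom c x -> chart_dom d x ->
    forall M : 'M[R]_(k, n),
      coefs c (chart_map c x) M =
      coefs d (chart_map d x)
        (M *m jacobian (chart_map d \o chart_inv c) (chart_map c x))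
}.

Definition closed_form k (a : tensor_field (form R R n k)) : Prop :=
  forall c p, chart_img c p -> forall M, ext_d (a c) p M = 0.

Definition involutive_dist (D : tensor_field (set E)) : Prop :=
  forall c (U : set E), open U -> U `<=` chart_img c ->
  forall Y Z : E -> E, smooth_map_on U Y -> smooth_map_on U Z ->
    (forall p, U p -> D c p (Y p)) -> (forall p, U p -> D c p (Z p)) ->
    forall p, U p -> D c p (lie_bracket Y Z p).

Definition csmooth_on (U : set E) (Z : E -> 'rV[R[i]]_n) : Prop :=
  smooth_map_on U (@re_vec R n \o Z) /\ smooth_map_on U (@im_vec R n \o Z).

Definition cinvolutive_dist (D : tensor_field (set 'rV[R[i]]_n)) : Prop :=
  forall c (U : set E), open U -> U `<=` chart_img c ->
  forall Y Z : E -> 'rV[R[i]]_n, csmooth_on U Y -> csmooth_on U Z ->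
    (forall p, U p -> D c p (Y p)) -> (forall p, U p -> D c p (Z p)) ->
    forall p, U p -> D c p (clie_bracket Y Z p).

Definition eigendist (K : tensor_field (E -> E)) (l : R) : tensor_field (set E) :=
  fun c p => [set v | K c p v = l *: v].

Definition ceigendist (K : tensor_field (E -> E)) (l : R[i]) :
    tensor_field (set 'rV[R[i]]_n) :=
  fun c p => [set z | complexify_end (K c p) z = l *: z].

Definition integrable_product (K : tensor_field (E -> E)) : Prop :=
  involutive_dist (eigendist K 1) /\ involutive_dist (eigendist K (-1)).

(* Integrability in the sense of Newlander-Nirenberg: T^{1,0} and T^{0,1} are
   involutive. *)
Definition integrable_complex (K : tensor_field (E -> E)) : Prop :=
  cinvolutive_dist (ceigendist K 'i%C) /\ cinvolutive_dist (ceigendist K (- 'i%C)).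

(* Holomorphic k-form: of type (k,0) and killed by dbar. *)
Definition holomorphic k (K : tensor_field (E -> E)) (a : tensor_field (form R[i] R n k)) :
    Prop :=
  forall c p, chart_img c p ->
    (forall M, type_part (K c p) 0 (a c p) M = a c p M) /\
    (forall M, dbar 0 (K c) (a c) p M = 0).

End ManifoldTensors.

Section MongeAmpere.
Variables (R : realType) (X : manifold R 6).
Local Notation E := 'rV[R]_6.

Record monge_ampere := MongeAmpere {
  symp : diff_form X 2;
  symp_closed : closed_form (coefs symp);
  symp_nondeg : forall c p, chart_img c p ->
    forall u : E, (forall v : E, symp c p (col_mx u v) = 0) -> u = 0;
  ma_form : diff_form X 3;
  ma_effective : forall c p, chart_img c p ->
    forall M, wedge (ma_form c p) (symp c p) M = 0
}.

Variable S : monge_ampere.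

Definition elliptic : Prop := forall c p, chart_img c p ->
  pfaffian (symp S c p) (ma_form S c p) < 0.

Definition hyperbolic : Prop := forall c p, chart_img c p ->
  0 < pfaffian (symp S c p) (ma_form S c p).

Definition normalized_form : tensor_field X (form R R 6 3) := fun c p =>
  normalize (symp S c p) (ma_form S c p) (ma_form S c p).

Definition normalized_dual : tensor_field X (form R R 6 3) := fun c p =>
  normalize (symp S c p) (ma_form S c p) (hitchin_dual (symp S c p) (ma_form S c p)).

Definition assoc_K : tensor_field X (E -> E) := fun c p =>
  hitchinK (symp S c p) (normalized_form c p).

Definition assoc_metric : tensor_field X (E -> E -> R) := fun c p u v =>
  symp S c p (col_mx (assoc_K c p u) v).

Definition assoc_Kform : tensor_field X (form R R 6 3) := fun c p =>
  pullback (assoc_K c p) (normalized_form c p).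

End MongeAmpere.

(* The tuple (q, K, Omega, alpha, beta), with alpha and beta valued in F. *)
Record almost_CY (R : realType) (X : manifold R 6) (F : Type) := AlmostCY {
  CY_metric : tensor_field X ('rV[R]_6 -> 'rV[R]_6 -> R);
  CY_K : tensor_field X ('rV[R]_6 -> 'rV[R]_6);
  CY_symp : diff_form X 2;
  CY_alpha : tensor_field X (form F R 6 3);
  CY_beta : tensor_field X (form F R 6 3)
}.

Section CalabiYau.
Variables (R : realType) (X : manifold R 6) (S : monge_ampere X).

Definition assoc_elliptic : almost_CY X R[i] :=
  let alpha : tensor_field X (form R[i] R 6 3) := fun c p M =>
    (4%:R / 3%:R) * ((normalized_form S c p M)%:C%C
                     + 'i%C * (assoc_Kform S c p M)%:C%C) in
  AlmostCY (assoc_metric S) (assoc_K S) (symp S)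
           alpha (fun c p M => conjc (alpha c p M)).

Definition assoc_hyperbolic : almost_CY X R :=
  AlmostCY (assoc_metric S) (assoc_K S) (symp S)
    (fun c p M => 2%:R^-1 * (normalized_form S c p M + assoc_Kform S c p M))
    (fun c p M => 2%:R^-1 * (normalized_form S c p M - assoc_Kform S c p M)).

Definition integrable_CY (T : almost_CY X R[i]) : Prop :=
  integrable_complex (CY_K T) /\ holomorphic (CY_K T) (CY_alpha T).

Definition integrable_real_CY (T : almost_CY X R) : Prop :=
  [/\ integrable_product (CY_K T), closed_form (CY_alpha T) &
      closed_form (CY_beta T)].

End CalabiYau.

(* Main.v *)
From HB Require Import structures.
From mathcomp Require Import all_boot all_order all_fingroup all_algebra.
From mathcomp Require Import all_classical all_reals all_analysis.
From mathcomp Require Import complex ring zify.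
Require Import Defs.

(** Write w for the normalised 3-form, K for its Hitchin endomorphism, eps for
    the sign of lambda (1 or -1), and g (X, Y, Z) = w (K X, Y, Z).

    Pointwise algebra.  The relation i_{KX} theta = i_X w /\ w determines K,
    because theta is a volume form ([vol_neq0]).  Contracting it with a second
    vector yields w (K X, Y, Z) = w (X, K Y, Z) ([K_sym]), so that g is again
    alternating, and yields that K o K is a multiple of the identity
    ([K_scalar]), namely eps after normalisation.  The combinations of w and g
    that are eigenforms of w |-> w (K ., ., .) satisfy the Pluecker relations,
    hence are decomposable ([half_dec]); conversely, in every decomposition
    w = a + b as in the definition of the dual form, a and b are these
    eigenforms ([decomposition_wK]).  So the dual form is a multiple of g, and
    after normalisation both the dual form and K^* w are equal to eps g
    ([lf_Kform], [lf_dual]).  The condition of the theorem thus reads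
    d w = d g = 0 ([closed_pairP]), and alpha, beta are combinations of w and
    g with constant coefficients.

    Calculus.  For vector fields u, v put u' = K u, v' = K v.  Expand
    i_v i_u (d w), eps i_{v'} i_{u'} (d w), - eps i_{v'} i_u (d g) and
    - eps i_v i_{u'} (d g) by Cartan's formula and add them up: the symmetry of
    K makes all derivatives of coefficients cancel, and what is left is
    - i_A w + eps i_{K B} w, where A = [u, v] + eps [u', v'] and
    B = [u, v'] + [u', v] ([key_identity]).
    If d w = d g = 0, then A = eps K B, since w is non-degenerate
    ([bracket_eq]).  This is the involutivity of the eigendistributions of K:
    take u' and v' equal to plus or minus u and v if eps = 1, and let u, u' be
    the real and imaginary parts of an eigenfield if eps = -1.

    Converse.  If eps = 1, then d w = d g = 0 because w = alpha + beta and
    K^* w = alpha - beta.  If eps = -1, the involutivity applied to the fields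
    x + i K x with x constant makes the right-hand side of the key identity
    vanish, so that d alpha kills any two vectors of type (0,1).  Its component
    of type (3,1) vanishes as alpha is holomorphic, and the one of type (4,0)
    because the complex dimension is 3; hence d alpha = 0 ([form4_eq0]).

    Forms are handled as functions on lists of vectors ([lform]): contraction
    fixes the head of the list, the wedge product recurses on the list ([wd]),
    and [lf_wedge] identifies it with the sum over permutations. *)

Set Implicit Arguments.
Unset Strict Implicit.
Unset Printing Implicit Defensive.

Import Order.TTheory GRing.Theory Num.Theory numFieldNormedType.Exports.

Local Open Scope classical_set_scope.
Local Open Scope ring_scope.

Section LinearCombination.
Variable F : comNzRingType.

(** Proves an equation by writing it as an explicit linear combination of
    known ones; the remaining goal is a polynomial identity. *)
Lemma eq_comb1 (c l r L R : F) : l = r -> L - R = c * (l - r) -> L = R.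
Proof. by move=> -> /eqP; rewrite subrr mulr0 subr_eq0 => /eqP. Qed.

Lemma eq_comb2 (c1 c2 l1 r1 l2 r2 L R : F) : l1 = r1 -> l2 = r2 ->
  L - R = c1 * (l1 - r1) + c2 * (l2 - r2) -> L = R.
Proof. by move=> -> -> /eqP; rewrite !subrr !mulr0 addr0 subr_eq0 => /eqP. Qed.

Lemma eq_comb3 (c1 c2 c3 l1 r1 l2 r2 l3 r3 L R : F) : l1 = r1 -> l2 = r2 -> l3 = r3 ->
  L - R = c1 * (l1 - r1) + c2 * (l2 - r2) + c3 * (l3 - r3) -> L = R.
Proof. by move=> -> -> -> /eqP; rewrite !subrr !mulr0 !addr0 subr_eq0 => /eqP. Qed.

End LinearCombination.
Arguments eq_comb1 {F} c {l r L R}.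
Arguments eq_comb2 {F} c1 c2 {l1 r1 l2 r2 L R}.
Arguments eq_comb3 {F} c1 c2 c3 {l1 r1 l2 r2 l3 r3 L R}.

(** * Alternating forms on lists of vectors *)

Section ListForms.
Variables (R0 : fieldType) (F : numFieldType) (f : {rmorphism R0 -> F}) (n : nat).
Local Notation V := 'rV[R0]_n.
(** The degree is kept out of the type, so that contraction and product
    never need casts. Vectors have coordinates in R0 and forms take values
    in F through an embedding f: this covers real forms, complex valued
    forms on a real space, and forms on a complex space. *)
Definition lform := seq V -> F.
Implicit Types (k l : nat) (A B C : lform) (x y z : V) (xs ys s : seq V).

Definition ctr x A : lform := fun xs => A (x :: xs).
Definition sg A : lform := fun xs => (-1) ^+ size xs * A xs.
Definition scl (c : F) A : lform := fun xs => c * A xs.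
Definition ladd A B : lform := fun xs => A xs + B xs.

(** The shuffle product: the first argument goes to the left factor, or to
    the right one with the sign [sg] for passing all the arguments of the
    left factor. The Leibniz rule [ctr_wd] holds by definition. *)
Fixpoint wd xs A B : F :=
  if xs is x :: xs' then wd xs' (ctr x A) B + wd xs' (sg A) (ctr x B)
  else A [::] * B [::].
Definition wdg A B : lform := fun xs => wd xs A B.

Lemma wdDl A A' B : wdg (ladd A A') B = ladd (wdg A B) (wdg A' B).
Proof.
apply/funext => xs; rewrite /wdg /ladd /=.
elim: xs A A' B => [|x xs IH] A A' B /=; first by rewrite mulrDl.
rewrite [wd xs (ctr x _) B](IH (ctr x A) (ctr x A')).
have -> : sg (fun xs => A xs + A' xs) = (fun xs => sg A xs + sg A' xs).
  by apply/funext => ys; rewrite /sg mulrDr.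
by rewrite IH addrACA.
Qed.

Lemma wdDr A B B' : wdg A (ladd B B') = ladd (wdg A B) (wdg A B').
Proof.
apply/funext => xs; rewrite /wdg /ladd /=.
elim: xs A B B' => [|x xs IH] A B B' /=; first by rewrite mulrDr.
by rewrite IH [wd xs _ (ctr x _)](IH _ (ctr x B) (ctr x B')) addrACA.
Qed.

Lemma wdZl c A B : wdg (scl c A) B = scl c (wdg A B).
Proof.
apply/funext => xs; rewrite /wdg /scl /=.
elim: xs A B => [|x xs IH] A B /=; first by rewrite mulrA.
rewrite [wd xs (ctr x _) B](IH (ctr x A)).
have -> : sg (fun xs => c * A xs) = (fun xs => c * sg A xs).
  by apply/funext => ys; rewrite /sg mulrCA.
by rewrite IH mulrDr.
Qed.

Lemma wdZr c A B : wdg A (scl c B) = scl c (wdg A B).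
Proof.
apply/funext => xs; rewrite /wdg /scl /=.
elim: xs A B => [|x xs IH] A B /=; first by rewrite mulrCA.
by rewrite IH [wd xs _ (ctr x _)](IH _ (ctr x B)) mulrDr.
Qed.

Definition l0 : lform := fun=> 0.
Lemma scl0 A : scl 0 A = l0. Proof. by apply/funext => xs; rewrite /scl mul0r. Qed.
Lemma scl1 A : scl 1 A = A. Proof. by apply/funext => xs; rewrite /scl mul1r. Qed.
Lemma sclA c d A : scl c (scl d A) = scl (c * d) A.
Proof. by apply/funext => xs; rewrite /scl mulrA. Qed.
Lemma scll0 c : scl c l0 = l0.
Proof. by apply/funext => xs; rewrite /scl mulr0. Qed.
Lemma ladd0 A : ladd A l0 = A. Proof. by apply/funext => xs; rewrite /ladd addr0. Qed.
Lemma wd0l A : wdg l0 A = l0.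
Proof. by rewrite -{1}(scl0 l0) wdZl scl0. Qed.
Lemma wd0r A : wdg A l0 = l0.
Proof. by rewrite -{1}(scl0 l0) wdZr scl0. Qed.

Lemma ctr_wd x A B : ctr x (wdg A B) = ladd (wdg (ctr x A) B) (wdg (sg A) (ctr x B)).
Proof. by []. Qed.

Lemma ctr_sg x A : ctr x (sg A) = scl (-1) (sg (ctr x A)).
Proof. by apply/funext => ys; rewrite /ctr /sg /scl /= exprS mulrA. Qed.

Lemma sg_wd A B : sg (wdg A B) = wdg (sg A) (sg B).
Proof.
apply/funext => xs; rewrite /wdg /sg /=.
elim: xs A B => [|x xs IH] A B /=; first by rewrite !mul1r.
have E := wdZl (-1) (sg (ctr x A)) (sg B).
have E' := wdZr (-1) (sg (sg A)) (sg (ctr x B)).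
rewrite -!ctr_sg in E E'.
have /(congr1 (fun h => h xs)) := E; have /(congr1 (fun h => h xs)) := E'.
rewrite /wdg /scl => -> ->.
by rewrite exprS mulrDr -!mulrA !IH.
Qed.

(** By the Leibniz rule, contraction of either side yields the same three
    products of contracted forms; no symmetry of the forms is used. *)
Lemma wdA A B C : wdg A (wdg B C) = wdg (wdg A B) C.
Proof.
apply/funext => xs; rewrite /wdg.
elim: xs A B C => [|x xs IH] A B C /=; first by rewrite mulrA.
rewrite [wd xs (ctr x _) C](_ : _ =
   wdg (ladd (wdg (ctr x A) B) (wdg (sg A) (ctr x B))) C xs) // wdDl.
rewrite [wd xs (sg A) _](_ : _ = wdg (sg A)
   (ladd (wdg (ctr x B) C) (wdg (sg B) (ctr x C))) xs) // wdDr.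
rewrite -/(wdg A B) sg_wd /ladd /wdg.
by rewrite -!IH addrA.
Qed.

Definition hasdeg (k : nat) A := forall xs, size xs != k -> A xs = 0.

Lemma sg_deg k A : hasdeg k A -> sg A = scl ((-1) ^+ k) A.
Proof.
move=> hA; apply/funext => xs; rewrite /sg /scl.
by have [->//|/hA ->] := eqVneq (size xs) k; rewrite !mulr0.
Qed.

Lemma deg_ctr k A x : hasdeg k.+1 A -> hasdeg k (ctr x A).
Proof. by move=> h xs hxs; apply: h; rewrite /= eqSS. Qed.

Lemma deg_ctr0 A x : hasdeg 0 A -> ctr x A = l0.
Proof. by move=> h; apply/funext=> xs; rewrite /ctr h. Qed.

Lemma deg_scl k c A : hasdeg k A -> hasdeg k (scl c A).
Proof. by move=> h xs /h; rewrite /scl => ->; rewrite mulr0. Qed.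
Lemma deg_add k A B : hasdeg k A -> hasdeg k B -> hasdeg k (ladd A B).
Proof. by move=> h h' xs hx; rewrite /ladd h // h' // addr0. Qed.

Lemma deg_wd k l A B : hasdeg k A -> hasdeg l B -> hasdeg (k + l)%N (wdg A B).
Proof.
move=> hA hB xs; rewrite /wdg.
elim: xs k l A B hA hB => [|x xs IH] k l A B hA hB /=.
  case: k hA => [|k] hA; last by rewrite hA // mul0r.
  by case: l hB => [|l] hB //; rewrite hB // mulr0.
move=> hs; rewrite [X in X + _](_ : _ = 0); last first.
  case: k hA hs => [|k] hA hs; first by rewrite (deg_ctr0 _ hA) -/(wdg _ _ _) wd0l.
  by apply: (IH k l) => //; apply: deg_ctr.
rewrite add0r (sg_deg hA) -/(wdg _ _ _) wdZl /scl [X in _ * X](_ : _ = 0) ?mulr0 //.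
case: l hB hs => [|l] hB hs; first by rewrite (deg_ctr0 _ hB) wd0r.
by apply: (IH k l) => //; [exact: deg_ctr | move: hs; rewrite /= addnS eqSS].
Qed.

(** Each of the two terms of the Leibniz rule turns into the other one;
    passing the contracted form of degree k - 1 or l - 1 costs the sign that
    the twist [sg] gives back. *)
Lemma wdC k l A B : hasdeg k A -> hasdeg l B ->
  wdg A B = scl ((-1) ^+ (k * l)) (wdg B A).
Proof.
move=> hA hB; apply/funext => xs; rewrite /wdg.
elim: xs k l A B hA hB => [|x xs IH] k l A B hA hB /=.
  rewrite /scl /= mulrC; case: k hA => [|k] hA; first by rewrite mul0n mul1r.
  by rewrite hA // !(mulr0, mul0r).
have {}IH : forall k l A B, hasdeg k A -> hasdeg l B ->
  wdg A B xs = (-1) ^+ (k * l) * wdg B A xs by exact: IH.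
rewrite -!/(wdg _ _ _) /scl /= -!/(wdg _ _ _).
rewrite (sg_deg hA) (sg_deg hB) !wdZl /scl mulrDr addrC; congr (_ + _).
  case: l hB => [|l] hB; first by rewrite (deg_ctr0 _ hB) wd0r wd0l !mulr0.
  rewrite (IH k l _ _ hA (deg_ctr _ hB)) mulnS exprD mulrA //.
case: k hA => [|k] hA; first by rewrite (deg_ctr0 _ hA) wd0r wd0l !mulr0.
rewrite (IH k l _ _ (deg_ctr _ hA) hB) mulSn exprD.
by rewrite [(-1) ^+ l * _]mulrC -mulrA [(-1) ^+ l * _]mulrA -exprMn mulrNN mulr1 expr1n mul1r.
Qed.

Record altform (k : nat) A : Prop := AltForm {
  alt_deg : hasdeg k A;
  alt_lin : forall s1 s2 b c x y, A (s1 ++ (b *: x + c *: y) :: s2) =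
     f b * A (s1 ++ x :: s2) + f c * A (s1 ++ y :: s2);
  alt_alt : forall s1 s2 x, A (s1 ++ x :: x :: s2) = 0 }.

Lemma alt_ctr k A x : altform k.+1 A -> altform k (ctr x A).
Proof.
case=> h1 h2 h3; split; first exact: deg_ctr.
  by move=> s1 *; exact: (h2 (x :: s1)).
by move=> s1 *; exact: (h3 (x :: s1)).
Qed.

Lemma alt_l0 k : altform k l0.
Proof. by split => // *; rewrite /l0 !mulr0 addr0. Qed.

Lemma alt_scl k c A : altform k A -> altform k (scl c A).
Proof.
case=> h1 h2 h3; split; first exact: deg_scl.
  by move=> *; rewrite /scl h2 mulrDr !(mulrCA c).
by move=> *; rewrite /scl h3 mulr0.
Qed.

Lemma alt_add k A B : altform k A -> altform k B -> altform k (ladd A B).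
Proof.
move=> [h1 h2 h3] [h1' h2' h3']; split; first exact: deg_add.
  by move=> *; rewrite /ladd h2 h2'; ring.
by move=> *; rewrite /ladd h3 h3' addr0.
Qed.

Lemma alt_sg k A : altform k A -> altform k (sg A).
Proof. by move=> h; rewrite (sg_deg (alt_deg h)); apply: alt_scl. Qed.

Lemma alt_ctr_pred k A x : altform k A -> altform k.-1 (ctr x A).
Proof.
by case: k => [|k] h; [rewrite (deg_ctr0 _ (alt_deg h)); exact: alt_l0 | exact: alt_ctr].
Qed.

Lemma ctr_lin k A b c x y : altform k A ->
  ctr (b *: x + c *: y) A = ladd (scl (f b) (ctr x A)) (scl (f c) (ctr y A)).
Proof. by move=> h; apply/funext => xs; exact: (alt_lin h [::]). Qed.

Lemma alt_wd k l A B : altform k A -> altform l B -> altform (k + l)%N (wdg A B).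
Proof.
move=> hA hB; split; first exact: deg_wd (alt_deg hA) (alt_deg hB).
- move=> s1 s2 b c x y; rewrite /wdg.
  elim: s1 k l A B hA hB => [|z s1 IH] k l A B hA hB /=.
    rewrite -!/(wdg _ _ _) (ctr_lin _ _ _ _ hA) (ctr_lin _ _ _ _ hB).
    by rewrite wdDl wdDr !wdZl !wdZr /ladd /scl; ring.
  rewrite (IH _ _ _ _ (alt_ctr_pred z hA) hB) (IH _ _ _ _ (alt_sg hA) (alt_ctr_pred z hB)).
  by ring.
move=> s1 s2 x; rewrite /wdg.
elim: s1 k l A B hA hB => [|z s1 IH] k l A B hA hB /=; last first.
  by rewrite (IH _ _ _ _ (alt_ctr_pred z hA) hB) (IH _ _ _ _ (alt_sg hA) (alt_ctr_pred z hB)) addr0.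
rewrite -!/(wdg _ _ _) ctr_sg.
have E C j : altform j C -> ctr x (ctr x C) = l0.
  by move=> h; apply/funext => xs; exact: (alt_alt h [::]).
rewrite (E _ _ hA) (E _ _ hB) wd0l wd0r wdZl /l0 /scl; ring.
Qed.

Lemma alt_anti k A s1 s2 x y : altform k A ->
  A (s1 ++ x :: y :: s2) = - A (s1 ++ y :: x :: s2).
Proof.
move=> h; have E := alt_alt h s1 s2 (1 *: x + 1 *: y).
have L z : A (s1 ++ z :: 1 *: x + 1 *: y :: s2) =
    A (s1 ++ z :: x :: s2) + A (s1 ++ z :: y :: s2).
  have := alt_lin h (rcons s1 z) s2 1 1 x y.
  by rewrite !cat_rcons rmorph1 !mul1r.
move: E; rewrite (alt_lin h) !L !(alt_alt h) rmorph1 !mul1r addr0 add0r.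
by move/eqP; rewrite addr_eq0 => /eqP.
Qed.

Lemma alt_move k A s1 s2 x : altform k A ->
  A (s1 ++ x :: s2) = (-1) ^+ size s1 * A (x :: s1 ++ s2).
Proof.
move=> h; elim/last_ind: s1 s2 => [|s1 y IH] s2 /=; first by rewrite mul1r.
by rewrite cat_rcons (alt_anti _ _ _ _ h) IH size_rcons exprS mulN1r mulNr cat_rcons.
Qed.

Lemma alt_nonuniq k A s : altform k A -> ~~ uniq s -> A s = 0.
Proof.
move=> h; elim: s k A h => //= x s IH k A h; rewrite negb_and negbK.
case/orP => [|hs]; last first.
  exact: (IH _ _ (alt_ctr_pred x h) hs).
case/splitPr => s1 s2.
rewrite -[A _]/(A ((x :: s1) ++ x :: s2)) (alt_move _ _ _ h) /=.
by rewrite (alt_alt h [::]) mulr0.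
Qed.

Lemma alt_perm0 k A s s' : altform k A -> perm_eq s s' -> A s = 0 -> A s' = 0.
Proof.
move=> h; elim: s s' k A h => [|x s IH] s' k A h hp h0.
  by have /perm_nilP -> : perm_eq s' [::] by rewrite perm_sym.
have hx : x \in s' by rewrite -(perm_mem hp) mem_head.
case/splitPr: hx hp => s1 s2 hp.
rewrite (alt_move _ _ _ h).
rewrite [A _](IH (s1 ++ s2) _ (ctr x A) (alt_ctr_pred x h)) ?mulr0 //.
rewrite -(perm_cons x); apply: perm_trans hp _.
by apply/permPl; exact: (perm_catCA s1 [:: x] s2).
Qed.

Definition be (j : 'I_n) : V := delta_mx 0 j.

Lemma alt_sum k A s1 s2 (I : Type) (r : seq I) (c : I -> R0) (y : I -> V) :
  altform k A -> A (s1 ++ (\sum_(j <- r) c j *: y j) :: s2) =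
  \sum_(j <- r) f (c j) * A (s1 ++ y j :: s2).
Proof.
move=> h; elim: r => [|j r IH].
  rewrite !big_nil; have := alt_lin h s1 s2 0 0 0 0.
  by rewrite !scale0r addr0 rmorph0 !mul0r addr0.
by rewrite !big_cons -[X in _ + X]scale1r (alt_lin h) IH rmorph1 mul1r.
Qed.

Lemma row_be x : x = \sum_j x 0 j *: be j.
Proof. exact: row_sum_delta. Qed.

Lemma alt_exp k A s1 s2 x : altform k A ->
  A (s1 ++ x :: s2) = \sum_j f (x 0 j) * A (s1 ++ be j :: s2).
Proof. by move=> h; rewrite {1}[x]row_be (alt_sum _ _ _ _ _ h). Qed.

(** Expands the arguments one by one, collecting basis vectors at the front
    of the list. *)
Lemma alt_basis0 k A : altform k A ->
  (forall js : seq 'I_n, size js = k -> A (map be js) = 0) -> A = l0.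
Proof.
move=> h h0; apply/funext => xs.
have [hs|/(alt_deg h)//] := eqVneq (size xs) k.
suff E : forall js, (size js + size xs)%N = k -> A (map be js ++ xs) = 0.
  exact: (E [::]).
elim: xs {hs} => [|x xs IH] js hj; first by rewrite cats0 h0 // -hj addn0.
rewrite (alt_exp _ _ _ h) big1 // => j _.
by rewrite -cat_rcons -map_rcons IH ?mulr0 // size_rcons addSnnS.
Qed.

(** More than n basis vectors contain a repetition. *)
Lemma alt_gt_dim k A : altform k A -> (n < k)%N -> A = l0.
Proof.
move=> h hk; apply: (alt_basis0 h) => js hj; apply: (alt_nonuniq h).
apply/negP => /map_uniq /card_uniqP hc.
by have := max_card (mem js); rewrite hc hj card_ord leqNgt hk.
Qed.

Definition bas : seq V := map be (enum 'I_n).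

(** A list of n distinct basis vectors is a permutation of the basis. *)
Lemma top_form_eq0 A : altform n A -> A bas = 0 -> A = l0.
Proof.
move=> h h0; apply: (alt_basis0 h) => js hj.
have [u|u] := boolP (uniq js); last first.
  apply: (alt_nonuniq h); apply: contra u; exact: map_uniq.
apply: (alt_perm0 h _ h0); apply: perm_map; apply: uniq_perm => //; first exact: enum_uniq.
have hs : {subset js <= enum 'I_n} by move=> j _; rewrite mem_enum.
have hz : (size (enum 'I_n) <= size js)%N by rewrite hj size_enum_ord.
by have [_ E] := uniq_min_size u hs hz.
Qed.

Lemma top_form_prop (th A : lform) : altform n th -> altform n A -> th bas != 0 ->
  A = scl (A bas / th bas) th.
Proof.
move=> ht hA t0; have E : ladd A (scl (- (A bas / th bas)) th) = l0.
  apply: top_form_eq0; first exact: (alt_add hA (alt_scl _ ht)).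
  by rewrite /ladd /scl mulNr mulfVK // subrr.
apply/funext => xs; have := congr1 (fun h => h xs) E.
by rewrite /ladd /scl /l0 mulNr => /eqP; rewrite subr_eq0 => /eqP.
Qed.

End ListForms.

Section Covectors.
Variables (R0 : fieldType) (F : numFieldType) (f : {rmorphism R0 -> F}) (n : nat).
Local Notation V := 'rV[R0]_n.
Local Notation lform := (lform R0 F n).
Local Notation altform := (@altform R0 F f n).
Implicit Types (k l : nat) (A B C eta : lform) (x y z : V) (xs ys s : seq V).

Lemma wd_deg0 A B : hasdeg 0 A -> wdg A B = scl (A [::]) B.
Proof.
move=> hA; apply/funext => xs; rewrite /wdg /scl.
elim: xs B => [|x xs IH] B //=.
by rewrite (deg_ctr0 _ hA) -!/(wdg _ _ _) wd0l (sg_deg hA) expr0 scl1 /wdg IH /l0 add0r.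
Qed.

Lemma ctr_wd1 eta A x : altform 1 eta ->
  ctr x (wdg eta A) = ladd (scl (eta [:: x]) A) (scl (-1) (wdg eta (ctr x A))).
Proof.
move=> h; rewrite ctr_wd (sg_deg (alt_deg h)) expr1 wdZl wd_deg0 //.
exact: (deg_ctr _ (alt_deg h)).
Qed.

Lemma wd_covector_eq0 eta A xs : altform 1 eta -> (forall x, x \in xs -> eta [:: x] = 0) ->
  wdg eta A xs = 0.
Proof.
move=> h; rewrite /wdg => h0; elim: xs A h0 => [|x xs IH] A h0 /=.
  by rewrite (alt_deg h) // mul0r.
have -> : wd xs (ctr x eta) A = 0.
  rewrite -/(wdg _ _ _) wd_deg0; last exact: (deg_ctr _ (alt_deg h)).
  by rewrite /scl /ctr h0 ?mem_head // mul0r.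
rewrite (sg_deg (alt_deg h)) -/(wdg _ _ _) wdZl /scl /wdg IH ?mulr0 ?addr0 //.
by move=> y hy; apply: h0; rewrite inE hy orbT.
Qed.

Definition dx (j : 'I_n) : lform := fun xs => if xs is [:: x] then f (x 0 j) else 0.

Lemma alt_dx j : altform 1 (dx j).
Proof.
split; first by case=> [|x [|y xs]].
- case=> [|? [|? ?]] [|? ?] b c x y; rewrite /= ?mulr0 ?addr0 //.
  by rewrite !mxE rmorphD !rmorphM.
- by case=> [|? [|? ?]].
Qed.

Lemma dx_be i j : dx j [:: be R0 i] = (i == j)%:R.
Proof. by rewrite /dx /be mxE eqxx /= [j == i]eq_sym rmorph_nat. Qed.

(** Let A be evaluated on k < n basis vectors and let be_j be another one:
    contracting 0 = dx_j /\ A with be_j gives A = dx_j /\ i_{be_j} A, where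
    dx_j kills all the arguments. *)
Lemma alt_eq0_dx k A : altform k A -> (k < n)%N ->
  (forall j, wdg (dx j) A = @l0 _ _ _) -> A = @l0 _ _ _.
Proof.
move=> h hk h0; apply: (alt_basis0 h) => js hj.
have [j hjs] : exists j, j \notin js.
  apply: contrapT => hn.
  have hs : {subset enum 'I_n <= js}.
    by move=> i _; apply: contrapT => /negP hi; apply: hn; exists i.
  have := uniq_leq_size (enum_uniq _) hs.
  by rewrite size_enum_ord hj leqNgt hk.
have E := ctr_wd1 A (be R0 j) (alt_dx j).
have := congr1 (fun h => h (map (@be R0 n) js)) E.
rewrite h0 dx_be eqxx scl1 /ladd /scl wd_covector_eq0; first last.
- by move=> x /mapP[i hi ->]; rewrite dx_be; case: eqP hi hjs => // -> ->.
- exact: alt_dx.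
by rewrite mulr0 addr0 => <-.
Qed.

(** The counting operator: sum_j dx_j /\ i_{be_j} is a derivation of the
    exterior algebra that is the identity on covectors. *)
Lemma euler k A xs : altform k A ->
  \sum_j wdg (dx j) (ctr (be R0 j) A) xs = (size xs)%:R * A xs.
Proof.
move=> h; rewrite /wdg; elim: xs k A h => [|x xs IH] k A h.
  by rewrite mul0r big1 // => j _; rewrite /= mul0r.
transitivity (\sum_j (f (x 0 j) * A (be R0 j :: xs) +
    wd xs (dx j) (ctr (be R0 j) (ctr x A)))).
  apply: eq_bigr => j _; rewrite -/(wdg _ _ _).
  have := congr1 (fun h => h xs) (ctr_wd1 (ctr (be R0 j) A) x (alt_dx j)).
  rewrite {1}/ctr => ->; rewrite /ladd {1}/scl /ctr /=; congr (_ + _).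
  have -> : (fun xs0 => A [:: be R0 j, x & xs0]) =
      scl (-1) (fun xs0 => A [:: x, be R0 j & xs0]).
    by apply/funext => ys; rewrite /scl (alt_anti [::] _ _ _ h) mulN1r.
  by rewrite wdZr sclA mulNr mulrN mulr1 opprK scl1.
have /= E := alt_exp [::] xs x h.
rewrite big_split /= -E (IH k.-1 _ (alt_ctr_pred x h)).
by rewrite /ctr -[in RHS]natr1 mulrDl mul1r addrC.
Qed.

Variable th : lform.
Hypotheses (ath : altform n th) (th0 : th (bas _ _) != 0).

(** Contract the form eta /\ th, which vanishes for degree reasons. *)
Lemma covector_wd_top eta x : altform 1 eta -> wdg eta (ctr x th) = scl (eta [:: x]) th.
Proof.
move=> h; have E := ctr_wd1 th x h.
rewrite (alt_gt_dim (alt_wd h ath) _) // in E.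
apply/funext => xs; have /esym := congr1 (fun h => h xs) E.
by rewrite /ladd /scl /ctr /l0 mulN1r => /eqP; rewrite subr_eq0 => /eqP.
Qed.

Lemma ctr_th_inj x y : ctr x th = ctr y th -> x = y.
Proof.
move=> E; apply/rowP => j; apply: (fmorph_inj f).
have := covector_wd_top y (alt_dx j); rewrite -E covector_wd_top; last exact: alt_dx.
by move/(congr1 (fun h => h (bas _ _))); rewrite /scl => /(mulIf th0).
Qed.

Lemma ctr_th0 x : ctr x th = @l0 _ _ _ -> x = 0.
Proof.
move=> E; apply: ctr_th_inj; rewrite E; apply/funext => xs.
have := alt_lin ath [::] xs 0 0 0 0.
by rewrite !scale0r addr0 rmorph0 !mul0r addr0.
Qed.

(** Contracting dx_j /\ i_x th = x_j th with y gives x_j i_y th = y_j i_x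
    th, because i_y i_x th = 0; choose j with x_j not 0. *)
Lemma colinear_of_ctr2 x y : ctr y (ctr x th) = @l0 _ _ _ -> x = 0 \/ exists c, y = c *: x.
Proof.
move=> E; have [->|/eqP/rowP hx] := eqVneq x 0; [by left | right].
have [j hj] : exists j, x 0 j != 0.
  apply: contrapT => hn; apply: hx => j; rewrite mxE; apply: contrapT => /eqP h.
  by apply: hn; exists j.
exists (y 0 j / x 0 j); apply: ctr_th_inj.
have H := ctr_wd1 (ctr x th) y (alt_dx j).
rewrite E wd0r scll0 ladd0 covector_wd_top in H; last exact: alt_dx.
have H' := ctr_lin (y 0 j / x 0 j) 0 x 0 ath.
rewrite scale0r addr0 rmorph0 scl0 ladd0 in H'; rewrite H'.
apply/funext => xs; have := congr1 (fun h => h xs) H.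
have hf : f (x 0 j) != 0 by rewrite fmorph_eq0.
rewrite /scl {1}/ctr /= fmorph_div => {}H.
by rewrite mulrAC -H mulrAC mulfV // mul1r.
Qed.

End Covectors.

Definition idR (R : realType) : {rmorphism (R : fieldType) -> (R : numFieldType)} := idfun.

Section RealTop.
Variables (R : realType) (n : nat).
Local Notation lform := (lform R R n.+1).
Local Notation altform := (@altform R R (idR R) n.+1).
Variable th : lform.
Hypotheses (ath : altform n.+1 th) (th0 : th (bas _ _) != 0).

(** The vector Y with i_Y th = s: by [covector_wd_top] its j-th coordinate
    is the quotient of dx_j /\ s by th. *)
Definition dualvec (s : lform) : 'rV[R]_n.+1 :=
  \row_j (wdg (dx (idR R) j) s (bas _ _) / th (bas _ _)).

Lemma dualvecP (s : lform) : altform n s -> ctr (dualvec s) th = s.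
Proof.
move=> hs.
have E : ladd (ctr (dualvec s) th) (scl (-1) s) = @l0 _ _ _.
  apply: (@alt_eq0_dx _ _ (idR R) _ n) => //.
    exact: (alt_add (alt_ctr _ ath) (alt_scl _ hs)).
  move=> j; have hj := @alt_dx R R (idR R) n.+1 j.
  rewrite wdDr wdZr (covector_wd_top ath _ hj) (top_form_prop ath (alt_wd hj hs) th0).
  by rewrite /dx mxE sclA mulN1r; apply/funext => xs; rewrite /ladd /scl mulNr subrr.
apply/funext => xs; have := congr1 (fun h => h xs) E.
by rewrite /ladd /scl /l0 mulN1r => /eqP; rewrite subr_eq0 => /eqP.
Qed.

End RealTop.

(** * Decomposable 3-forms *)

Section Decomposable.
Variables (R0 : fieldType) (F : numFieldType) (f : {rmorphism R0 -> F}) (n : nat).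
Local Notation V := 'rV[R0]_n.
Local Notation lform := (lform R0 F n).
Local Notation altform := (@altform R0 F f n).
Local Notation l0 := (@l0 R0 F n).
Implicit Types (k l : nat) (A B C e : lform) (x y z : V) (xs ys s : seq V).

Lemma wd_sum (I : Type) (r : seq I) (A : I -> lform) B xs :
  wdg (fun ys => \sum_(j <- r) A j ys) B xs = \sum_(j <- r) wdg (A j) B xs.
Proof.
elim: r => [|j r IH].
  rewrite big_nil (_ : (fun=> _) = l0) ?wd0l //.
  by apply/funext => ys; rewrite big_nil.
rewrite big_cons -IH -[in RHS]/(ladd (wdg _ _) (wdg _ _) xs) -wdDl.
by congr wdg; apply/funext => ys; rewrite big_cons.
Qed.

Lemma wd_odd0 k A : hasdeg k A -> odd k -> wdg A A = l0.
Proof.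
move=> hA ok; have := wdC hA hA; rewrite -signr_odd oddM ok /= expr1 => E.
apply/funext => xs; have := congr1 (fun h => h xs) E; rewrite /scl mulN1r.
move/eqP; rewrite -addr_eq0 -mulr2n -mulr_natr mulf_eq0 pnatr_eq0 orbF.
by move/eqP.
Qed.

(** Choose x1, x2, x3 with t = A (x1, x2, x3) not 0. Contracting (i_{x3}
    i_{x2} A) /\ A = 0 with x1 factors out one covector, t A = (i_{x3}
    i_{x2} A) /\ i_{x1} A; a further contraction splits the 2-form i_{x1} A
    in the same way. *)
Lemma pluecker A : altform 3 A -> A <> l0 ->
  (forall x y, wdg (ctr y (ctr x A)) A = l0) ->
  exists e1 e2 e3, [/\ altform 1 e1, altform 1 e2, altform 1 e3 &
    A = wdg (wdg e1 e2) e3].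
Proof.
move=> hA A0 hP.
have [x1 [x2 [x3 ht]]] : exists x1 x2 x3, A [:: x1; x2; x3] != 0.
  apply: contrapT => hn; apply: A0; apply/funext => xs.
  have [|/(alt_deg hA)//] := eqVneq (size xs) 3.
  case: xs => [|x1 [|x2 [|x3 []]]] // _; apply: contrapT => /eqP h.
  by apply: hn; exists x1, x2, x3.
set t := A _ in ht.
have h1 x y : altform 1 (ctr y (ctr x A)) by apply: alt_ctr; exact: alt_ctr.
have rot x y z : A [:: y; z; x] = A [:: x; y; z].
  by rewrite (alt_anti [:: y] [::] z x hA) (alt_anti [::] [:: z] y x hA) opprK.
have E1 : A = scl t^-1 (wdg (ctr x3 (ctr x2 A)) (ctr x1 A)).
  have := ctr_wd1 A x1 (h1 x2 x3); rewrite hP (_ : ctr x3 (ctr x2 A) _ = t); last exact: rot.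
  move=> E.
  apply/funext => xs; have := congr1 (fun h => h xs) E.
  rewrite /ladd /scl /= mulN1r => /esym/eqP; rewrite subr_eq0 => /eqP <-.
  by rewrite mulKf.
have E2 : wdg (ctr x1 (ctr x3 A)) (ctr x1 A) = l0.
  have := ctr_wd1 A x1 (h1 x3 x1); rewrite hP (_ : ctr x1 (ctr x3 A) _ = 0); last exact: (alt_alt hA [:: _]).
  move=> E.
  apply/funext => xs; have := congr1 (fun h => h xs) E.
  by rewrite /ladd /scl /= mul0r add0r mulN1r => /esym/eqP; rewrite oppr_eq0 => /eqP ->.
have E3 : ctr x1 A = scl t^-1 (wdg (ctr x1 (ctr x3 A)) (ctr x2 (ctr x1 A))).
  have := ctr_wd1 (ctr x1 A) x2 (h1 x3 x1); rewrite E2 (_ : ctr x1 (ctr x3 A) _ = t); last by rewrite /ctr /t 2!rot.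
  move=> E.
  apply/funext => xs; have := congr1 (fun h => h xs) E.
  rewrite /ladd /scl /= mulN1r => /esym/eqP; rewrite subr_eq0 => /eqP <-.
  by rewrite mulKf.
exists (scl (t^-1 * t^-1) (ctr x3 (ctr x2 A))), (ctr x1 (ctr x3 A)), (ctr x2 (ctr x1 A)).
split; [exact: alt_scl|exact: h1|exact: h1|].
by rewrite {1}E1 {1}E3 wdZr sclA -wdA wdZl.
Qed.

Section Dec.
Variables e1 e2 e3 : lform.
Hypotheses (h1 : altform 1 e1) (h2 : altform 1 e2) (h3 : altform 1 e3).
Let a := wdg (wdg e1 e2) e3.

Lemma alt_dec : altform 3 a.
Proof. exact: (alt_wd (alt_wd h1 h2) h3). Qed.

Let swap e e' A : altform 1 e -> altform 1 e' ->
  wdg e (wdg e' A) = scl (-1) (wdg e' (wdg e A)).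
Proof.
move=> he he'.
by rewrite !wdA (wdC (alt_deg he) (alt_deg he')) expr1 wdZl.
Qed.

Let sq e A : altform 1 e -> wdg e (wdg e A) = l0.
Proof. by move=> he; rewrite wdA (wd_odd0 (alt_deg he)) // wd0l. Qed.

Lemma dec_kill : [/\ wdg e1 a = l0, wdg e2 a = l0 & wdg e3 a = l0].
Proof.
rewrite /a -wdA; split; first by rewrite sq.
  by rewrite (swap _ h2 h1) sq // wd0r scll0.
rewrite (swap _ h3 h1) (swap _ h3 h2).
by rewrite (wd_odd0 (alt_deg h3)) // wd0r scll0 wd0r scll0.
Qed.

Lemma ctr_dec x : ctr x a = ladd (scl (e1 [:: x]) (wdg e2 e3))
  (ladd (scl (- e2 [:: x]) (wdg e1 e3)) (scl (e3 [:: x]) (wdg e1 e2))).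
Proof.
apply/funext => xs; rewrite /a -wdA (ctr_wd1 _ _ h1) (ctr_wd1 _ _ h2).
have -> : ctr x e3 = scl (e3 [:: x]) (fun ys => (ys == [::])%:R).
  apply/funext => -[|y ys]; rewrite /scl /ctr ?mulr1 //.
  by rewrite (alt_deg h3) // mulr0.
rewrite wdZr wdDr !wdZr.
have E A : hasdeg 1 A -> wdg A (fun ys => (ys == [::])%:R) = A.
  move=> hA; rewrite (wdC (l := 0) hA); last by case.
  rewrite muln0 expr0 scl1 wd_deg0; last by case.
  by rewrite scl1.
rewrite (E _ (alt_deg h2)).
by rewrite /ladd /scl; ring.
Qed.

Lemma dec_sq x : wdg (ctr x a) a = l0.
Proof.
have [k1 k2 k3] := dec_kill.
rewrite ctr_dec !wdDl !wdZl -!wdA k3 k2 !wd0r !scll0.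
by apply/funext => xs; rewrite /ladd /l0 !addr0.
Qed.

(** A decomposable form depends on its argument only through the three
    covectors. *)
Lemma dec_scale t x y : e1 [:: y] = t * e1 [:: x] -> e2 [:: y] = t * e2 [:: x] ->
  e3 [:: y] = t * e3 [:: x] -> ctr y a = scl t (ctr x a).
Proof.
move=> E1 E2 E3; rewrite !ctr_dec E1 E2 E3.
by apply/funext => xs; rewrite /ladd /scl; ring.
Qed.

End Dec.
End Decomposable.

(** An endomorphism for which every vector is an eigenvector is scalar:
    compare the eigenvalues of e_0, e_j and e_0 + e_j. *)
Lemma scalar_lin (R : fieldType) n (g : 'rV[R]_n.+1 -> 'rV[R]_n.+1) :
  (forall b c x y, g (b *: x + c *: y) = b *: g x + c *: g y) ->
  (forall x, exists c, g x = c *: x) -> exists c, forall x, g x = c *: x.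
Proof.
move=> gl ge; pose e j : 'rV[R]_n.+1 := be R j.
have [c hc] := ge (e 0); exists c.
have he j : g (e j) = c *: e j.
  have [d hd] := ge (e j); have [->//|j0] := eqVneq j 0.
  have [b hb] := ge (e 0 + e j).
  have := gl 1 1 (e 0) (e j); rewrite !scale1r hb hc hd => E.
  have := congr1 (fun u : 'rV__ => u 0 j) E; have := congr1 (fun u : 'rV__ => u 0 0) E.
  rewrite /e /be !mxE !eqxx /= (negbTE j0) [0 == j]eq_sym (negbTE j0) !(mulr0, mulr1, addr0, add0r).
  by move=> <- <-.
have gD x y : g (x + y) = g x + g y by rewrite -[x]scale1r -[y]scale1r gl !scale1r.
have gZ b x : g (b *: x) = b *: g x.
  by rewrite -[_ *: x]addr0 -{1}(scale0r 0) gl scale0r addr0.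
have g0 : g 0 = 0 by rewrite -{1}(scale0r 0) gZ scale0r.
move=> x; rewrite {1}[x]row_be (big_morph g gD g0).
rewrite [in RHS](row_be x) scaler_sumr; apply: eq_bigr => j _.
by rewrite gZ he !scalerA mulrC.
Qed.

(** * The Hitchin endomorphism of a 3-form in dimension 6 *)

Section Hitchin.
Variables (R0 : fieldType) (F : numFieldType) (f : {rmorphism R0 -> F}).
Local Notation V := 'rV[R0]_6.
Local Notation lform := (lform R0 F 6).
Local Notation altform := (@altform R0 F f 6).
Local Notation l0 := (@l0 R0 F 6).
Implicit Types (x y z : V) (xs : seq V).
Variables (th w : lform) (K : V -> V).
Hypotheses (ath : altform 6 th) (aw : altform 3 w) (th0 : th (bas _ _) != 0).
Hypothesis hK : forall x, ctr (K x) th = wdg (ctr x w) w.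

Let two0 : (2%:R : F) != 0. Proof. by rewrite pnatr_eq0. Qed.
Let tau x y := ctr y (ctr x w).
Let P x y := wdg (tau x y) w.
Let Q x y := wdg (ctr x w) (ctr y w).
Let aw2 x : altform 2 (ctr x w). Proof. exact: alt_ctr. Qed.
Let atau x y : altform 1 (tau x y). Proof. exact/alt_ctr/alt_ctr. Qed.
Let thC x y xs : th [:: x, y & xs] = - th [:: y, x & xs].
Proof. exact: (alt_anti [::] _ _ _ ath). Qed.
Let th1 x xs : th [:: x, x & xs] = 0. Proof. exact: (alt_alt ath [::]). Qed.
Let wC x y xs : w [:: x, y & xs] = - w [:: y, x & xs].
Proof. exact: (alt_anti [::] _ _ _ aw). Qed.
Let wC' x y z xs : w [:: x, y, z & xs] = - w [:: x, z, y & xs].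
Proof. exact: (alt_anti [:: x] _ _ _ aw). Qed.

Lemma K_lin b c x y : K (b *: x + c *: y) = b *: K x + c *: K y.
Proof.
apply: (ctr_th_inj ath th0); rewrite hK (ctr_lin _ _ _ _ aw) wdDl !wdZl -!hK.
by rewrite (ctr_lin _ _ _ _ ath).
Qed.

(* P x y = (i_y i_x w) /\ w is antisymmetric in (x, y), and Q x y = i_x w /\
   i_y w is symmetric: the two parts of i_y i_{Kx} th. *)
Let e0 x y xs : th [:: K x, y & xs] = P x y xs + Q x y xs.
Proof.
have := congr1 (fun h => h xs) (congr1 (ctr y) (hK x)).
rewrite ctr_wd (sg_deg (alt_deg (aw2 x))) sqrrN expr1n scl1.
by [].
Qed.

Let QC x y : Q x y = Q y x.
Proof.
by rewrite /Q (wdC (alt_deg (aw2 x)) (alt_deg (aw2 y))) -signr_odd /= expr0 scl1.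
Qed.

Let PC x y xs : P x y xs = - P y x xs.
Proof.
rewrite /P (_ : tau x y = scl (-1) (tau y x)) ?wdZl /scl ?mulN1r //.
by apply/funext => ys; rewrite /scl mulN1r; exact: wC.
Qed.

Let Q2 x y xs : 2%:R * Q x y xs = th [:: K x, y & xs] + th [:: K y, x & xs].
Proof. by rewrite !e0 (PC y) (QC y); ring. Qed.
Let P2 x y xs : 2%:R * P x y xs = th [:: K x, y & xs] - th [:: K y, x & xs].
Proof. by rewrite !e0 (PC y) (QC y); ring. Qed.

Let tau_th x y A z xs : wdg (tau x y) (ctr z (ctr A th)) xs =
  tau x y [:: z] * th (A :: xs) - tau x y [:: A] * th (z :: xs).
Proof.
have := congr1 (fun h => h xs) (ctr_wd1 (ctr A th) z (atau x y)).
rewrite (covector_wd_top ath _ (atau x y)) /ladd /scl /ctr -!/(ctr _ _) mulN1r => ->.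
by ring.
Qed.

(* With the covector tau = i_y i_x w, expand tau /\ (tau /\ w) = 0 by [P2] and
   [tau_th]: tau (K y) i_y i_x th = 0. If tau (K y) is not 0, then x and y are
   colinear and tau is 0. *)
Let I0 x y : w [:: x; y; K y] = 0.
Proof.
have E : wdg (tau x y) (scl 2%:R (P x y)) = l0.
  by rewrite wdZr wdA (wd_odd0 (alt_deg (atau x y))) // wd0l scll0.
have E' : scl 2%:R (P x y) =
    ladd (ctr y (ctr (K x) th)) (scl (-1) (ctr x (ctr (K y) th))).
  by apply/funext => xs; rewrite /scl /ladd P2 mulN1r.
rewrite E' wdDr wdZr in E.
have [->|t0] := eqVneq (w [:: x; y; K y]) 0; first by [].
have [|->|[c ->]] := @colinear_of_ctr2 _ _ f _ th ath th0 x y.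
- apply/funext => xs; have := congr1 (fun h => h (y :: xs)) E.
  have ty : tau x y [:: y] = 0 by exact: (alt_alt aw [:: x]).
  have tx : tau x y [:: x] = 0.
    by rewrite /tau /ctr wC' (alt_alt aw [::]) oppr0.
  rewrite /ladd /scl !tau_th ty tx th1 /l0 mulN1r !mulr0 !mul0r !sub0r oppr0 add0r opprK.
  by move=> /eqP; rewrite mulf_eq0 (negPf t0 : tau x y [:: K y] == 0 = false) => /eqP.
- have := alt_lin aw [::] [:: y; K y] 0 0 0 0.
  by rewrite scale0r addr0 rmorph0 !mul0r addr0.
have := alt_lin aw [:: x] [:: K (c *: x)] c 0 x 0.
by rewrite scale0r addr0 rmorph0 !mul0r addr0 /= => ->; rewrite (alt_alt aw [::]) mulr0.
Qed.

Let I1 x y z : w [:: x; y; K z] = w [:: x; K y; z].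
Proof.
have := I0 x (1 *: y + 1 *: z); rewrite K_lin.
rewrite (alt_lin aw [:: x]) (alt_lin aw [:: x; y] [::]) (alt_lin aw [:: x; z] [::]) /=.
rewrite rmorph1 !mul1r !I0 addr0 add0r => /eqP.
by rewrite addr_eq0 => /eqP ->; rewrite wC' opprK.
Qed.

(** Polarisation of w (x, y, K y) = 0. *)
Lemma K_sym x y xs : w [:: K x, y & xs] = w [:: x, K y & xs].
Proof.
have [|h] := eqVneq (size xs) 1; last by rewrite !(alt_deg aw).
case: xs => [|z []] // _; rewrite wC -I1 wC opprK.
by rewrite I1.
Qed.

(* The covector i_x i_{Kx} w vanishes, hence so do P (K x) x and P x (K x);
   thus i_x i_{KKx} th = Q (K x) x = i_{Kx} i_{Kx} th = 0. *)
Let KK0 x xs : th [:: K (K x), x & xs] = 0.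
Proof.
have t0 : tau (K x) x = l0.
  apply/funext => ys; rewrite /tau /ctr /l0.
  have := K_sym x x ys; rewrite wC => /esym/eqP.
  rewrite -addr_eq0 -mulr2n -mulr_natr mulf_eq0 (negPf two0) orbF => /eqP E.
  by rewrite E oppr0.
have t0' : tau x (K x) = l0.
  apply/funext => ys; rewrite /tau /ctr wC; have := congr1 (fun h => h ys) t0.
  by rewrite /tau /ctr /l0 => ->; rewrite oppr0.
have := e0 (K x) x xs; rewrite /P t0 wd0l /l0 add0r => ->.
have := e0 x (K x) xs; rewrite /P t0' wd0l /l0 add0r QC => <-.
by rewrite th1.
Qed.

(** Since i_x i_{KKx} th = 0, the vector K (K x) is a multiple of x for
    every x. *)
Lemma K_scalar : exists lam, forall x, K (K x) = lam *: x.
Proof.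
apply: scalar_lin; first by move=> *; rewrite !K_lin.
move=> x; have [||[c ->]] := @colinear_of_ctr2 _ _ f _ th ath th0 x (K (K x)).
- by apply/funext => xs; rewrite /ctr thC KK0 oppr0.
- move=> ->; exists 0; rewrite scale0r.
  have K0 : K 0 = 0.
    by have := K_lin 0 0 0 0; rewrite !scale0r addr0.
  by rewrite !K0.
by exists c.
Qed.

Variable lam : R0.
Hypothesis hlam : forall x, K (K x) = lam *: x.

(** The form that is called g in the introduction. *)
Definition wK : lform := fun xs => if xs is x :: xs' then w (K x :: xs') else 0.

Lemma ctr_wK x : ctr x wK = ctr (K x) w. Proof. by []. Qed.

Lemma alt_wK : altform 3 wK.
Proof.
split.
- by case=> [|x xs] // h; rewrite /wK (alt_deg aw).
- case=> [|z s1] s2 b c x y /=; last exact: (alt_lin aw (K z :: s1)).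
  by rewrite K_lin (alt_lin aw [::]).
case=> [|z s1] s2 x /=; last exact: (alt_alt aw (K z :: s1)).
have := K_sym x x s2; rewrite wC => /eqP; rewrite eq_sym.
rewrite -addr_eq0 -mulr2n -mulr_natr mulf_eq0 (negPf two0) orbF => /eqP E.
by rewrite E oppr0.
Qed.

Let th_lam x xs : th (lam *: x :: xs) = f lam * th (x :: xs).
Proof.
have := alt_lin ath [::] xs lam 0 x 0.
by rewrite scale0r addr0 rmorph0 mul0r addr0.
Qed.

(* The top form wK /\ w is mu th for some mu. Contracting with x gives i_x w
   /\ wK = (lam - mu) i_x th, and multiplying by dx_j for x = be_j and summing
   over j counts degrees: - 3 mu = 6 (lam - mu), that is mu = 2 lam. *)
Let wKw : wdg wK w = scl (2%:R * f lam) th.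
Proof.
have awk := alt_wK.
have := top_form_prop ath (alt_wd awk aw) th0; set mu := _ / _ => E.
have G x xs : wdg (ctr x w) wK xs = (f lam - mu) * th (x :: xs).
  have := congr1 (fun h => h xs) (congr1 (ctr x) E).
  rewrite ctr_wd ctr_wK -hK hlam (sg_deg (alt_deg awk)) wdZl.
  rewrite (wdC (alt_deg awk) (alt_deg (aw2 x))) sclA /ladd /scl /ctr th_lam.
  by move=> H; apply: (eq_comb1 (-1) H); ring.
(* The counting operator on the 3-form w, and then on the 6-form th. *)
have S1 : \sum_j wdg (dx f j) (wdg (ctr (be R0 j) w) wK) (bas _ _) =
    3%:R * wdg w wK (bas _ _).
  under eq_bigr do rewrite wdA.
  rewrite -wd_sum -[RHS]/(scl 3%:R (wdg w wK) _) -wdZl; congr wdg.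
  apply/funext => ys; rewrite (euler _ aw) /scl.
  by have [->//|h] := eqVneq (size ys) 3; rewrite (alt_deg aw) // !mulr0.
have S2 : \sum_j wdg (dx f j) (wdg (ctr (be R0 j) w) wK) (bas _ _) =
    (f lam - mu) * (6%:R * th (bas _ _)).
  have sb : size (bas R0 6) = 6 by rewrite size_map size_enum_ord.
  have := euler (bas R0 6) ath; rewrite sb => <-; rewrite mulr_sumr; apply: eq_bigr => j _.
  rewrite (_ : wdg (ctr _ w) wK = scl (f lam - mu) (ctr (be R0 j) th)) ?wdZr //.
  by apply/funext => ys; rewrite G.
have S3 : wdg w wK (bas _ _) = - mu * th (bas _ _).
  rewrite (wdC (alt_deg aw) (alt_deg awk)) E /scl.
  by ring.
rewrite E; congr scl; apply: (mulIf th0).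
rewrite S1 S3 in S2.
have three : (3%:R : F) != 0 by rewrite pnatr_eq0.
apply: (mulfI three).
by apply: (eq_comb1 1 S2); ring.
Qed.

Let GK x xs : wdg (ctr x w) wK xs = - f lam * th (x :: xs).
Proof.
have awk := alt_wK.
have := congr1 (fun h => h xs) (congr1 (ctr x) wKw).
rewrite ctr_wd ctr_wK -hK hlam (sg_deg (alt_deg awk)) wdZl.
rewrite (wdC (alt_deg awk) (alt_deg (aw2 x))) sclA /ladd /scl /ctr th_lam.
by move=> H; apply: (eq_comb1 (-1) H); ring.
Qed.

Let tauK x y xs : 2%:R * wdg (tau x y) wK xs =
  - (f lam * th [:: x, y & xs] + th [:: K x, K y & xs]).
Proof.
have := congr1 (fun h => h xs) (ctr_wd y (ctr x w) wK).
rewrite {1}/ctr GK (sg_deg (alt_deg (aw2 x))) sqrrN expr1n scl1 ctr_wK.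
rewrite /ladd -/(Q _ _) -/(tau _ _) => H.
have := Q2 x (K y) xs; rewrite hlam th_lam (thC y x) => H'.
by apply: (eq_comb2 (-2%:R) (-1) H H'); ring.
Qed.

Section Split.
Variable p : F.
Hypothesis hp : p ^+ 2 * f lam = 1.
(** For q * q * lam = 1 this is the component of w on which contraction
    through K is multiplication by the inverse of q. *)
Definition half (e : F) : lform := ladd (scl 2%:R^-1 w) (scl (2%:R^-1 * e) wK).

Lemma alt_half e : altform 3 (half e).
Proof. by apply: alt_add; apply: alt_scl => //; exact: alt_wK. Qed.

Lemma half_add xs : w xs = half p xs + half (- p) xs.
Proof. by rewrite /half /ladd /scl; field. Qed.

(** The Pluecker relations: by [P2] and [tauK] the four products that occur
    are combinations of the contractions of th with x or K x and with y or K
    y, and the coefficients cancel when q * q * lam = 1. *)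
Lemma half_tau q x y : q ^+ 2 * f lam = 1 -> wdg (ctr y (ctr x (half q))) (half q) = l0.
Proof.
move=> hq; apply/funext => xs.
rewrite (_ : ctr y (ctr x (half q)) = ladd (scl 2%:R^-1 (tau x y))
   (scl (2%:R^-1 * q) (tau (K x) y))) // /half !wdDl !wdDr !wdZl !wdZr.
rewrite /ladd /scl /l0 -!/(P _ _).
have H1 := P2 x y xs; have H2 := P2 (K x) y xs.
have H3 := tauK x y xs; have H4 := tauK (K x) y xs.
rewrite hlam !th_lam in H2 H4.
rewrite (thC (K y)) in H1; rewrite (thC (K y)) in H2.
set a1 := P x y xs in H1 *; set a2 := P (K x) y xs in H2 *.
set a3 := wdg _ _ _ in H3 *; set a4 := wdg _ _ _ in H4 *.
have D1 : a1 = 2%:R^-1 * (2%:R * a1) by rewrite mulKf.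
have D2 : a2 = 2%:R^-1 * (2%:R * a2) by rewrite mulKf.
have D3 : a3 = 2%:R^-1 * (2%:R * a3) by rewrite mulKf.
have D4 : a4 = 2%:R^-1 * (2%:R * a4) by rewrite mulKf.
rewrite D1 D2 D3 D4 H1 H2 H3 H4 {D1 D2 D3 D4 H1 H2 H3 H4}.
set u := th _; set v := th _; set h := 2%:R^-1.
by apply: (eq_comb1 (- h ^+ 3 * (u + v)) hq); ring.
Qed.

Lemma half_wd : wdg (half p) (half (- p)) = scl (p * f lam) th.
Proof.
rewrite /half !wdDl !wdDr !wdZl !wdZr.
rewrite (wd_odd0 (alt_deg aw)) // (wd_odd0 (alt_deg alt_wK)) //.
rewrite (wdC (alt_deg aw) (alt_deg alt_wK)) wKw.
by apply/funext => xs; rewrite /ladd /scl /l0; field.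
Qed.

(** Otherwise the product [half_wd] of the two halves would vanish. *)
Lemma half_neq0 q : q ^+ 2 = p ^+ 2 -> half q <> l0.
Proof.
move=> hq E.
have nz : p * f lam != 0.
  apply/eqP => h; move: hp; rewrite expr2 -mulrA h mulr0 => /eqP.
  by rewrite eq_sym oner_eq0.
have : scl (p * f lam) th = l0.
  rewrite -half_wd; move/eqP: hq; rewrite eqf_sqr => /orP[]/eqP <-.
    by rewrite E wd0l.
  by rewrite E wd0r.
move/(congr1 (fun h => h (bas _ _))); rewrite /scl /l0 => /eqP.
by rewrite mulf_eq0 (negPf nz) (negPf th0).
Qed.

Lemma half_dec q : q ^+ 2 = p ^+ 2 -> exists e1 e2 e3,
  [/\ altform 1 e1, altform 1 e2, altform 1 e3 & half q = wdg (wdg e1 e2) e3].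
Proof.
move=> hq; apply: (pluecker (alt_half q)); first exact: half_neq0.
by move=> x y; apply: half_tau; rewrite hq.
Qed.

End Split.

Section Determination.
Variables (e1 e2 e3 b : lform) (t : F).
Hypotheses (h1 : altform 1 e1) (h2 : altform 1 e2) (h3 : altform 1 e3).
Hypotheses (ab : altform 3 b) (bsq : forall x, wdg (ctr x b) b = l0).
Let a := wdg (wdg e1 e2) e3.
Hypothesis hw : w = ladd a b.
Hypothesis hab : wdg a b = scl t th.

(** A covector e dividing a satisfies e (K x) th = e /\ i_{Kx} th = e /\ i_x
    w /\ w = e (x) a /\ b, hence e (K x) = t e (x). This holds for the three
    covectors of a. *)
Lemma dec_K x : ctr (K x) a = scl t (ctr x a).
Proof.
have aa := alt_dec h1 h2 h3.
have Hk : ctr (K x) th = ladd (wdg (ctr x a) b) (wdg a (ctr x b)).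
  rewrite hK {1 2}hw (_ : ctr x (ladd a b) = ladd (ctr x a) (ctr x b)) //.
  rewrite wdDl !wdDr bsq (dec_sq h1 h2 h3).
  rewrite (wdC (alt_deg aa) (alt_deg (alt_ctr x ab))) /= -signr_odd expr0 scl1.
  by apply/funext => xs; rewrite /ladd /l0 add0r addr0.
have E e : altform 1 e -> wdg e a = l0 -> e [:: K x] = t * e [:: x].
  move=> he ea; apply: (mulIf th0).
  have := covector_wd_top ath (K x) he; rewrite Hk wdDr (wdA e (ctr x a) b) (wdA e a (ctr x b)) ea wd0l ladd0.
  have -> : wdg e (ctr x a) = scl (e [:: x]) a.
    have := ctr_wd1 a x he; rewrite ea => H; apply/funext => xs.
    have := congr1 (fun h => h xs) H; rewrite /ladd /scl /ctr /l0 mulN1r.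
    by move/esym/eqP; rewrite subr_eq0 => /eqP.
  rewrite wdZl hab sclA => /(congr1 (fun h => h (bas _ _))).
  by rewrite /scl => <-; rewrite [t * _]mulrC.
have [k1 k2 k3] := dec_kill h1 h2 h3.
exact: (dec_scale h1 h2 h3 (E _ h1 k1) (E _ h2 k2) (E _ h3 k3)).
Qed.

End Determination.

(** The decomposition of w is unique: contraction through K is t on a and -
    t on b, so wK = t (a - b), and applying K twice gives t * t = lam. *)
Lemma decomposition_wK (e1 e2 e3 g1 g2 g3 : lform) (t : F) :
  altform 1 e1 -> altform 1 e2 -> altform 1 e3 ->
  altform 1 g1 -> altform 1 g2 -> altform 1 g3 -> lam != 0 ->
  let a := wdg (wdg e1 e2) e3 in let b := wdg (wdg g1 g2) g3 in
  w = ladd a b -> wdg a b = scl t th ->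
  t ^+ 2 = f lam /\ forall xs, wK xs = t * (a xs - b xs).
Proof.
move=> h1 h2 h3 k1 k2 k3 lam0 a b hw hab.
have aa := alt_dec h1 h2 h3; have bb := alt_dec k1 k2 k3.
have Ka := dec_K h1 h2 h3 bb (dec_sq k1 k2 k3) hw hab.
have hw' : w = ladd b a by rewrite hw; apply/funext => xs; rewrite /ladd addrC.
have hba : wdg b a = scl (- t) th.
  rewrite (wdC (alt_deg bb) (alt_deg aa)) hab sclA.
  by congr scl; rewrite -signr_odd expr1 mulN1r.
have Kb := dec_K k1 k2 k3 aa (dec_sq h1 h2 h3) hw' hba.
have Kae x xs : a (K x :: xs) = t * a (x :: xs).
  exact: (congr1 (fun h => h xs) (Ka x)).
have Kbe x xs : b (K x :: xs) = - t * b (x :: xs).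
  exact: (congr1 (fun h => h xs) (Kb x)).
split; last first.
  case=> [|x xs]; last by rewrite /= hw /ladd Kae Kbe; ring.
  have a0 : a [::] = 0 by exact: (alt_deg aa).
  have b0 : b [::] = 0 by exact: (alt_deg bb).
  by rewrite a0 b0 subrr mulr0.
have [x [xs hx]] : exists x xs, w (x :: xs) != 0.
  apply: contrapT => hn; move/eqP: lam0; apply.
  have K0 x : K x = 0.
    apply: (ctr_th0 ath th0); rewrite hK.
    rewrite (_ : ctr x w = l0) ?wd0l //; apply/funext => xs.
    by apply: contrapT => /eqP h; apply: hn; exists x, xs.
  have := hlam (be R0 0); rewrite !K0 => /(congr1 (fun u : 'rV__ => u 0 0)).
  by rewrite !mxE eqxx mulr1.
apply: (mulIf hx); have := congr1 (fun y => w (y :: xs)) (hlam x).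
have := alt_lin aw [::] xs lam 0 x 0; rewrite scale0r addr0 rmorph0 mul0r addr0 => ->.
move=> /= <-; rewrite !hw /ladd !Kae !Kbe; ring.
Qed.

End Hitchin.

(** * The wedge product as a sum over permutations *)

Section PermutationSum.
Variables (R0 : fieldType) (F : numFieldType) (f : {rmorphism R0 -> F}) (n : nat).
Local Notation V := 'rV[R0]_n.
Local Notation lform := (lform R0 F n).
Local Notation altform := (@altform R0 F f n).
Local Notation l0 := (@l0 R0 F n).
Implicit Types (m k l p : nat) (A B : lform) (x : V) (xs ys : seq V).

(** Sorts the permutations by the position p at which the index 0 appears. *)
Lemma sum_perm_lift m (G : 'S_m.+1 -> F) :
  \sum_s G s = \sum_p \sum_(s : 'S_m) G (lift_perm p ord0 s).
Proof.
pose h (u : 'I_m.+1 * 'S_m) := lift_perm u.1 ord0 u.2.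
have hinj : injective h.
  move=> [p s] [q t]; rewrite /h /= => E.
  have pq : p = q.
    by apply: (@perm_inj _ (lift_perm q ord0 t)); rewrite -{1}E !lift_perm_id.
  move: E; rewrite -pq => E; congr pair; apply/permP => i.
  apply: (@lift_inj _ ord0).
  by have := congr1 (fun u : 'S_m.+1 => u (lift p i)) E; rewrite !lift_perm_lift.
rewrite pair_bigA /= (reindex h) //.
apply: onW_bij; apply: inj_card_bij => //.
by rewrite card_prod card_ord !card_Sn factS.
Qed.

Definition permseq m (s : 'S_m) xs : seq V := [seq nth 0 xs (s i) | i <- enum 'I_m].

Lemma size_permseq m (s : 'S_m) xs : size (permseq s xs) = m.
Proof. by rewrite size_map size_enum_ord. Qed.

Lemma nth_permseq m (s : 'S_m) xs (i : 'I_m) : nth 0 (permseq s xs) i = nth 0 xs (s i).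
Proof. by rewrite (nth_map i) ?size_enum_ord // nth_ord_enum. Qed.

Definition ins p x ys := take p ys ++ x :: drop p ys.

Lemma permseq_lift m (p : 'I_m.+1) (s : 'S_m) x xs :
  permseq (lift_perm p ord0 s) (x :: xs) = ins p x (permseq s xs).
Proof.
have pm : (p <= m)%N by rewrite -ltnS.
have st : size (take p (permseq s xs)) = p by rewrite size_takel // size_permseq.
apply: (@eq_from_nth _ 0) => [|i].
  by rewrite size_permseq size_cat /= st size_drop size_permseq addnS subnKC.
rewrite size_permseq => im.
rewrite -[(i)]/(val (Ordinal im)) nth_permseq nth_cat st.
case: (unliftP p (Ordinal im)) => [k ->|->]; last first.
  by rewrite lift_perm_id ltnn subnn.
rewrite lift_perm_lift lift0 /= /bump; case: (leqP p k) => pk /=.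
  by rewrite add1n ltnNge (leqW pk) /= subSn //= nth_drop subnKC // nth_permseq.
by rewrite add0n pk nth_take // nth_permseq.
Qed.

(** The sum that defines the wedge product, before division by k! l!. *)
Definition perm_wedge m k A B xs : F := \sum_(s : 'S_m)
  (-1) ^+ s * A (take k (permseq s xs)) * B (drop k (permseq s xs)).

(** The first argument x appears at some position p. Moving it to the head
    of its factor, by alternation, makes the summand independent of p on
    each of the two sides p < k and p >= k. *)
Lemma perm_wedge_rec m k l A B x xs : altform k A -> altform l B -> m.+1 = (k + l)%N ->
  perm_wedge m.+1 k A B (x :: xs) = k%:R * perm_wedge m k.-1 (ctr x A) B xs
    + l%:R * ((-1) ^+ k * perm_wedge m k A (ctr x B) xs).
Proof.
move=> hA hB hm; rewrite {1}/perm_wedge sum_perm_lift.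
transitivity (\sum_(p < m.+1) (if (p < k)%N then perm_wedge m k.-1 (ctr x A) B xs
    else (-1) ^+ k * perm_wedge m k A (ctr x B) xs)); last first.
  rewrite {}hm big_split_ord /=; congr (_ + _).
    under eq_bigr do rewrite ltn_ord.
    by rewrite sumr_const card_ord mulr_natl.
  under eq_bigr do rewrite ltnNge leq_addr /=.
  by rewrite sumr_const card_ord mulr_natl.
apply: eq_bigr => p _; have pm : (p <= m)%N by rewrite -ltnS.
rewrite /perm_wedge; case: ltnP => pk; last rewrite mulr_sumr; apply: eq_bigr => s _;
  rewrite permseq_lift odd_lift_perm /= addbF signr_addb signr_odd;
  set ys := permseq s xs; have st : size (take p ys) = p
    by [rewrite size_takel // size_permseq].
  rewrite /ins take_cat drop_cat st ltnNge (ltnW pk) /= .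
  case E : (k - p)%N => [|d]; first by move/eqP: E; rewrite subn_eq0 leqNgt pk.
  have kE : k.-1 = (p + d)%N by rewrite -[d]/(d.+1.-1) -E; move: pk E; case: (k) => // k' *; lia.
  rewrite /= (alt_move _ _ _ hA) st kE takeD /ctr drop_drop addnC.
  rewrite !mulrA -[X in X * _ * _ = _]mulrA [X in X * _ * _ = _]mulrC.
  by rewrite -!mulrA [(-1) ^+ p * (_ * _)]mulrA -exprMn mulrNN mulr1 expr1n mul1r.
rewrite /ins take_cat drop_cat st; case: ltnP => kp.
  rewrite take_takel 1?ltnW // (alt_move _ _ _ hB) size_drop st /ctr.
  have -> : drop k (take p ys) ++ drop p ys = drop k ys.
    by rewrite -[in RHS](cat_take_drop p ys) drop_cat st kp.
  have -> : (-1) ^+ p = (-1) ^+ k * (-1) ^+ (p - k) :> F by rewrite -exprD subnKC.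
  set u := (-1) ^+ (p - k).
  have uu : u * u = 1 by rewrite -exprMn mulrNN mulr1 expr1n.
  set a := A _; set b := B _; set v := (-1) ^+ k; set z := (-1) ^+ s.
  by apply: (eq_comb1 (v * z * a * b) uu); ring.
have kE : k = p by apply/eqP; rewrite eqn_leq pk kp.
rewrite kE subnn take0 drop0 cats0 /ctr.
by rewrite !mulrA.
Qed.

Lemma perm_wedge_wd k l A B xs : altform k A -> altform l B -> size xs = (k + l)%N ->
  perm_wedge (k + l)%N k A B xs = (k`! * l`!)%:R * wdg A B xs.
Proof.
rewrite /wdg; move: {-2}(k + l)%N (erefl (k + l)%N) => m.
elim: xs m k l A B => [|x xs IH] m k l A B hm hA hB hs.
  have /eqP : (k + l)%N = 0%N by rewrite -hm -hs.
  rewrite addn_eq0 => /andP[/eqP k0 /eqP l0'].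
  have m0 : m = 0%N by rewrite -hs.
  rewrite m0 k0 l0' /= mul1r /perm_wedge (big_pred1 1%g).
    rewrite (size0nil (size_permseq (1%g : 'S_0) [::])) odd_perm1 mul1r //.
  by move=> s; apply/esym/eqP/permP; case.
case: m hm hs => [|m] hm // [hs].
rewrite (perm_wedge_rec _ _ hA hB (etrans hm _)) //.
rewrite [wd _ _ _]/= (sg_deg (alt_deg hA)) -!/(wdg _ _ _) wdZl /scl mulrDr.
congr (_ + _).
  case: k hm hA => [|k] hm hA.
    by rewrite mul0r (deg_ctr0 _ (alt_deg hA)) wd0l mulr0.
  move: hm; rewrite addSn => -[hm].
  rewrite (IH m k l) //; last exact: (alt_ctr _ hA).
  by rewrite factS -/(wdg _ _ _) !natrM !mulrA.
case: l hm hB => [|l] hm hB.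
  by rewrite mul0r (deg_ctr0 _ (alt_deg hB)) wd0r !mulr0.
move: hm; rewrite addnS => -[hm].
rewrite (IH m k l) //; last exact: (alt_ctr _ hB).
by rewrite factS -/(wdg _ _ _) !natrM; ring.
Qed.

End PermutationSum.

Section FormsAsLists.
Variables (R0 : fieldType) (F : numFieldType) (n : nat).
Local Notation V := 'rV[R0]_n.
Implicit Types (k l : nat) (x : V) (xs : seq V).

Definition mxl k xs : 'M[R0]_(k, n) := \matrix_(i < k) nth 0 xs i.
Definition rws k (M : 'M[R0]_(k, n)) : seq V := [seq row i M | i <- enum 'I_k].
Definition lf k (a : 'M[R0]_(k, n) -> F) : lform R0 F n :=
  fun xs => if size xs == k then a (mxl k xs) else 0.

Lemma size_rws k (M : 'M[R0]_(k, n)) : size (rws M) = k.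
Proof. by rewrite size_map size_enum_ord. Qed.

Lemma nth_rws k (M : 'M[R0]_(k, n)) (i : 'I_k) : nth 0 (rws M) i = row i M.
Proof. by rewrite (nth_map i) ?size_enum_ord // nth_ord_enum. Qed.

Lemma rwsK k (M : 'M[R0]_(k, n)) : mxl k (rws M) = M.
Proof. by apply/row_matrixP => i; rewrite rowK nth_rws. Qed.

Lemma mxlK k xs : size xs = k -> rws (mxl k xs) = xs.
Proof.
move=> h; apply: (@eq_from_nth _ 0) => [|i]; first by rewrite size_rws.
by rewrite size_rws => ik; rewrite -[(i)]/(val (Ordinal ik)) nth_rws rowK.
Qed.

Lemma lf_rws k (a : 'M[R0]_(k, n) -> F) M : lf a (rws M) = a M.
Proof. by rewrite /lf size_rws eqxx rwsK. Qed.

Lemma lf_deg k (a : 'M[R0]_(k, n) -> F) : hasdeg k (lf a).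
Proof. by move=> xs /negbTE h; rewrite /lf h. Qed.

Lemma lf_inj k (a b : 'M[R0]_(k, n) -> F) : lf a = lf b -> a = b.
Proof. by move=> E; apply/funext => M; rewrite -!lf_rws E. Qed.

Lemma mxl_cons k x xs : mxl k.+1 (x :: xs) = col_mx x (mxl k xs).
Proof.
apply/matrixP => i j; rewrite !mxE; case: splitP => u hu; rewrite ?hu.
  by rewrite ord1.
by rewrite !mxE.
Qed.

End FormsAsLists.

Section Bridge.
Variables (R : realType) (F : numFieldType) (f : {rmorphism R -> F}) (n : nat).

Lemma lf_wedge k l (a : form F R n k) (b : form F R n l) :
  altform f k (lf a) -> altform f l (lf b) ->
  lf (wedge a b) = wdg (lf a) (lf b).
Proof.
move=> ha hb; apply/funext => xs.
have [hs|hs] := eqVneq (size xs) (k + l)%N; last first.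
  by rewrite (deg_wd (alt_deg ha) (alt_deg hb)) // lf_deg.
have nz : (k`! * l`!)%:R != 0 :> F by rewrite pnatr_eq0 muln_eq0 !gtn_eqF // fact_gt0.
rewrite /lf hs eqxx /wedge; apply: (mulfI nz); rewrite mulrA mulfV // mul1r.
rewrite -(perm_wedge_wd ha hb hs) /perm_wedge; apply: eq_bigr => s _; congr (_ * _ * _).
  rewrite /lf size_takel ?size_permseq ?leq_addr // eqxx; congr a.
  apply/row_matrixP => i; rewrite rowK nth_take ?ltn_ord //.
  rewrite -[val i]/(val (lshift l i)) nth_permseq.
  by rewrite -(rowK (fun j : 'I_(k + l) => nth 0 xs j)); apply/rowP => j; rewrite !mxE.
rewrite /lf size_drop size_permseq addKn eqxx; congr b.
apply/row_matrixP => i; rewrite rowK nth_drop.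
rewrite -[(k + i)%N]/(val (rshift k i)) nth_permseq.
by rewrite -(rowK (fun j : 'I_(k + l) => nth 0 xs j)); apply/rowP => j; rewrite !mxE.
Qed.

End Bridge.

(** * From forms on matrices to forms on lists *)

Section MapForms.
Variables (R0 : fieldType) (F G : numFieldType).
Variables (f : {rmorphism R0 -> F}) (g : {rmorphism F -> G}) (n : nat).

Definition mapf (A : lform R0 F n) : lform R0 G n := fun xs => g (A xs).

Lemma wd_map (A B : lform R0 F n) : mapf (wdg A B) = wdg (mapf A) (mapf B).
Proof.
apply/funext => xs; rewrite /mapf /wdg.
elim: xs A B => [|x xs IH] A B /=; first by rewrite rmorphM.
rewrite rmorphD !IH; congr (_ + wd _ _ _).
by apply/funext => ys; rewrite /sg rmorphM rmorphXn rmorphN1.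
Qed.

End MapForms.

Lemma alt_map (R : realType) (G : numFieldType) (g : {rmorphism R -> G}) n k (A : lform R R n) :
  altform (idR R) k A -> altform g k (mapf g A).
Proof.
case=> h1 h2 h3; split; rewrite /mapf.
- by move=> xs /h1 ->; rewrite rmorph0.
- by move=> s1 s2 b c x y; rewrite h2 rmorphD !rmorphM.
by move=> s1 s2 x; rewrite h3 rmorph0.
Qed.

Section FormAlt.
Variables (R : realType) (n : nat).

Lemma row'_mxl k (s1 s2 : seq 'rV[R]_n) x y (i : 'I_k) : size s1 = i ->
  row' i (mxl k (s1 ++ x :: s2)) = row' i (mxl k (s1 ++ y :: s2)).
Proof.
move=> hi; apply/row_matrixP => j; apply/rowP => c; rewrite !mxE !nth_cat hi.
case: ltngtP => //= h; first by rewrite -[(lift i j - i)%N]prednK ?subn_gt0.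
by have := neq_lift i j; rewrite -val_eqE /= h eqxx.
Qed.

Lemma form_alt k (a : form R R n k) : is_form a -> altform (idR R) k (lf a).
Proof.
case=> ml al; split; first exact: lf_deg.
- move=> s1 s2 b c x y; rewrite /lf !size_cat /=.
  have [hk|_] := eqVneq; last by rewrite !mulr0 addr0.
  have ik : (size s1 < k)%N by rewrite -hk addnS ltnS leq_addr.
  apply: (ml (Ordinal ik)); [|exact: row'_mxl|exact: row'_mxl].
  by rewrite !rowK /= !nth_cat ltnn subnn.
move=> s1 s2 x; rewrite /lf size_cat /=.
have [hk|//] := eqVneq.
have ik : (size s1 < k)%N by rewrite -hk addnS ltnS leq_addr.
have jk : ((size s1).+1 < k)%N by rewrite -hk !addnS !ltnS leq_addr.
apply: (al _ (Ordinal ik) (Ordinal jk)).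
  by rewrite -val_eqE /= neq_ltn ltnSn.
by rewrite !rowK /= !nth_cat ltnn subnn ltnNge leqnSn /= subSnn.
Qed.

Lemma cform_alt k (a : form R[i] R n k) :
  is_cform a -> altform (real_complex R) k (lf a).
Proof.
case=> /form_alt hr /form_alt hi.
have -> : lf a = ladd (mapf (real_complex R) (lf (re_form a)))
    (scl 'i%C (mapf (real_complex R) (lf (im_form a)))).
  apply/funext => xs; rewrite /ladd /scl /mapf /lf.
  by case: ifP => _; [exact: complexE | rewrite rmorph0 mulr0 addr0].
by apply: alt_add; [|apply: alt_scl]; exact: alt_map.
Qed.

Definition fl (F : Type) k (A : seq 'rV[R]_n -> F) : form F R n k := fun M => A (rws M).
Arguments fl {F} k A _ : simpl never.

Lemma lf_fl (F : numFieldType) k (A : lform R F n) : hasdeg k A -> lf (@fl F k A) = A.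
Proof.
move=> h; apply/funext => xs; rewrite /lf /fl.
by have [/mxlK ->|/h ->] := eqVneq.
Qed.

Lemma rws1 (M : 'rV[R]_n) : rws M = [:: M].
Proof.
apply: (@eq_from_nth _ 0) => [|i]; first by rewrite size_rws.
rewrite size_rws => ik; rewrite -[(i)]/(val (Ordinal ik)) nth_rws.
by case: i ik => // ik; apply/rowP => j; rewrite !mxE; congr (M _ _); rewrite !ord1.
Qed.

Lemma fl_form1 (A : lform R R n) : altform (idR R) 1 A -> is_form (fl 1 A).
Proof.
move=> h; split => [i M B C b c|M i j]; last by rewrite !ord1.
have E (N : 'rV[R]_n) : row i N = N.
  by apply/rowP => j; rewrite !mxE; congr (N _ _); rewrite !ord1.
by rewrite !E => -> _ _; rewrite /fl !rws1 (alt_lin h [::]).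
Qed.

Lemma fl_cform1 (A : lform R R[i] n) : altform (real_complex R) 1 A -> is_cform (fl 1 A).
Proof.
move=> h; have E b c (u v : R[i]) : b%:C%C * u + c%:C%C * v =
   Complex (b * complex.Re u + c * complex.Re v) (b * complex.Im u + c * complex.Im v).
  by case: u v => [? ?] [? ?]; simpc.
split; apply: (fl_form1 (A := fun xs => _ (A xs))); split.
- by move=> xs hx; rewrite (alt_deg h).
- by move=> *; rewrite (alt_lin h) E.
- by move=> *; rewrite (alt_alt h).
- by move=> xs hx; rewrite (alt_deg h).
- by move=> *; rewrite (alt_lin h) E.
- by move=> *; rewrite (alt_alt h).
Qed.

End FormAlt.
Arguments fl {R n F} k A _ : simpl never.

Section Volume.
Variable R : realType.
Implicit Types (Om : form R R 6 2) (w : form R R 6 3).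
Local Notation l0 := (@l0 R R 6).

Definition vol (O : lform R R 6) : lform R R 6 := scl (- 6%:R^-1) (wdg (wdg O O) O).

Lemma lf_volume Om : is_form Om -> lf (volume Om) = vol (lf Om).
Proof.
move=> /form_alt h; have h2 := alt_wd h h.
have E2 := lf_wedge h h.
have E3 : lf (wedge (wedge Om Om) Om) = wdg (wdg (lf Om) (lf Om)) (lf Om).
  by rewrite (@lf_wedge _ _ _ _ (2 + 2) 2 _ _ _ h) E2.
rewrite /vol -E3; apply/funext => xs; rewrite /lf /scl /volume.
by case: ifP; rewrite ?mulr0 // mulNr.
Qed.

Lemma alt_vol O : altform (idR R) 2 O -> altform (idR R) 6 (vol O).
Proof. by move=> h; apply: alt_scl; exact: (alt_wd (alt_wd h h) h). Qed.

(** Non-degeneracy makes every dx_j a contraction i_x O. Contracting O /\ O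
    /\ O = 0 then shows dx_j /\ O /\ O = 0 for all j, so O /\ O = 0 by
    [alt_eq0_dx]; in the same way O = 0, which is degenerate. *)
Lemma vol_neq0 (O : lform R R 6) : altform (idR R) 2 O ->
  (forall u, (forall v, O [:: u; v] = 0) -> u = 0) -> vol O (bas _ _) != 0.
Proof.
move=> h nd; apply/negP => /eqP v0.
have aOO := alt_wd h h.
have OOO : wdg (wdg O O) O = l0.
  apply: (top_form_eq0 (alt_wd aOO h)); move/eqP: v0.
  by rewrite /vol /scl mulf_eq0 oppr_eq0 invr_eq0 pnatr_eq0 /= => /eqP.
pose B : 'M[R]_6 := \matrix_(i, j) O [:: be R i; be R j].
have uB u j : (u *m B) 0 j = O [:: u; be R j].
  rewrite (alt_exp [::] _ _ h) mxE; apply: eq_bigr => i _.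
  by rewrite !mxE.
have Bu : B \in unitmx.
  rewrite -row_free_unit; apply/row_freeP; apply: contrapT => nB.
  have : ~~ row_free B by apply/negP => /row_freeP.
  rewrite -kermx_eq0 => /rowV0Pn[u /sub_kermxP uB0 /eqP]; apply.
  apply: nd => v; rewrite (alt_exp [:: u] [::] _ h) big1 // => j _.
  by rewrite /= -uB uB0 mxE mulr0.
have surj j : exists x, ctr x O = dx (idR R) j.
  exists (be R j *m invmx B); apply/funext => xs.
  have hc : altform (idR R) 1 (ctr (be R j *m invmx B) O) by exact: alt_ctr.
  have [|hx] := eqVneq (size xs) 1%N; last by rewrite (alt_deg hc) // (alt_deg (alt_dx _ j)).
  case: xs => [|y []] // _; rewrite (alt_exp [::] _ _ hc).
  rewrite (bigD1 j) //= big1 ?addr0 => [|i ij].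
    by rewrite /ctr -uB mulmxKV // /be mxE !eqxx mulr1.
  by rewrite /ctr -uB mulmxKV // /be mxE (negPf ij) mulr0.
have sgO : sg O = O by rewrite (sg_deg (alt_deg h)) sqrrN expr1n scl1.
have cOO x : ctr x (wdg O O) = scl 2%:R (wdg (ctr x O) O).
  rewrite ctr_wd sgO (wdC (alt_deg h) (alt_deg (alt_ctr x h))) -signr_odd expr0 scl1.
  by apply/funext => xs; rewrite /ladd /scl; ring.
have OO : wdg O O = l0.
  apply: (alt_eq0_dx aOO) => // j; have [x <-] := surj j.
  have ax := alt_ctr x h.
  have := congr1 (ctr x) OOO.
  rewrite ctr_wd cOO wdZl sg_wd sgO -wdA (wdC (alt_deg aOO) (alt_deg ax)).
  rewrite -signr_odd expr0 scl1 => E; apply/funext => xs.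
  have three : (3%:R : R) != 0 by rewrite pnatr_eq0.
  have := congr1 (fun h => h xs) E; rewrite /ladd /scl /ctr /l0 => {}E.
  by apply: (mulfI three); apply: (eq_comb1 1 E); ring.
have O0 : O = l0.
  apply: (alt_eq0_dx h) => // j; have [x <-] := surj j.
  have := cOO x; rewrite OO => E; apply/funext => xs.
  have two : (2%:R : R) != 0 by rewrite pnatr_eq0.
  have := congr1 (fun h => h xs) E; rewrite /scl /ctr /l0 => {}E.
  by apply: (mulfI two); rewrite mulr0 -E.
have := nd (be R 0); rewrite O0 => /(_ (fun=> erefl)) /(congr1 (fun u : 'rV__ => u 0 0)).
by move/eqP; rewrite /be !mxE !eqxx oner_eq0.
Qed.

Variables (Om : form R R 6 2) (w : form R R 6 3).
Hypotheses (fOm : is_form Om) (fw : is_form w).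
Hypothesis nd : forall u : 'rV[R]_6, (forall v : 'rV[R]_6, Om (col_mx u v) = 0) -> u = 0.

Let O := lf Om.
Let A := lf w.
Let aO : altform (idR R) 2 O. Proof. exact: form_alt. Qed.
Let aA : altform (idR R) 3 A. Proof. exact: form_alt. Qed.

Lemma vol_alt : altform (idR R) 6 (vol O). Proof. exact: alt_vol. Qed.

Lemma vol_bas_neq0 : vol O (bas _ _) != 0.
Proof.
apply: vol_neq0 => // u hu; apply: nd => v; have := hu v.
rewrite /O /lf /= (mxl_cons 1 u [:: v]).
by have -> : mxl 1 [:: v] = v by apply/rowP => j; rewrite mxE.
Qed.

(** The Hitchin endomorphism by a formula that is rational in the
    coefficients of O and A; its smooth dependence on the point is read off
    from it. *)
Definition Kvec (O A : lform R R 6) (x : 'rV[R]_6) : 'rV[R]_6 :=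
  dualvec (n := 5) (vol O) (wdg (ctr x A) A).

Lemma lf_contract x : lf (contract x w) = ctr x A.
Proof.
apply/funext => xs; rewrite /lf /contract /ctr /A /lf /= eqSS.
by case: eqP => // _; rewrite mxl_cons.
Qed.

Lemma Kvec_vol x : ctr (Kvec O A x) (vol O) = wdg (ctr x A) A.
Proof.
apply: (dualvecP (n := 5) vol_alt vol_bas_neq0).
exact: (alt_wd (alt_ctr x aA) aA).
Qed.

Lemma hitchinK_Kvec x : hitchinK Om w x = Kvec O A x.
Proof.
rewrite /hitchinK /contract5.
have as5 : altform (idR R) 5 (wdg (ctr x A) A) by exact: (alt_wd (alt_ctr x aA) aA).
have E5 : lf (wedge (contract x w) w) = wdg (ctr x A) A.
  have ac : altform (idR R) 2 (lf (contract x w)) by rewrite lf_contract; exact: alt_ctr.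
  by rewrite (lf_wedge ac aA) lf_contract.
have as5' : altform (idR R) (2 + 3)%N (lf (wedge (contract x w) w)) by rewrite E5.
set S := [set Y | _].
have hS : S (Kvec O A x).
  move=> eta /form_alt he M.
  rewrite -(lf_rws (wedge eta _)) (lf_wedge he as5') E5 -Kvec_vol.
  rewrite (covector_wd_top vol_alt _ he) /scl -(lf_volume fOm) lf_rws /lf /=.
  by congr (eta _ * _); apply/rowP => j; rewrite mxE.
have := @getPex _ S (ex_intro _ _ hS); set Y := get S => hY.
apply/rowP => j; rewrite mxE.
have hj := @alt_dx R R (idR R) 6 j.
have := hY _ (fl_form1 hj).
have E : forall M, wedge (fl 1 (dx (idR R) j)) (wedge (contract x w) w) M =
   wdg (dx (idR R) j) (wdg (ctr x A) A) (rws M).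
  have E1 : lf (fl 1 (dx (idR R) j)) = dx (idR R) j .
    exact: (lf_fl (alt_deg hj)).
  have hfl : altform (idR R) 1 (lf (fl 1 (dx (idR R) j))) by rewrite E1.
  by move=> M; rewrite -(lf_rws (wedge (fl 1 _) _)) (lf_wedge hfl as5') E5 E1.
move/(_ (mxl 6 (bas R 6))); rewrite E.
have sb : size (bas R 6) = 6 by rewrite size_map size_enum_ord.
rewrite mxlK // /fl rws1 /dx -[volume Om _](lf_rws (volume Om)) mxlK // lf_volume //.
by rewrite -/(dx _ _) => ->; rewrite mulfK // vol_bas_neq0.
Qed.

Local Notation K := (Kvec O A).

Let Klin := K_lin vol_alt aA vol_bas_neq0 Kvec_vol.

(** K o K is scalar, so one sixth of its trace is its eigenvalue. *)
Lemma pfaffian_scalar x : K (K x) = pfaffian Om w *: x.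
Proof.
have [lam hlam] := K_scalar vol_alt aA vol_bas_neq0 Kvec_vol.
suff -> : pfaffian Om w = lam by [].
rewrite /pfaffian.
have -> : lin1_mx (hitchinK Om w \o hitchinK Om w) = lam%:M.
  apply/matrixP => i j; rewrite !mxE /= !hitchinK_Kvec hlam !mxE eqxx /=.
  by rewrite eq_sym mulr_natr.
by rewrite mxtrace_scalar -[lam *+ 6]mulr_natr; field.
Qed.

Let lam := pfaffian Om w.
Let hlam : forall x, K (K x) = lam *: x := pfaffian_scalar.

Lemma wedge33 (F : numFieldType) (f : {rmorphism R -> F}) (a b : form F R 6 3) M :
  altform f 3 (lf a) -> altform f 3 (lf b) ->
  wedge a b M = wdg (lf a) (lf b) (rws M).
Proof. by move=> ha hb; rewrite -(lf_wedge ha hb) lf_rws. Qed.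

Lemma decomp_lf (F : numFieldType) (f : {rmorphism R -> F}) (e1 e2 e3 : form F R 6 1) :
  altform f 1 (lf e1) -> altform f 1 (lf e2) -> altform f 1 (lf e3) ->
  lf (wedge (wedge e1 e2) e3) = wdg (wdg (lf e1) (lf e2)) (lf e3).
Proof.
move=> h1 h2 h3; have h12 : altform f (1 + 1)%N (lf (wedge e1 e2)).
  by rewrite (lf_wedge h1 h2); exact: alt_wd.
by rewrite (lf_wedge h12 h3) (lf_wedge h1 h2).
Qed.

Lemma decomp_fl (F : numFieldType) (f : {rmorphism R -> F}) (e1 e2 e3 : lform R F 6) :
  altform f 1 e1 -> altform f 1 e2 -> altform f 1 e3 ->
  fl 3 (wdg (wdg e1 e2) e3) = wedge (wedge (fl 1 e1) (fl 1 e2)) (fl 1 e3).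
Proof.
move=> h1 h2 h3; have [[E1 E2] E3] := (lf_fl (alt_deg h1), lf_fl (alt_deg h2), lf_fl (alt_deg h3)).
apply: lf_inj; rewrite (@decomp_lf _ f) ?E1 ?E2 ?E3 // lf_fl //.
exact: (alt_deg (alt_dec h1 h2 h3)).
Qed.

(** The two halves of A give one decomposition; by [decomposition_wK] any
    other decomposition with positive a /\ b / theta yields the same a - b,
    the positive square root of lam being unique. *)
Lemma hyper_dual : 0 < lam ->
  lf (hitchin_dual Om w) = scl (Num.sqrt lam)^-1 (wK A K).
Proof.
move=> l0; set c := Num.sqrt lam; have c0 : 0 < c by rewrite sqrtr_gt0.
have c2 : c ^+ 2 = lam by rewrite sqr_sqrtr // ltW.
have cn : c != 0 by rewrite gt_eqF.
rewrite /hitchin_dual; set S := [set _ | _].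
have hp : c^-1 ^+ 2 * idR R lam = 1 by rewrite /= -c2 -exprMn mulVf // expr1n.
have hS : S (fl 3 (scl c^-1 (wK A K))).
  left; split => //; exists (fl 3 (half A K c^-1)), (fl 3 (half A K (- c^-1))).
  have ah q : altform (idR R) 3 (half A K q).
    exact: (alt_half vol_alt aA vol_bas_neq0 Kvec_vol).
  split.
  - have [e1 [e2 [e3 [h1 h2 h3 ->]]]] := half_dec vol_alt aA vol_bas_neq0 Kvec_vol hlam hp erefl.
    exists (fl 1 e1), (fl 1 e2), (fl 1 e3); split; try exact: fl_form1.
    exact: (decomp_fl h1 h2 h3).
  - have [e1 [e2 [e3 [h1 h2 h3 ->]]]] :=
      half_dec vol_alt aA vol_bas_neq0 Kvec_vol hlam hp (sqrrN _).
    exists (fl 1 e1), (fl 1 e2), (fl 1 e3); split; try exact: fl_form1.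
    exact: (decomp_fl h1 h2 h3).
  - by move=> M; rewrite /fl -half_add /A lf_rws.
  - exists c => // M.
    have lfh q : lf (fl 3 (half A K q)) = half A K q by exact: lf_fl (alt_deg (ah q)).
    rewrite (@wedge33 _ (idR R)) ?lfh //.
    rewrite (half_wd vol_alt aA vol_bas_neq0 Kvec_vol hlam).
    rewrite /scl -(lf_volume fOm) lf_rws /= -c2; congr (_ * _).
    by rewrite expr2 mulKf.
  - by move=> M; rewrite /fl /half /scl /ladd; field.
have [|] := @getPex _ S (ex_intro _ _ hS); set w' := get S; last first.
  by case=> /lt_trans/(_ l0); rewrite ltxx.
case=> _ [a [b [[e1 [e2 [e3 [f1 f2 f3 ha]]]] [g1 [g2 [g3 [k1 k2 k3 hb]]]] hw [c' c'0 hc] hw']]].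
have [[h1 h2] h3] := (form_alt f1, form_alt f2, form_alt f3).
have [[h4 h5] h6] := (form_alt k1, form_alt k2, form_alt k3).
have la : lf a = wdg (wdg (lf e1) (lf e2)) (lf e3) by rewrite ha (decomp_lf h1 h2 h3).
have lb : lf b = wdg (wdg (lf g1) (lf g2)) (lf g3) by rewrite hb (decomp_lf h4 h5 h6).
have aa : altform (idR R) 3 (lf a) by rewrite la; exact: alt_dec.
have bb : altform (idR R) 3 (lf b) by rewrite lb; exact: alt_dec.
have hA : A = ladd (lf a) (lf b).
  by apply/funext => xs; rewrite /A /ladd /lf; case: ifP; rewrite ?addr0.
have hab : wdg (lf a) (lf b) = scl c' (vol O).
  rewrite -(lf_wedge aa bb) -(lf_volume fOm); apply/funext => xs.
  by rewrite /scl /lf /=; case: ifP; rewrite ?mulr0.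
rewrite la lb in hA hab.
have [c'2 hK] := decomposition_wK vol_alt aA vol_bas_neq0 Kvec_vol hlam h1 h2 h3 h4 h5 h6 (lt0r_neq0 l0) hA hab.
have cc : c' = c by apply/eqP; rewrite -(eqrXn2 (n := 2)) ?ltW // c2 c'2.
apply/funext => xs; rewrite /scl hK cc mulKf // -la -lb.
by rewrite /lf; case: ifP; rewrite ?subr0.
Qed.

Let cjD (x y : R[i]) : conjc (x + y) = conjc x + conjc y.
Proof. exact: (rmorphD (conjc : {rmorphism R[i] -> R[i]})). Qed.

Let cjM (x y : R[i]) : conjc (x * y) = conjc x * conjc y.
Proof. exact: (rmorphM (conjc : {rmorphism R[i] -> R[i]})). Qed.

Let gC : {rmorphism (R : fieldType) -> (R[i] : numFieldType)} := real_complex R.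

(** The same argument after extension of scalars: the square roots of lam
    are now plus or minus i c, complex conjugation exchanges the two halves,
    and the sign condition on the product of a and its conjugate selects one
    of them. *)
Lemma ell_dual : lam < 0 ->
  lf (hitchin_dual Om w) = scl (- (Num.sqrt (- lam))^-1) (wK A K).
Proof.
move=> l0; set c := Num.sqrt (- lam).
have c0 : 0 < c by rewrite sqrtr_gt0 oppr_gt0.
have c2 : c ^+ 2 = - lam by rewrite sqr_sqrtr // oppr_ge0 ltW.
have cn : c != 0 by rewrite gt_eqF.
have cC : c%:C%C != 0 by rewrite (fmorph_eq0 gC).
have ii : 'i%C ^+ 2 = -1 :> R[i] by exact: sqr_i.
have in0 : 'i%C != 0 :> R[i].
  by apply/eqP => i0; move/eqP: ii; rewrite i0 expr0n /= eq_sym oppr_eq0 oner_eq0.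
pose AC := mapf gC A; pose tC := mapf gC (vol O).
have aAC : altform gC 3 AC by exact: alt_map.
have atC : altform gC 6 tC by apply: alt_map; exact: vol_alt.
have tC0 : tC (bas _ _) != 0 by rewrite /tC /mapf fmorph_eq0 vol_bas_neq0.
have hKC x : ctr (K x) tC = wdg (ctr x AC) AC.
  by rewrite /AC -[ctr x _]/(mapf gC (ctr x A)) -wd_map -Kvec_vol.
have wKC : wK AC K = mapf gC (wK A K).
  by apply/funext => -[|x xs] //; rewrite /mapf /= rmorph0.
have lamC : gC lam = - c%:C%C ^+ 2.
  by rewrite /gC -rmorphXn c2 rmorphN opprK.
(* The half with this p satisfies a /\ conj a = p lam theta = i c theta. *)
pose p : R[i] := (c%:C%C * 'i%C)^-1.
have hp : p ^+ 2 * gC lam = 1.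
  by rewrite /p lamC exprVn exprMn ii mulrN1 mulVf // oppr_eq0 expf_neq0.
have pconj : conjc p = - p.
  have ci : conjc (c%:C%C * 'i%C) = - (c%:C%C * 'i%C) :> R[i].
    by apply/eqP; rewrite eq_complex /=; apply/andP; split; apply/eqP; ring.
  by rewrite /p conjc_inv ci invrN.
rewrite /hitchin_dual; set S := [set _ | _].
have hS : S (fl 3 (scl (- c^-1) (wK A K))).
  right; split => //; exists (fl 3 (half AC K p)).
  have ah q : altform gC 3 (half AC K q).
    exact: (alt_half atC aAC tC0 hKC).
  have cj : conjc \o fl 3 (half AC K p) = fl 3 (half AC K (- p)).
    apply/funext => M; rewrite /fl /= /half /ladd /scl wKC /AC /mapf.
    by rewrite cjD !cjM conjc_inv conjc_nat !conjc_real pconj.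
  split.
  - have [e1 [e2 [e3 [h1 h2 h3 ->]]]] := half_dec atC aAC tC0 hKC hlam hp erefl.
    exists (fl 1 e1), (fl 1 e2), (fl 1 e3); split; try exact: fl_cform1.
    exact: (decomp_fl h1 h2 h3).
  - move=> M; rewrite -[conjc _]/((conjc \o fl 3 (half AC K p)) M) cj.
    by rewrite /fl -half_add /AC /mapf /A lf_rws.
  - exists c => // M; rewrite cj.
    have lfh q : lf (fl 3 (half AC K q)) = half AC K q by exact: lf_fl (alt_deg (ah q)).
    rewrite (@wedge33 _ gC) ?lfh //.
    rewrite (half_wd atC aAC tC0 hKC hlam).
    rewrite /scl lamC /tC /mapf -(lf_volume fOm) lf_rws /= mulrA; congr (_ * _).
    by rewrite /p invfM; apply: (mulfI in0); apply: (eq_comb1 (- c%:C%C) ii); field; apply/andP; split.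
  - move=> M; rewrite -[conjc _]/((conjc \o fl 3 (half AC K p)) M) cj.
    rewrite /fl /half /scl /ladd wKC /mapf rmorphM rmorphN fmorphV /p.
    by field; apply/andP; split.
have [|] := @getPex _ S (ex_intro _ _ hS); set w' := get S.
  by case=> /(lt_trans l0); rewrite ltxx.
case=> _ [a [[e1 [e2 [e3 [f1 f2 f3 ha]]]] hw [c' c'0 hc] hw']].
have [[h1 h2] h3] := (cform_alt f1, cform_alt f2, cform_alt f3).
have la : lf a = wdg (wdg (lf e1) (lf e2)) (lf e3) by rewrite ha (decomp_lf h1 h2 h3).
pose cg : {rmorphism R[i] -> R[i]} := conjc.
have lb : lf (conjc \o a) = wdg (wdg (mapf cg (lf e1)) (mapf cg (lf e2))) (mapf cg (lf e3)).
  rewrite -!wd_map -la; apply/funext => xs; rewrite /mapf /lf.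
  by case: ifP; rewrite ?rmorph0.
have cr (z : R) : conjc (gC z) = gC z by exact: conjc_real.
have cjalt k (B : lform R R[i] 6) : altform gC k B -> altform gC k (mapf cg B).
  case=> q1 q2 q3; split; rewrite /mapf.
  - by move=> xs /q1 ->; rewrite rmorph0.
  - move=> s1 s2 b d x y; rewrite q2 -![cg _]/(conjc _) cjD !cjM.
    by rewrite !cr.
  by move=> s1 s2 x; rewrite q3 rmorph0.
have [[h4 h5] h6] := (cjalt _ _ h1, cjalt _ _ h2, cjalt _ _ h3).
have aa : altform gC 3 (lf a) by rewrite la; exact: alt_dec.
have bb : altform gC 3 (lf (conjc \o a)) by rewrite lb; exact: alt_dec.
have hA : AC = ladd (lf a) (lf (conjc \o a)).
  apply/funext => xs; rewrite /AC /mapf /A /ladd /lf; case: ifP => _.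
    exact: hw.
  by rewrite rmorph0 addr0.
have hab : wdg (lf a) (lf (conjc \o a)) = scl (c'%:C%C * 'i%C) tC.
  rewrite -(lf_wedge aa bb) /tC -(lf_volume fOm); apply/funext => xs.
  rewrite /scl /mapf /lf /=; case: ifP => _; last by rewrite mulr0.
  by rewrite hc mulrA.
rewrite la lb in hA hab.
have [c'2 hK] := decomposition_wK atC aAC tC0 hKC hlam h1 h2 h3 h4 h5 h6 (ltr0_neq0 l0) hA hab.
have cc : c' = c.
  apply/eqP; rewrite -(eqrXn2 (n := 2)) ?ltW //; apply/eqP.
  apply: (fmorph_inj gC); rewrite !rmorphXn /=.
  move: c'2; rewrite lamC exprMn ii mulrN1 => /eqP; rewrite eqr_opp => /eqP.
  by [].
apply/funext => xs; apply: (fmorph_inj gC); rewrite /scl rmorphM.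
have := hK xs; rewrite wKC /mapf => ->; rewrite -la -lb cc rmorphN fmorphV.
rewrite /lf; case: ifP => _; last by rewrite subr0 !mulr0 rmorph0.
have hw'' M : gC (w' M) = 'i%C * (conjc (a M) - a M) by exact: hw'.
rewrite hw'' -[gC c]/(c%:C%C) mulNr -!mulrA mulKf //=.
by rewrite -mulrN opprB.
Qed.

End Volume.

(** * Calculus of smooth functions *)

Section DirectionalDerivatives.
Variables (R : realType) (n : nat).
Local Notation E := 'rV[R]_n.
Implicit Types (f g : E -> R) (p q v w : E) (U : set E).

Lemma line_derive f q e s : derivable f (s *: e + q) e ->
  is_derive s 1 (fun r : R => f (r *: e + q)) ('D_e f (s *: e + q)).
Proof.
move=> df.
have Eq : (fun h : R => h^-1 *: (((fun r : R => f (r *: e + q)) \o shift s) (h *: 1) -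
      f (s *: e + q)))
   = (fun h : R => h^-1 *: ((f \o shift (s *: e + q)) (h *: e) - f (s *: e + q))).
  apply/funext => h /=; congr (_ *: (f _ - _)).
  by rewrite scalerDl addrA [h *: 1]mulr1.
by split; rewrite ?/derivable ?/derive Eq.
Qed.

(** Adds a direction t e to w: the increment along t e is given by the mean
    value theorem on the segment from p + h w to p + h (w + t e), where the
    partial derivative along e is close to its value at p. *)
Lemma derive_step f p w e t : derivable f p w ->
  (\forall q \near p, derivable f q e) -> {for p, continuous ('D_e f)} ->
  is_derive p (w + t *: e) f ('D_w f p + t * 'D_e f p).
Proof.
move=> dw de ce.
suff C : (fun h : R => h^-1 *: ((f \o shift p) (h *: (w + t *: e)) - f p)) @ 0^'
    --> 'D_w f p + t * 'D_e f p.
  by split; [apply/cvg_ex; exists ('D_w f p + t * 'D_e f p) | apply: cvg_lim C].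
rewrite (_ : (fun h : R => _) = (fun h : R => h^-1 *: ((f \o shift p) (h *: w) - f p) +
   h^-1 *: (f (h *: (w + t *: e) + p) - f (h *: w + p)))); last first.
  by apply/funext => h /=; rewrite -scalerDr; congr (_ *: _); rewrite [RHS]addrC subrKA.
apply: cvgD; first exact: dw.
apply/cvgrPdist_le => eps eps0.
have t1 : 0 < `|t| + 1 by rewrite ltr_pwDr.
have : \forall q \near p, derivable f q e /\ `|'D_e f p - 'D_e f q| <= eps / (`|t| + 1).
  near=> q; split; near: q => //.
  by move/cvgrPdist_le: ce; apply; rewrite divr_gt0.
move=> /nbhs_ballP[d /= d0 hd].
pose M := `|w| + `|t *: e| + 1.
have M0 : 0 < M by rewrite ltr_pwDr // addr_ge0.
near=> h.
have hn0 : h != 0 by near: h; exact: nbhs_dnbhs_neq.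
have hlt : `|h| < d / M by near: h; apply: dnbhs0_lt; rewrite divr_gt0.
have hb (r : R) : 0 <= r <= 1 -> ball p d ((r * (h * t)) *: e + (h *: w + p)).
  move=> /andP[r0 r1]; rewrite -ball_normE /= distrC addrA addrK.
  have -> : (r * (h * t)) *: e = (h * r) *: (t *: e) by rewrite scalerA; congr (_ *: _); ring.
  apply: (@le_lt_trans _ _ (`|h| * M)); last by rewrite -ltr_pdivlMr.
  apply: le_trans (ler_normD _ _) _.
  rewrite /M !normrZ (ger0_norm r0) -!mulrA -mulrDr ler_wpM2l //.
  set x := `|t| * `|e|; have x0 : 0 <= x by rewrite mulr_ge0.
  rewrite addrC -addrA lerD2l; apply: (@le_trans _ _ x); last by rewrite lerDl ler01.
  by rewrite -[leRHS]mul1r ler_wpM2r.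
pose g (r : R) := f ((r * (h * t)) *: e + (h *: w + p)).
have gd (r : R) : 0 <= r <= 1 ->
    is_derive r 1 g ('D_e f ((r * (h * t)) *: e + (h *: w + p)) * (h * t)).
  move=> r01; have [der _] := hd _ (hb r r01).
  have := @is_derive1_comp _ (fun u : R => f (u *: e + (h *: w + p)))
     (fun r : R => r * (h * t)) r _ (h * t) (line_derive der).
  apply; have := @is_deriveM _ _ id (cst (h * t)) r 1 1 0 _ _.
  rewrite scaler0 add0r /= [_ *: 1]mulr1 => H.
  exact: (H (is_derive_id _ _) (is_derive_cst _ _ _)).
have [||c c01] := @MVT_segment _ g
    (fun r => 'D_e f ((r * (h * t)) *: e + (h *: w + p)) * (h * t)) 0 1 ler01.
- move=> r; rewrite in_itv /= => /andP[/ltW r0 /ltW r1]; apply: gd.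
  by rewrite r0 r1.
- apply: derivable_within_continuous => r; rewrite in_itv /= => r01.
  by have [] := gd r r01.
rewrite /g mul1r mul0r scale0r add0r subr0 mulr1.
have -> : (h * t) *: e + (h *: w + p) = h *: (w + t *: e) + p.
  by rewrite scalerDr scalerA addrA [_ *: e + _]addrC.
move=> ->; rewrite in_itv /= in c01; have [_ hc] := hd _ (hb c c01).
rewrite [_ *: (_ * (h * t))](_ : _ = t * 'D_e f ((c * (h * t)) *: e + (h *: w + p))); last first.
  by rewrite /GRing.scale /=; field.
rewrite -mulrBr normrM.
apply: le_trans (ler_wpM2l (normr_ge0 t) hc) _.
rewrite mulrCA ger_pMr // ler_pdivrMr // mul1r lerDl.
exact: ler01.
Unshelve. all: by end_near. Qed.

(** Linearity of the directional derivative in the direction, adding the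
    coordinate directions one at a time. *)
Lemma smooth_derive U f p v : open U -> smooth_on U f -> U p ->
  is_derive p v f (\sum_i v 0 i * 'D_(be R i) f p).
Proof.
move=> oU sf Up.
rewrite {1}[v]row_be; elim: (index_enum _) => [|i s IH].
  by rewrite !big_nil; split; [exact: derivable0 | rewrite derive0].
rewrite !big_cons addrC [X in is_derive _ _ _ X]addrC.
have [d1 <-] := IH.
apply: (derive_step _ d1 _ (proj1 (sf [:: i] p Up))).
near=> q; have Uq : U q by near: q; exact: open_nbhs_nbhs.
exact: (proj2 (sf [::] q Uq) i).
Unshelve. all: by end_near. Qed.

End DirectionalDerivatives.

Section Smooth.
Variables (R : realType) (n : nat).
Local Notation E := 'rV[R]_n.
Variable U : set E.
Hypothesis oU : open U.
Implicit Types (f g : E -> R) (p q v w : E) (k : nat) (i : 'I_n).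
Local Notation D i f := ('D_(be R i) f).

(** Differentiability of order k by recursion on the first derivative, so
    that product and chain rules go through by induction; [smoothP] compares
    it with iterated partial derivatives. *)
Fixpoint Ck k f : Prop := (forall p, U p -> {for p, continuous f}) /\
  if k is k'.+1 then
    forall i, (forall p, U p -> derivable f p (be R i)) /\ Ck k' (D i f)
  else True.

Lemma iter_rcons s i f : iter_partial (rcons s i) f = iter_partial s (D i f).
Proof. by elim: s => //= j s ->. Qed.

Lemma smoothP f : smooth_on U f <-> forall k, Ck k f.
Proof.
split=> [sf k | h s p Up].
  elim: k f sf => [|k IH] f sf; split.
  - by move=> p Up; have [] := sf [::] p Up.
  - by [].
  - by move=> p Up; have [] := sf [::] p Up.
  move=> i; split; first by move=> p Up; have [_] := sf [::] p Up; exact.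
  by apply: IH => s p Up; have := sf (rcons s i) p Up; rewrite iter_rcons.
elim/last_ind: s f h => [|s i IH] f h.
  have /= [c d] := h 1%N; split; first exact: c.
  by move=> i; have [] := d i; move=> /(_ p Up).
rewrite iter_rcons; apply: IH => k.
by have /= [_ /(_ i)[]] := h k.+1.
Qed.

Lemma nearU p : U p -> \forall q \near p, U q.
Proof. by move=> Up; exact: open_nbhs_nbhs. Qed.

Lemma Ck_congr k f g : (forall p, U p -> f p = g p) -> Ck k f -> Ck k g.
Proof.
have nr f' g' p : (forall p, U p -> f' p = g' p) -> U p -> \forall q \near p, f' q = g' q.
  by move=> h Up; near=> q; apply: h; near: q; exact: nearU.
have cg f' g' : (forall p, U p -> f' p = g' p) ->
    (forall p, U p -> {for p, continuous f'}) -> forall p, U p -> {for p, continuous g'}.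
  move=> h c p Up; have := c p Up; rewrite /prop_for /continuous_at -h //.
  by apply: cvg_trans; exact: (near_eq_cvg (nr _ _ p h Up)).
elim: k f g => [|k IH] f g h [c d]; split => //; try exact: (cg f).
move=> i; have [di ci] := d i; split.
  by move=> p Up; apply: near_eq_derivable (di p Up); exact: nr.
apply: IH ci => p Up; apply: near_eq_derive; exact: nr.
Unshelve. all: by end_near. Qed.

Lemma Ck_S k f : Ck k.+1 f -> Ck k f.
Proof.
elim: k f => [|k IH] f [c d]; split => // i; have [di ci] := d i.
by split => //; exact: IH.
Qed.

Lemma Ck_cst k (c : R) : Ck k (fun=> c).
Proof.
elim: k c => [|k IH] c; split => //; try by move=> p _; exact: cst_continuous.
move=> i; split; first by move=> p _; exact: derivable_cst.
by apply: Ck_congr (IH 0) => p _; rewrite derive_cst.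
Qed.

Lemma Ck_add k f g : Ck k f -> Ck k g -> Ck k (fun p => f p + g p).
Proof.
elim: k f g => [|k IH] f g [cf df] [cg dg]; split => //;
  try by move=> p Up; exact: (cvgD (cf p Up) (cg p Up)).
move=> i; have [dfi cfi] := df i; have [dgi cgi] := dg i; split.
  by move=> p Up; apply: derivableD; [exact: dfi | exact: dgi].
apply: Ck_congr (IH _ _ cfi cgi) => p Up.
by rewrite -[in RHS]/(f + g) deriveD //; [exact: dfi | exact: dgi].
Qed.

Lemma Ck_mul k f g : Ck k f -> Ck k g -> Ck k (fun p => f p * g p).
Proof.
elim: k f g => [|k IH] f g hf hg; have [cf df] := hf; have [cg dg] := hg; split => //;
  try by move=> p Up; exact: (cvgM (cf p Up) (cg p Up)).
move=> i; have [dfi cfi] := df i; have [dgi cgi] := dg i; split.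
  by move=> p Up; apply: derivableM; [exact: dfi | exact: dgi].
apply: Ck_congr (Ck_add (IH _ _ (Ck_S hf) cgi) (IH _ _ (Ck_S hg) cfi)) => p Up.
by rewrite -[in RHS]/(f * g) deriveM //; [exact: dfi | exact: dgi].
Qed.

Lemma Ck_inv k f : (forall p, U p -> f p != 0) -> Ck k f -> Ck k (fun p => (f p)^-1).
Proof.
move=> nz; elim: k => [|k IH] hf; have [cf df] := hf; split => //;
  try by move=> p Up; exact: (cvgV (nz p Up) (cf p Up)).
move=> i; have [dfi cfi] := df i; split.
  by move=> p Up; apply: derivableV; [exact: nz | exact: dfi].
have iv := IH (Ck_S hf).
apply: Ck_congr (Ck_mul (Ck_cst k (-1)) (Ck_mul (Ck_mul iv iv) cfi)) => p Up.
rewrite deriveV; [|exact: nz|exact: dfi].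
by rewrite mulN1r scaleNr -exprVn expr2 /GRing.scale /=.
Qed.

Lemma powR_derive_at (a : R) f p v : 0 < f p -> derivable f p v ->
  is_derive p v (fun q => f q `^ a) (a * f p `^ (a - 1) * 'D_v f p).
Proof.
move=> f0 df.
have L : is_derive (0 : R) 1 (fun r : R => f (r *: v + p)) ('D_v f p).
  have := @line_derive R n f p v 0; rewrite scale0r add0r => L; exact: (L df).
have f0' : 0 < f (0 *: v + p) by rewrite scale0r add0r.
have := @is_derive1_comp _ (fun r : R => r `^ a) (fun r : R => f (r *: v + p)) 0 _ _
  (@is_derive1_powR R a _ f0') L.
rewrite scale0r add0r => -[d1 d2].
have Eq : (fun h : R => h^-1 *: (((fun q => f q `^ a) \o shift p) (h *: v) - f p `^ a))
   = (fun h : R => h^-1 *: ((((fun r : R => r `^ a) \o (fun r : R => f (r *: v + p))) \o shift 0) (h *: 1)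
      - ((fun r : R => r `^ a) \o (fun r : R => f (r *: v + p))) 0)).
  by apply/funext => h /=; rewrite scale0r add0r addr0 [h *: 1]mulr1.
by split; rewrite ?/derivable ?/derive Eq.
Qed.

Lemma powR_cont (a x : R) : 0 < x -> {for x, continuous (fun r : R => r `^ a)}.
Proof.
move=> x0; apply: differentiable_continuous; apply/derivable1_diffP.
by have [] := @is_derive1_powR R a x x0.
Qed.

Lemma Ck_powR k a f : (forall p, U p -> 0 < f p) -> Ck k f -> Ck k (fun p => f p `^ a).
Proof.
move=> f0; elim: k => [|k IH] hf; have [cf df] := hf; split => //;
  try by move=> p Up; exact: (@continuous_comp _ _ _ f (fun r : R => r `^ a) p
    (cf p Up) (@powR_cont a _ (f0 p Up))).
move=> i; have [dfi cfi] := df i; split.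
  by move=> p Up; have [] := powR_derive_at a (f0 p Up) (dfi p Up).
have iv : Ck k (fun p => (f p)^-1).
  by apply: Ck_inv (Ck_S hf) => p Up; rewrite gt_eqF // f0.
apply: Ck_congr (Ck_mul (Ck_mul (Ck_cst k a) (Ck_mul (IH (Ck_S hf)) iv)) cfi) => p Up.
have [_ ->] := powR_derive_at a (f0 p Up) (dfi p Up).
by rewrite powRD ?powR_inv1 // ?ltW ?f0 //; apply/implyP => _; rewrite gt_eqF ?f0.
Qed.

Lemma smooth_congr f g : (forall p, U p -> f p = g p) -> smooth_on U f -> smooth_on U g.
Proof. by move=> h /smoothP sf; apply/smoothP => k; exact: Ck_congr (sf k). Qed.
Lemma smooth_cst (c : R) : smooth_on U (fun=> c).
Proof. by apply/smoothP => k; exact: Ck_cst. Qed.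
Lemma smooth_add f g : smooth_on U f -> smooth_on U g -> smooth_on U (fun p => f p + g p).
Proof. by move=> /smoothP sf /smoothP sg; apply/smoothP => k; exact: Ck_add. Qed.
Lemma smooth_mul f g : smooth_on U f -> smooth_on U g -> smooth_on U (fun p => f p * g p).
Proof. by move=> /smoothP sf /smoothP sg; apply/smoothP => k; exact: Ck_mul. Qed.
Lemma smooth_inv f : (forall p, U p -> f p != 0) -> smooth_on U f ->
  smooth_on U (fun p => (f p)^-1).
Proof. by move=> h /smoothP sf; apply/smoothP => k; exact: Ck_inv. Qed.
Lemma smooth_powR a f : (forall p, U p -> 0 < f p) -> smooth_on U f ->
  smooth_on U (fun p => f p `^ a).
Proof. by move=> h /smoothP sf; apply/smoothP => k; exact: Ck_powR. Qed.
Lemma smooth_sum (I : Type) (r : seq I) (F : I -> E -> R) :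
  (forall j, smooth_on U (F j)) -> smooth_on U (fun p => \sum_(j <- r) F j p).
Proof.
move=> h; elim: r => [|j r IH].
  by apply: smooth_congr (smooth_cst 0) => p _; rewrite big_nil.
by apply: smooth_congr (smooth_add (h j) IH) => p _; rewrite big_cons.
Qed.

End Smooth.

(** * The key identity for the exterior derivatives *)

(* A polynomial identity between derivatives is checked with the derivatives
   as atoms. *)
Ltac gen_derive := repeat match goal with |- context [@derive ?R ?V ?W ?f ?p ?v] =>
  let T := fresh "T" in set T := (@derive R V W f p v); clearbody T end.

Section KeyIdentity.
Variables (R : realType) (n : nat).
Local Notation E := 'rV[R]_n.
Local Notation lform := (lform R R n).
Local Notation altform := (@altform R R (idR R) n).
Variable U : set E.
Hypothesis oU : open U.
Implicit Types (p q x y z : E) (Y Z u v : E -> E).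

Lemma derive_eq_on (f g : E -> R) p d : (forall q, U q -> f q = g q) -> U p ->
  'D_d f p = 'D_d g p.
Proof.
move=> h Up; apply: near_eq_derive; near=> q; apply: h; near: q; exact: nearU.
Unshelve. all: by end_near. Qed.

Lemma smooth_derivable (f : E -> R) p d : smooth_on U f -> U p -> derivable f p d.
Proof. by move=> sf Up; have [] := smooth_derive d oU sf Up. Qed.

Lemma derive_scale (c : R) (f : E -> R) p d : smooth_on U f -> U p ->
  'D_d (fun q => c * f q) p = c * 'D_d f p.
Proof. by move=> sf Up; exact: (deriveZ c (@smooth_derivable f p d sf Up)). Qed.

Section OneSlot.
Variables (l : E -> E -> R) (Y : E -> E).
Hypothesis ll : forall q x, U q -> l q x = \sum_j x 0 j * l q (be R j).
Hypothesis sl : forall x, smooth_on U (fun q => l q x).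
Hypothesis sY : smooth_map_on U Y.

Lemma slot_smooth : smooth_on U (fun q => l q (Y q)).
Proof.
apply: (smooth_congr oU (f := fun q => \sum_j Y q 0 j * l q (be R j))).
  by move=> q Uq; rewrite -ll.
by apply: (smooth_sum oU) => j; apply: (smooth_mul oU).
Qed.

(** Product rule for a form with one moving argument, after expansion of
    this argument in the basis. *)
Lemma slot_derive p d : U p ->
  'D_d (fun q => l q (Y q)) p = 'D_d (fun q => l q (Y p)) p + l p ('D_d Y p).
Proof.
move=> Up.
have dY j : derivable (fun q => Y q 0 j) p d by exact: smooth_derivable (sY j) Up.
have dl x : derivable (fun q => l q x) p d by exact: smooth_derivable (sl x) Up.
rewrite (@derive_eq_on _ (\sum_j (fun q => Y q 0 j * l q (be R j))) p d) //; last first.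
  by move=> q Uq; rewrite ll // fct_sumE.
rewrite (@derive_eq_on (fun q => l q (Y p)) (\sum_j (fun q => Y p 0 j * l q (be R j))) p d) //;
  last by move=> q Uq; rewrite ll // fct_sumE.
rewrite !derive_sum; last 2 first.
- by move=> j; exact: (derivableZ (dl (be R j))).
- by move=> j; exact: (derivableM (dY j) (dl (be R j))).
rewrite ll // -big_split /=; apply: eq_bigr => j _.
rewrite (deriveM (dY j) (dl (be R j))) (deriveZ _ (dl (be R j))); congr (_ + _).
rewrite derive_mx; first by rewrite mxE /GRing.scale /= mulrC.
by apply/derivable_mxP => i k; rewrite ord1.
Qed.

End OneSlot.

(** The exterior derivative of a 3-form on constant vector fields. *)
Definition d4 (b : E -> lform) p x y z t : R :=
  'D_x (fun q => b q [:: y; z; t]) p - 'D_y (fun q => b q [:: x; z; t]) p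
  + ('D_z (fun q => b q [:: x; y; t]) p - 'D_t (fun q => b q [:: x; y; z]) p).

Lemma alt_head_lin k (a : lform) c x y s : altform k a ->
  a (x + c *: y :: s) = a (x :: s) + c * a (y :: s).
Proof. by move=> aa; have := alt_lin aa [::] s 1 c x y; rewrite scale1r /= mul1r. Qed.

Section Family.
Variable b : E -> lform.
Hypothesis ab : forall q, U q -> altform 3 (b q).
Hypothesis sb : forall xs, smooth_on U (fun q => b q xs).

Let lin1 s1 s2 q x : U q -> b q (s1 ++ x :: s2) = \sum_j x 0 j * b q (s1 ++ be R j :: s2).
Proof. by move=> Uq; rewrite (alt_exp _ _ _ (ab Uq)). Qed.

Lemma derive_slot1 Y z t p d : smooth_map_on U Y -> U p ->
  'D_d (fun q => b q [:: Y q; z; t]) p =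
  'D_d (fun q => b q [:: Y p; z; t]) p + b p [:: 'D_d Y p; z; t].
Proof.
move=> sY Up; apply: (slot_derive (l := fun q x => b q [:: x; z; t])) => //.
by move=> q x Uq; exact: (lin1 [::]).
Qed.

Lemma smooth_slot2 Y x t : smooth_map_on U Y -> smooth_on U (fun q => b q [:: x; Y q; t]).
Proof.
move=> sY; apply: (slot_smooth (l := fun q y => b q [:: x; y; t])) => //.
by move=> q y Uq; exact: (lin1 [:: x]).
Qed.

Lemma derive_slot12 Y Z t p d : smooth_map_on U Y -> smooth_map_on U Z -> U p ->
  'D_d (fun q => b q [:: Y q; Z q; t]) p =
  'D_d (fun q => b q [:: Y p; Z p; t]) p + b p [:: 'D_d Y p; Z p; t]
     + b p [:: Y p; 'D_d Z p; t].
Proof.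
move=> sY sZ Up.
rewrite (slot_derive (l := fun q x => b q [:: x; Z q; t])) //; last 2 first.
- by move=> q x Uq; exact: (lin1 [::]).
- by move=> x; exact: smooth_slot2.
rewrite (slot_derive (l := fun q x => b q [:: Y p; x; t])) //; last first.
  by move=> q x Uq; exact: (lin1 [:: Y p]).
by rewrite addrAC.
Qed.

Lemma smooth_slot1 Y z t : smooth_map_on U Y -> smooth_on U (fun q => b q [:: Y q; z; t]).
Proof.
move=> sY; apply: (slot_smooth (l := fun q y => b q [:: y; z; t])) => //.
by move=> q y Uq; exact: (lin1 [::]).
Qed.

Lemma smooth_slot12 Y Z t : smooth_map_on U Y -> smooth_map_on U Z ->
  smooth_on U (fun q => b q [:: Y q; Z q; t]).
Proof.
move=> sY sZ; apply: (slot_smooth (l := fun q y => b q [:: y; Z q; t])) => //.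
  by move=> q y Uq; exact: (lin1 [::]).
by move=> x; exact: smooth_slot2.
Qed.

(** Cartan's formula for d b (Y, Z, z, t), with constant fields z and t: the
    derivatives of Y and Z that the left-hand side does not contain are
    subtracted again, and two of these corrections make up the bracket. *)
Lemma cartan Y Z z t p : smooth_map_on U Y -> smooth_map_on U Z -> U p ->
  d4 b p (Y p) (Z p) z t =
   ('D_(Y p) (fun q => b q [:: Z q; z; t]) p - 'D_(Z p) (fun q => b q [:: Y q; z; t]) p)
   + ('D_z (fun q => b q [:: Y q; Z q; t]) p - 'D_t (fun q => b q [:: Y q; Z q; z]) p)
   - b p [:: lie_bracket Y Z p; z; t]
   - (b p [:: 'D_z Y p; Z p; t] + b p [:: Y p; 'D_z Z p; t])
   + (b p [:: 'D_t Y p; Z p; z] + b p [:: Y p; 'D_t Z p; z]).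
Proof.
move=> sY sZ Up.
rewrite (@derive_slot1 Z z t p (Y p) sZ Up) (@derive_slot1 Y z t p (Z p) sY Up).
rewrite (@derive_slot12 Y Z t p z sY sZ Up) (@derive_slot12 Y Z z p t sY sZ Up) /d4.
have -> : b p [:: lie_bracket Y Z p; z; t] =
    b p [:: 'D_(Y p) Z p; z; t] - b p [:: 'D_(Z p) Y p; z; t].
  by rewrite /lie_bracket -scaleN1r (alt_head_lin _ _ _ _ (ab Up)) mulN1r.
gen_derive; move: (b p) => B; ring.
Qed.

End Family.

Variables (w g : E -> lform) (K : E -> E -> E) (eps : R).
Hypothesis aw : forall q, U q -> altform 3 (w q).
Hypothesis ag : forall q, U q -> altform 3 (g q).
Hypothesis sw : forall xs, smooth_on U (fun q => w q xs).
Hypothesis sg : forall xs, smooth_on U (fun q => g q xs).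
Hypothesis eps2 : eps ^+ 2 = 1.
Hypothesis gE : forall q x s, U q -> g q (x :: s) = w q (K q x :: s).
Hypothesis KK : forall q x, U q -> K q (K q x) = eps *: x.
Hypothesis Ks : forall q x y s, U q -> w q [:: K q x, y & s] = w q [:: x, K q y & s].

Let weps q x s : U q -> w q (eps *: x :: s) = eps * w q (x :: s).
Proof.
move=> Uq; have := alt_lin (aw Uq) [::] s eps 0 x 0.
by rewrite scale0r addr0 /= mul0r addr0.
Qed.

(** In the sum of the four Cartan expansions the derivatives of coefficients
    cancel, because g (Y, .) = w (K Y, .), g (K Y, .) = eps w (Y, .) and w
    (K Y, K Z, .) = eps w (Y, Z, .) as functions of the point. The
    derivatives of u, v, u', v' along z and t cancel in the same way, and
    only the brackets remain. *)
Lemma key_identity u v u' v' z t p :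
  smooth_map_on U u -> smooth_map_on U v -> smooth_map_on U u' -> smooth_map_on U v' ->
  (forall q, U q -> u' q = K q (u q)) -> (forall q, U q -> v' q = K q (v q)) -> U p ->
  d4 w p (u p) (v p) z t + eps * d4 w p (u' p) (v' p) z t
   - eps * d4 g p (u p) (v' p) z t - eps * d4 g p (u' p) (v p) z t =
  - w p [:: lie_bracket u v p + eps *: lie_bracket u' v' p; z; t]
  + eps * g p [:: lie_bracket u v' p + lie_bracket u' v p; z; t].
Proof.
move=> su sv su' sv' hu hv Up.
rewrite (cartan aw sw _ _ su sv Up) (cartan aw sw _ _ su' sv' Up).
rewrite (cartan ag sg _ _ su sv' Up) (cartan ag sg _ _ su' sv Up).
(* These equations are between functions near p, so they may be
   differentiated. *)
have Fg d Y Y' s1 s2 : smooth_map_on U Y -> smooth_map_on U Y' ->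
    (forall q, U q -> Y' q = K q (Y q)) ->
    'D_d (fun q => g q [:: Y' q; s1; s2]) p = eps * 'D_d (fun q => w q [:: Y q; s1; s2]) p.
  move=> sY sY' hY; rewrite -(derive_scale _ _ (smooth_slot1 aw sw _ _ sY) Up).
  by apply: derive_eq_on => // q Uq; rewrite gE // hY // KK // weps.
have Fw d Y Y' s1 s2 : smooth_map_on U Y -> smooth_map_on U Y' ->
    (forall q, U q -> Y' q = K q (Y q)) ->
    'D_d (fun q => g q [:: Y q; s1; s2]) p = 'D_d (fun q => w q [:: Y' q; s1; s2]) p.
  by move=> sY sY' hY; apply: derive_eq_on => // q Uq; rewrite gE // hY.
have G d s : [/\ 'D_d (fun q => w q [:: u' q; v' q; s]) p = eps * 'D_d (fun q => w q [:: u q; v q; s]) p,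
   'D_d (fun q => g q [:: u q; v' q; s]) p = eps * 'D_d (fun q => w q [:: u q; v q; s]) p &
   'D_d (fun q => g q [:: u' q; v q; s]) p = eps * 'D_d (fun q => w q [:: u q; v q; s]) p].
  rewrite -(derive_scale _ _ (smooth_slot12 aw sw _ su sv) Up).
  split; apply: derive_eq_on => // q Uq; rewrite ?gE // ?hu // ?hv //.
  - by rewrite -Ks // KK // weps.
  - by rewrite -Ks // KK // weps.
  - by rewrite KK // weps.
have Ws x y s : w p [:: K p x; K p y; s] = eps * w p [:: x; y; s].
  by rewrite -Ks // KK // weps.
have [G1 G2 G3] := G z t; have [H1 H2 H3] := G t z.
rewrite G1 G2 G3 H1 H2 H3 (Fg _ v v') // (Fg _ u u') // (Fw _ u u') // (Fw _ v v') //.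
have Q1 x s : g p [:: x; v' p; s] = eps * w p [:: x; v p; s] by rewrite gE // hv // Ws.
have Q2 y s : g p [:: u p; y; s] = w p [:: u' p; y; s] by rewrite gE // hu.
have Q3 x s : g p [:: x; v p; s] = w p [:: x; v' p; s] by rewrite gE // hv // Ks.
have Q4 y s : g p [:: u' p; y; s] = eps * w p [:: u p; y; s].
  by rewrite gE // hu // KK // weps.
rewrite !Q1 !Q3 !Q4 !Q2.
have -> : w p [:: lie_bracket u v p + eps *: lie_bracket u' v' p; z; t] =
    w p [:: lie_bracket u v p; z; t] + eps * w p [:: lie_bracket u' v' p; z; t].
  exact: (alt_head_lin _ _ _ _ (aw Up)).
have -> : g p [:: lie_bracket u v' p + lie_bracket u' v p; z; t] =
    g p [:: lie_bracket u v' p; z; t] + g p [:: lie_bracket u' v p; z; t].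
  rewrite -[X in _ + X]scale1r (alt_head_lin _ _ _ _ (ag Up)).
  congr (_ + _); exact: mul1r.
set T1 := 'D_(u p) _ _; set T2 := 'D_(v p) _ _; set T3 := 'D_z _ _; set T4 := 'D_t _ _.
set T5 := w p [:: 'D_z u p; _; _]; set T6 := w p [:: _; 'D_z v p; _].
set T7 := w p [:: 'D_t u p; _; _]; set T8 := w p [:: _; 'D_t v p; _].
apply: (eq_comb1 (- (T1 - T2 + (T3 - T4) - (T5 + T6) + (T7 + T8))) eps2).
set L1 := lie_bracket u v p; set L2 := lie_bracket u' v' p.
set L3 := lie_bracket u v' p; set L4 := lie_bracket u' v p.
clearbody L1 L2 L3 L4; gen_derive.
repeat match goal with |- context [w p ?l] =>
  let T := fresh "T" in set T := (w p l); clearbody T end.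
repeat match goal with |- context [g p ?l] =>
  let T := fresh "T" in set T := (g p l); clearbody T end.
ring.
Qed.

End KeyIdentity.

(** * Complex multilinear extension and types of forms *)

Section SubsetSums.
Variables (F : nmodType).

Definition lift0 k (S : {set 'I_k}) : {set 'I_k.+1} := lift ord0 @: S.

Lemma mem_lift0 k (S : {set 'I_k}) (i : 'I_k) : (lift ord0 i \in lift0 S) = (i \in S).
Proof. by rewrite mem_imset //; exact: lift_inj. Qed.

Lemma ord0_lift0 k (S : {set 'I_k}) : (ord0 \in lift0 S) = false.
Proof. by apply/negP => /imsetP[i _]. Qed.

(** Splits the subsets of the arguments according to whether they contain
    the first argument. *)
Lemma sum_set_lift k (G : {set 'I_k.+1} -> F) :
  \sum_S G S = \sum_(S : {set 'I_k}) (G (lift0 S) + G (ord0 |: lift0 S)).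
Proof.
pose h (u : bool * {set 'I_k}) := if u.1 then ord0 |: lift0 u.2 else lift0 u.2.
have h0 u : (ord0 \in h u) = u.1.
  by rewrite /h; case: u => -[] S /=; rewrite ?inE ?ord0_lift0.
have hl u i : (lift ord0 i \in h u) = (i \in u.2).
  by rewrite /h; case: u => -[] S /=; rewrite ?inE mem_lift0.
have hinj : injective h.
  move=> [b S] [c T] E; have bc : b = c by rewrite -[b]/((b, S).1) -h0 E h0.
  by rewrite bc; congr pair; apply/setP => i; rewrite -(hl (b, S)) E hl.
rewrite (reindex h) /=; last first.
  apply: onW_bij; apply: inj_card_bij => //.
  have cs m : #|{: {set 'I_m}}| = (2 ^ m)%N.
    by rewrite -cardsT -powersetT card_powerset cardsT card_ord.
  by rewrite card_prod card_bool !cs expnS.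
rewrite -(pair_bigA _ (fun b S => G (h (b, S)))) /= big_bool /= -big_split /=.
by apply: eq_bigr => S _; rewrite addrC.
Qed.

End SubsetSums.

Section Select.
Variables (T T' : Type) (x0 : T) (f g : T -> T').

Definition sel k (S : {set 'I_k}) (xs : seq T) : seq T' :=
  [seq (if r \in S then f (nth x0 xs r) else g (nth x0 xs r)) | r : 'I_k <- enum 'I_k].

Lemma sel_lift0 k (S : {set 'I_k}) x xs : sel (lift0 S) (x :: xs) = g x :: sel S xs.
Proof.
rewrite /sel enum_ordSl /= ord0_lift0; congr cons.
by rewrite -map_comp; apply: eq_map => i /=; rewrite mem_lift0.
Qed.

Lemma sel_ord0_lift0 k (S : {set 'I_k}) x xs : sel (ord0 |: lift0 S) (x :: xs) = f x :: sel S xs.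
Proof.
rewrite /sel enum_ordSl /= setU11; congr cons.
rewrite -map_comp; apply: eq_map => i /=.
by rewrite in_setU1 mem_lift0 eq_sym (negPf (neq_lift _ _)).
Qed.

Lemma size_sel k (S : {set 'I_k}) xs : size (sel S xs) = k.
Proof. by rewrite size_map size_enum_ord. Qed.

End Select.

Lemma card_lift0 k (S : {set 'I_k}) : #|lift0 S| = #|S|.
Proof. by rewrite card_imset //; exact: lift_inj. Qed.

Lemma card_ord0_lift0 k (S : {set 'I_k}) : #|ord0 |: lift0 S| = #|S|.+1.
Proof. by rewrite cardsU1 ord0_lift0 card_lift0. Qed.

(** The embedding of the real coordinates into complex values; [idC] serves
    forms on the complexified space. *)
Definition rC (R : realType) : {rmorphism (R : fieldType) -> (R[i] : numFieldType)} := real_complex R.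
Definition idC (R : realType) : {rmorphism (R[i] : fieldType) -> (R[i] : numFieldType)} := idfun.

Section Complexification.
Variables (R : realType) (n : nat).
Local Notation V := 'rV[R]_n.
Local Notation VC := 'rV[R[i]]_n.
Local Notation lform := (lform R R[i] n).
Local Notation alt k A := (altform (rC R) k A).
Local Notation altC k A := (altform (idC R) k A).
Implicit Types (A B : lform) (zs : seq VC) (z : VC) (xs : seq V).

(** The complex multilinear extension, one argument at a time;
    [complexify_formE] matches it with the sum over subsets of arguments. *)
Fixpoint cx A zs : R[i] :=
  if zs is z :: zs' then cx (ctr (re_vec z) A) zs' + 'i%C * cx (ctr (im_vec z) A) zs'
  else A [::].

Lemma cx_add A B zs : cx (ladd A B) zs = cx A zs + cx B zs.
Proof.
elim: zs A B => //= z zs IH A B.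
rewrite -[ctr (re_vec z) _]/(ladd (ctr _ A) (ctr _ B)) -[ctr (im_vec z) _]/(ladd (ctr _ A) (ctr _ B)).
by rewrite !IH; ring.
Qed.

Lemma cx_scl c A zs : cx (scl c A) zs = c * cx A zs.
Proof.
elim: zs A => //= z zs IH A.
rewrite -[ctr (re_vec z) _]/(scl c (ctr _ A)) -[ctr (im_vec z) _]/(scl c (ctr _ A)).
by rewrite !IH; ring.
Qed.

Lemma cx_0 zs : cx (@l0 _ _ _) zs = 0.
Proof. by elim: zs => //= z zs ->; rewrite mulr0 addr0. Qed.

Lemma re_cvec (u v : V) : re_vec (cvec u v) = u.
Proof. by apply/rowP => j; rewrite !mxE /=; simpc. Qed.

Lemma im_cvec (u v : V) : im_vec (cvec u v) = v.
Proof. by apply/rowP => j; rewrite !mxE /=; simpc. Qed.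

Lemma cx_cvec A u v zs : cx A (cvec u v :: zs) = cx (ctr u A) zs + 'i%C * cx (ctr v A) zs.
Proof. by rewrite /= re_cvec im_cvec. Qed.

Definition castv (x : V) : VC := map_mx (real_complex R) x.

Lemma re_castv x : re_vec (castv x) = x.
Proof. by apply/rowP => j; rewrite !mxE. Qed.

Lemma im_castv x : im_vec (castv x) = 0.
Proof. by apply/rowP => j; rewrite !mxE. Qed.

Lemma alt_ctr0 k A : alt k A -> ctr 0 A = @l0 _ _ _.
Proof.
move=> h; apply/funext => xs; have := alt_lin h [::] xs 0 0 0 0.
by rewrite !scale0r addr0 rmorph0 !mul0r addr0.
Qed.

Lemma cx_castv k A xs : alt k A -> cx A (map castv xs) = A xs.
Proof.
elim: xs k A => //= x xs IH k A h.
rewrite re_castv im_castv (alt_ctr0 h) cx_0 mulr0 addr0.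
by rewrite (IH k.-1) //; exact: alt_ctr_pred.
Qed.

Lemma re_lin (b c : R[i]) (x y : VC) : re_vec (b *: x + c *: y) =
  1 *: (complex.Re b *: re_vec x + (- complex.Im b) *: im_vec x) +
  1 *: (complex.Re c *: re_vec y + (- complex.Im c) *: im_vec y).
Proof.
apply/rowP => j; rewrite !mxE; case: (x 0 j) (y 0 j) b c => [? ?] [? ?] [? ?] [? ?] /=.
by simpc => /=; ring.
Qed.

Lemma im_lin (b c : R[i]) (x y : VC) : im_vec (b *: x + c *: y) =
  1 *: (complex.Im b *: re_vec x + complex.Re b *: im_vec x) +
  1 *: (complex.Im c *: re_vec y + complex.Re c *: im_vec y).
Proof.
apply/rowP => j; rewrite !mxE; case: (x 0 j) (y 0 j) b c => [? ?] [? ?] [? ?] [? ?] /=.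
by simpc => /=; ring.
Qed.

(** Alternation at two complex vectors follows from the alternation at their
    real and imaginary parts, as the two mixed terms are opposite. *)
Lemma alt_cx k A : alt k A -> altC k (cx A).
Proof.
move=> h; split.
- move=> zs; elim: zs k A h => [|z zs IH] k A h hs /=; first by rewrite (alt_deg h).
  case: k h hs => [|k] h hs.
    by rewrite !(deg_ctr0 _ (alt_deg h)) cx_0 mulr0 addr0.
  by rewrite !(IH k) ?mulr0 ?addr0 //; exact: alt_ctr.
- move=> s1 s2 b c x y; elim: s1 k A h => [|z s1 IH] k A h /=; last first.
    by rewrite !(IH _ _ (alt_ctr_pred _ h)) -[idC R b]/b -[idC R c]/c; ring.
  rewrite re_lin im_lin !(ctr_lin _ _ _ _ h) !cx_add !cx_scl rmorph1 !cx_add !cx_scl.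
  have hb := complexE b; have hc := complexE c.
  set X1 := cx _ _; set X2 := cx _ _; set X3 := cx _ _; set X4 := cx _ _.
  rewrite !rmorphN /rC /=.
  set b1 := _%:C%C; set b2 := _%:C%C; set c1 := _%:C%C; set c2 := _%:C%C.
  have ii : 'i%C ^+ 2 = -1 :> R[i] by exact: sqr_i.
  rewrite -/b1 -/b2 in hb; rewrite -/c1 -/c2 in hc.
  by apply: (eq_comb3 (- (b2 * X2 + c2 * X4)) (- (X1 + 'i%C * X2)) (- (X3 + 'i%C * X4)) ii hb hc); ring.
move=> s1 s2 z; elim: s1 k A h => [|y s1 IH] k A h /=; last first.
  by rewrite !(IH _ _ (alt_ctr_pred _ h)) mulr0 addr0.
have E x y : ctr y (ctr x A) = scl (-1) (ctr x (ctr y A)).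
  by apply/funext => ys; rewrite /ctr /scl (alt_anti [::] _ _ _ h) mulN1r.
have E0 x : ctr x (ctr x A) = @l0 _ _ _.
  by apply/funext => ys; exact: (alt_alt h [::]).
rewrite !E0 (E (re_vec z)) cx_scl !cx_0; ring.
Qed.

Definition cxsum k A zs : R[i] :=
  \sum_(S : {set 'I_k}) 'i%C ^+ #|S| * A (sel 0 (@im_vec R n) (@re_vec R n) S zs).

Lemma cxsumE k A zs : size zs = k -> cxsum k A zs = cx A zs.
Proof.
elim: zs k A => [|z zs IH] k A.
  move=> <-; rewrite /cxsum (big_pred1 finset.set0).
    by rewrite cards0 expr0 mul1r /=; congr A; apply: size0nil; rewrite size_sel.
  by move=> S /=; apply/esym/eqP/setP; case.
case: k => // k [hk]; rewrite /cxsum sum_set_lift big_split /=; congr (_ + _).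
  rewrite -(IH k) // /cxsum; apply: eq_bigr => S _.
  by rewrite card_lift0 sel_lift0.
rewrite -(IH k) // /cxsum mulr_sumr; apply: eq_bigr => S _.
by rewrite card_ord0_lift0 sel_ord0_lift0 exprS mulrA.
Qed.

Lemma complexify_formE k (a : form R[i] R n k) (N : 'M[R[i]]_(k, n)) :
  complexify_form a N = cx (lf a) (rws N).
Proof.
rewrite -(cxsumE _ (size_rws N)) /cxsum /complexify_form; apply: eq_bigr => S _.
congr (_ * _); rewrite /lf size_sel eqxx; congr a.
apply/row_matrixP => r; rewrite !rowK (nth_map r) ?size_enum_ord // nth_ord_enum.
by rewrite !nth_rws.
Qed.

Section Types.
Variable K : V -> V.
Local Notation p10 := (part10 K).
Local Notation p01 := (part01 K).

(** The component with q arguments of type (0,1), one argument at a time;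
    [type_partE] matches it with the sum over subsets. *)
Fixpoint tp (q : nat) (B : seq VC -> R[i]) xs : R[i] :=
  if xs is x :: xs' then tp q (fun zs => B (p10 x :: zs)) xs' +
     (if q is q'.+1 then tp q' (fun zs => B (p01 x :: zs)) xs' else 0)
  else if q is 0 then B [::] else 0.

Definition tpsum k (q : nat) (B : seq VC -> R[i]) xs : R[i] :=
  \sum_(S : {set 'I_k} | #|S| == q) B (sel 0 p01 p10 S xs).

Lemma tpsumE k (q : nat) (B : seq VC -> R[i]) xs : size xs = k -> tpsum k q B xs = tp q B xs.
Proof.
elim: xs k q B => [|x xs IH] k q B.
  move=> <-; rewrite /tpsum; case: q => [|q] /=.
    rewrite (big_pred1 finset.set0); first by congr B; apply: size0nil; rewrite size_sel.
    by move=> S /=; rewrite cards_eq0.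
  rewrite big_pred0 // => S; apply/negP => /eqP h.
  have := max_card (mem S); rewrite h card_ord //.
case: k => // k [hk]; rewrite /tpsum big_mkcond sum_set_lift big_split /=; congr (_ + _).
  rewrite -(IH k) // /tpsum [in RHS]big_mkcond; apply: eq_bigr => S _.
  by rewrite card_lift0 sel_lift0.
case: q => [|q]; first by rewrite big1 // => S _; rewrite card_ord0_lift0.
rewrite -(IH k) // /tpsum [in RHS]big_mkcond; apply: eq_bigr => S _.
by rewrite card_ord0_lift0 sel_ord0_lift0 eqSS.
Qed.

Lemma type_partE k (q : nat) (a : form R[i] R n k) M :
  type_part K q a M = tp q (cx (lf a)) (rws M).
Proof.
rewrite -(tpsumE _ _ (size_rws M)) /tpsum /type_part; apply: eq_bigr => S _.
rewrite complexify_formE; congr cx.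
by rewrite /rws /sel; apply: eq_map => r; rewrite rowK nth_rws.
Qed.

End Types.
End Complexification.

(** Replace the j-th argument by the vanishing sum: only its own term
    survives, all the others repeat an argument. *)
Lemma alt_dep (R0 : fieldType) (F : numFieldType) (f : {rmorphism R0 -> F}) n k
    (A : lform R0 F n) (m : nat) (y : 'I_m -> 'rV[R0]_n) (c : 'I_m -> R0) (j : 'I_m) :
  altform f k A -> \sum_i c i *: y i = 0 -> c j != 0 -> A [seq y i | i <- enum 'I_m] = 0.
Proof.
move=> h hs cj.
have [s1 [s2 [E nj]]] : exists s1 s2 : seq 'I_m,
    enum 'I_m = s1 ++ j :: s2 /\ forall i, i != j -> i \in s1 ++ s2.
  have je : j \in enum 'I_m by rewrite mem_enum.
  case/splitPr: je (enum_uniq 'I_m) (mem_enum 'I_m) => s1 s2 _ me.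
  exists s1, s2; split=> // i ij; have := me i.
  by rewrite !mem_cat !inE (negPf ij).
rewrite E map_cat /=.
have := alt_sum (map y s1) (map y s2) (index_enum 'I_m) c y h.
rewrite hs (bigD1 j) //= big1 ?addr0 => [|i ij].
  have := alt_lin h (map y s1) (map y s2) 0 0 0 0.
  rewrite !scale0r addr0 rmorph0 !mul0r addr0 => -> /esym/eqP.
  by rewrite mulf_eq0 fmorph_eq0 (negPf cj) => /eqP.
rewrite (alt_move _ _ _ h) [X in _ * (_ * X)](alt_nonuniq h) ?mulr0 //=.
by rewrite negb_and negbK -map_cat map_f // nj.
Qed.

(** Only the terms with at most one argument satisfying P survive. *)
Lemma expand_four_slots (V : zmodType) (F : comNzRingType) (B : seq V -> F) (P : V -> Prop)
    (a1 a2 a3 a4 b1 b2 b3 b4 : V) :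
  (forall s1 s2 x y, B (s1 ++ (x + y) :: s2) = B (s1 ++ x :: s2) + B (s1 ++ y :: s2)) ->
  (forall s1 s2 s3 x y, P x -> P y -> B (s1 ++ x :: s2 ++ y :: s3) = 0) ->
  P b1 -> P b2 -> P b3 -> P b4 ->
  B [:: a1 + b1; a2 + b2; a3 + b3; a4 + b4] = B [:: a1; a2; a3; a4] +
   (B [:: b1; a2; a3; a4] + B [:: a1; b2; a3; a4] + B [:: a1; a2; b3; a4] + B [:: a1; a2; a3; b4]).
Proof.
move=> L Z p1 p2 p3 p4.
rewrite (L [::]) !(L [:: _]) !(L [:: _; _]) !(L [:: _; _; _]) /=.
rewrite !(Z [::] [::] _ b1 b2) // !(Z [::] [:: _] _ b1 b3) // !(Z [::] [:: _; _] _ b1 b4) //.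
rewrite !(Z [:: _] [::] _ b2 b3) // !(Z [:: _] [:: _] _ b2 b4) //.
rewrite !(Z [:: _; _] [::] _ b3 b4) //.
by ring.
Qed.

Section FourForms.
Variable R : realType.
Local Notation V := 'rV[R]_6.
Local Notation VC := 'rV[R[i]]_6.
Variables (K : V -> V) (Phi : lform R R[i] 6).
Hypothesis Klin : forall b c x y, K (b *: x + c *: y) = b *: K x + c *: K y.
Hypothesis KK : forall x, K (K x) = - x.
Hypothesis aP : altform (rC R) 4 Phi.
Local Notation p10 := (part10 K).
Local Notation p01 := (part01 K).
Let B := cx Phi.
Let aB : altform (idC R) 4 B. Proof. exact: alt_cx. Qed.
Let ii : 'i%C ^+ 2 = -1 :> R[i]. Proof. exact: sqr_i. Qed.

Lemma part_sum v : p10 v + p01 v = castv v.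
Proof.
rewrite /part10 /part01; move: (K v) => u; rewrite -scalerDr; apply/rowP => j.
rewrite [RHS]mxE [LHS]mxE [X in _ * X]mxE [X in _ * (X + _)]mxE [X in _ * (_ + X)]mxE !mxE.
by apply/eqP; rewrite eq_complex /=; apply/andP; split; apply/eqP; field.
Qed.

Lemma p10D x y : p10 (x + y) = p10 x + p10 y.
Proof.
have := Klin 1 1 x y; rewrite /part10 !scale1r => ->.
move: (K x) (K y) => x' y'; rewrite -scalerDr; congr (_ *: _); apply/rowP => j.
rewrite [LHS]mxE [RHS]mxE [X in _ = X + _]mxE [X in _ = _ + X]mxE !mxE.
by apply/eqP; rewrite eq_complex /=; apply/andP; split;
  apply/eqP; ring.
Qed.

(** The projection to type (1,0) intertwines K with multiplication by i. *)
Lemma p10_lin (a b : R) x : p10 (a *: x + b *: K x) = (a%:C%C + 'i%C * b%:C%C) *: p10 x.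
Proof.
rewrite /part10 Klin KK.
move: (K x) => y; apply/rowP => j; rewrite mxE mxE [RHS]mxE [in RHS]mxE [in RHS]mxE !mxE.
by apply/eqP; rewrite eq_complex /=; apply/andP; split;
  apply/eqP; ring.
Qed.

(** In real dimension 6 the eight vectors x_i, K x_i have a linear relation;
    by [p10_lin] it becomes a complex relation between the four vectors p10
    x_i. *)
Lemma vanish_40 x1 x2 x3 x4 : B [:: p10 x1; p10 x2; p10 x3; p10 x4] = 0.
Proof.
pose x (i : 'I_4) : V := nth 0 [:: x1; x2; x3; x4] i.
pose N : 'M[R]_(4 + 4, 6) := col_mx (\matrix_i x i) (\matrix_i K (x i)).
have [u un0 uN] : exists2 u : 'rV[R]_(4 + 4), u != 0 & u *m N = 0.
  have : ~~ row_free N by rewrite /row_free neq_ltn (leq_ltn_trans (rank_leq_col N)).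
  rewrite -kermx_eq0 => /rowV0Pn[u /sub_kermxP uN un0]; by exists u.
pose a (i : 'I_4) := lsubmx u 0 i; pose b (i : 'I_4) := rsubmx u 0 i.
have S0 : \sum_i (a i *: x i + b i *: K (x i)) = 0.
  have E : lsubmx u *m (\matrix_i x i) + rsubmx u *m (\matrix_i K (x i)) = 0.
    by rewrite -mul_row_col hsubmxK.
  rewrite big_split /= -[RHS]E !mulmx_sum_row.
  by congr (_ + _); apply: eq_bigr => i _; rewrite rowK.
have SC : \sum_i ((a i)%:C%C + 'i%C * (b i)%:C%C) *: p10 (x i) = 0.
  under eq_bigr do rewrite -p10_lin.
  have p0 : p10 0 = 0 by have := p10_lin 0 0 0; rewrite !scale0r addr0 mulr0 addr0 scale0r.
  by rewrite -(big_morph p10 p10D p0) S0.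
have [j hj] : exists j, (a j)%:C%C + 'i%C * (b j)%:C%C != 0.
  apply: contrapT => hn; move/eqP: un0; apply; rewrite -(hsubmxK u).
  have ab i : a i = 0 /\ b i = 0.
    have : (a i)%:C%C + 'i%C * (b i)%:C%C = 0 by apply: contrapT => /eqP h; apply: hn; exists i.
    move=> h; split; [have := congr1 (@complex.Re R) h | have := congr1 (@complex.Im R) h];
      by rewrite /= !(mul0r, mul1r, mulr0, subr0, addr0, add0r, oppr0).
  have -> : lsubmx u = 0 by apply/rowP => i; have [h _] := ab i; rewrite [RHS]mxE; exact: h.
  have -> : rsubmx u = 0 by apply/rowP => i; have [_ h] := ab i; rewrite [RHS]mxE; exact: h.
  by rewrite row_mx0.
have := alt_dep aB SC hj.
by rewrite !enum_ordSl enum_ord0 /=.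
Qed.

Hypothesis H02 : forall u v s t, Phi [:: u; v; s; t] - Phi [:: K u; K v; s; t]
   + 'i%C * (Phi [:: u; K v; s; t] + Phi [:: K u; v; s; t]) = 0.

(* The real and imaginary parts of the two vectors of type (0,1) produce
   exactly the combination in H02. *)
Let Z12 u v z t : B [:: p01 u; p01 v; z; t] = 0.
Proof.
have sc c s1 s2 (y : VC) : B (s1 ++ c *: y :: s2) = c * B (s1 ++ y :: s2).
  have := alt_lin aB s1 s2 c 0 y 0.
  by rewrite scale0r addr0 rmorph0 mul0r addr0.
have sc2 c x y s : B [:: x, c *: y & s] = c * B [:: x, y & s] by exact: (sc c [:: x]).
have sc1 c y s : B (c *: y :: s) = c * B (y :: s) by exact: (sc c [::]).
rewrite sc1 sc2 /B !cx_cvec.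
pose Psi := ladd (ladd (ctr v (ctr u Phi)) (scl (-1) (ctr (K v) (ctr (K u) Phi))))
   (scl 'i%C (ladd (ctr (K v) (ctr u Phi)) (ctr v (ctr (K u) Phi)))).
have P0 : Psi = @l0 _ _ _.
  apply/funext => xs; have [|hx] := eqVneq (size xs) 2%N.
    case: xs => [|s [|t' []]] // _; rewrite /Psi /ladd /scl /ctr mulN1r.
    exact: H02.
  have d x y : Phi [:: x, y & xs] = 0 by rewrite (alt_deg aP) //= !eqSS.
  by rewrite /Psi /ladd /scl /ctr !d !(mulr0, addr0).
have := cx_0 [:: z; t] : cx (@l0 R R[i] 6) _ = 0.
rewrite -P0 /Psi !cx_add !cx_scl !cx_add => E.
set A1 := cx (ctr v (ctr u Phi)) _ in E *.
set A2 := cx (ctr (K v) (ctr u Phi)) _ in E *.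
set A3 := cx (ctr v (ctr (K u) Phi)) _ in E *.
set A4 := cx (ctr (K v) (ctr (K u) Phi)) _ in E *.
suff -> : A1 + 'i%C * A2 + 'i%C * (A3 + 'i%C * A4) = 0 by rewrite !mulr0.
by apply: (eq_comb2 A4 1 ii E); ring.
Qed.

(** Expand the four real arguments into types. Two arguments of type (0,1)
    give 0 by the hypothesis on Phi, none gives 0 by [vanish_40], and
    exactly one gives the component of type (3,1). *)
Lemma form4_eq0 : (forall xs, size xs = 4%N -> tp K 1 B xs = 0) -> Phi = @l0 _ _ _.
Proof.
move=> h1; apply/funext => xs; have [|hx] := eqVneq (size xs) 4%N; last first.
  by rewrite (alt_deg aP).
case: xs => [|x1 [|x2 [|x3 [|x4 []]]]] // _.
rewrite -(cx_castv _ aP) -/B [map _ _]/= -!part_sum.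
have L1 s1 s2 (x y : VC) : B (s1 ++ (x + y) :: s2) = B (s1 ++ x :: s2) + B (s1 ++ y :: s2).
  have := alt_lin aB s1 s2 1 1 x y.
  by rewrite !scale1r rmorph1 !mul1r.
have Zg s1 s2 s3 x y : (exists u, x = p01 u) -> (exists v, y = p01 v) ->
    B (s1 ++ x :: s2 ++ y :: s3) = 0.
  move=> [u ->] [v ->]; rewrite (alt_move _ _ _ aB) catA.
  rewrite -[B _]/(B ((p01 u :: (s1 ++ s2)) ++ p01 v :: s3)) (alt_move _ _ _ aB) /=.
  have -> : B [:: p01 v, p01 u & (s1 ++ s2) ++ s3] = 0; last by rewrite !mulr0.
  have [hs|hs] := eqVneq (size ((s1 ++ s2) ++ s3)) 2%N; last by rewrite (alt_deg aB) //= !eqSS.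
  by case: (_ ++ _) hs => [|z [|t []]] // _; exact: Z12.
have ex x : exists u, p01 x = p01 u by exists x.
rewrite (expand_four_slots (p10 x1) (p10 x2) (p10 x3) (p10 x4) L1 Zg (ex x1) (ex x2) (ex x3) (ex x4)).
have v40 := vanish_40 x1 x2 x3 x4.
have h := h1 [:: x1; x2; x3; x4] erefl.
move: v40 h; rewrite [tp _ _ _ _]/=.
move: {h1 L1 Zg} (B) => B'.
move: (p10 x1) (p10 x2) (p10 x3) (p10 x4) => a1 a2 a3 a4.
move: (p01 x1) (p01 x2) (p01 x3) (p01 x4) => b1 b2 b3 b4 v40 h.
rewrite v40 -[RHS]h.
ring.
Qed.

End FourForms.

(** * The normalised structure in a chart *)

Section ChartFacts.
Variables (R : realType) (X : manifold R 6) (S : monge_ampere X) (c : chart X) (eps : R).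
Local Notation E := 'rV[R]_6.
Local Notation U := (chart_img c).
Local Notation altR k A := (altform (idR R) k A).
Let Om (q : E) : form R R 6 2 := symp S c q.
Let w (q : E) : form R R 6 3 := ma_form S c q.
Let lam (q : E) : R := pfaffian (Om q) (w q).
Hypothesis heps : eps = 1 \/ eps = -1.
Hypothesis hl : forall q, U q -> 0 < eps * lam q.

Lemma chart_open : open U.
Proof. exact: chart_img_open. Qed.

Lemma eps_sq : eps ^+ 2 = 1.
Proof. by case: heps => ->; rewrite ?expr1n // sqrrN expr1n. Qed.

Let fOm q : U q -> is_form (Om q). Proof. exact: coefs_form. Qed.
Let fw q : U q -> is_form (w q). Proof. exact: coefs_form. Qed.
Let nd q : U q -> forall u : E, (forall v : E, Om q (col_mx u v) = 0) -> u = 0.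
Proof. by move=> Uq; exact: symp_nondeg. Qed.

Let O q := lf (Om q).
Let A q := lf (w q).
Let aA q : U q -> altR 3 (A q). Proof. by move=> Uq; exact: form_alt (fw Uq). Qed.

Lemma smooth_lf k (a : diff_form X k) xs : smooth_on U (fun q => lf (a c q) xs).
Proof.
rewrite /lf; case: eqP => _; last exact: (smooth_cst chart_open).
exact: coefs_smooth.
Qed.

Lemma smooth_wdg (B C : E -> lform R R 6) xs :
  (forall ys, smooth_on U (fun q => B q ys)) -> (forall ys, smooth_on U (fun q => C q ys)) ->
  smooth_on U (fun q => wdg (B q) (C q) xs).
Proof.
rewrite /wdg; elim: xs B C => [|x xs IH] B C sB sC /=.
  exact: (smooth_mul chart_open).
apply: (smooth_add chart_open).
  exact: (IH (fun q => ctr x (B q)) C (fun ys => sB (x :: ys)) sC).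
exact: (IH (fun q => sg (B q)) (fun q => ctr x (C q))
  (fun ys => smooth_mul chart_open (smooth_cst chart_open _) (sB ys)) (fun ys => sC (x :: ys))).
Qed.

Let smooth_vol xs : smooth_on U (fun q => vol (O q) xs).
Proof.
apply: (smooth_mul chart_open); first exact: (smooth_cst chart_open).
by apply: smooth_wdg => ys; [apply: smooth_wdg => zs|]; exact: smooth_lf.
Qed.

Let K0 q x := Kvec (O q) (A q) x.

Let smooth_K0 x : smooth_map_on U (fun q => K0 q x).
Proof.
move=> j; rewrite (_ : (fun q => _) = (fun q =>
   wdg (dx (idR R) j) (wdg (ctr x (A q)) (A q)) (bas R 6) * (vol (O q) (bas R 6))^-1)).
  apply: (smooth_mul chart_open); last first.
    apply: (smooth_inv chart_open _ (smooth_vol _)) => q Uq.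
    exact: (vol_bas_neq0 (fOm Uq) (nd Uq)).
  apply: smooth_wdg => ys; first exact: (smooth_cst chart_open).
  by apply: smooth_wdg => zs; exact: smooth_lf.
by apply/funext => q; rewrite /K0 /Kvec mxE.
Qed.

Let K0_lin q b d x y : U q -> K0 q (b *: x + d *: y) = b *: K0 q x + d *: K0 q y.
Proof.
move=> Uq.
exact: (K_lin (vol_alt (fOm Uq)) (aA Uq) (vol_bas_neq0 (fOm Uq) (nd Uq))
  (Kvec_vol (fOm Uq) (fw Uq) (nd Uq))).
Qed.

Let K0K0 q x : U q -> K0 q (K0 q x) = lam q *: x.
Proof. by move=> Uq; exact: (pfaffian_scalar (fOm Uq) (fw Uq) (nd Uq)). Qed.

(** The eigenvalue of K o K is polynomial in the entries of K. *)
Let smooth_lam : smooth_on U lam.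
Proof.
apply: (smooth_congr chart_open
  (f := fun q => \sum_j K0 q (be R 0) 0 j * K0 q (be R j) 0 0)); last first.
  apply: (smooth_sum chart_open) => j; apply: (smooth_mul chart_open); exact: smooth_K0.
move=> q Uq; have := K0K0 (be R 0) Uq.
have b00 : (be R 0 : E) 0 0 = 1 by rewrite /be mxE !eqxx.
move/(congr1 (fun u : E => u 0 0)); rewrite [RHS]mxE b00 mulr1 => <-.
rewrite [in RHS](row_be (K0 q (be R 0))).
have K0D x y : K0 q (x + y) = K0 q x + K0 q y.
  by have := K0_lin 1 1 x y Uq; rewrite !scale1r.
have K00 : K0 q 0 = 0.
  by have := K0_lin 0 0 0 0 Uq; rewrite !scale0r addr0.
rewrite (big_morph _ K0D K00) summxE; apply: eq_bigr => j _.
have := K0_lin (K0 q (be R 0) 0 j) 0 (be R j) 0 Uq.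
by rewrite !scale0r !addr0 => ->; rewrite [RHS]mxE.
Qed.

Let rho q : R := `|lam q| `^ (4%:R^-1).
Let r q : R := (rho q)^-1.

Let abs_lam q : U q -> `|lam q| = eps * lam q.
Proof.
move=> Uq; have := hl Uq; case: heps => -> ; rewrite ?mul1r ?mulN1r => h.
  exact: gtr0_norm.
by rewrite ltr0_norm // -oppr_gt0.
Qed.

Let rho_gt0 q : U q -> 0 < rho q.
Proof. by move=> Uq; rewrite powR_gt0 // abs_lam // hl. Qed.

Let r_gt0 q : U q -> 0 < r q.
Proof. by move=> Uq; rewrite invr_gt0 rho_gt0. Qed.

(* K is quadratic in the 3-form, so K o K scales with the fourth power of r:
   this turns lam into eps. *)
Let r4 q : U q -> r q ^+ 4 * (eps * lam q) = 1.
Proof.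
move=> Uq; rewrite /r -abs_lam // exprVn.
have -> : `|lam q| = rho q ^+ 4.
  rewrite -powR_mulrn ?ltW ?rho_gt0 // /rho -powRrM mulVf ?pnatr_eq0 //.
  by rewrite powRr1.
by rewrite mulVf // expf_neq0 // gt_eqF // rho_gt0.
Qed.

Let smooth_r : smooth_on U r.
Proof.
apply: (smooth_inv chart_open); first by move=> q Uq; rewrite gt_eqF // rho_gt0.
apply: (smooth_congr chart_open (f := fun q => (eps * lam q) `^ (4%:R^-1))).
  by move=> q Uq; rewrite /rho abs_lam.
apply: (smooth_powR (f := fun q => eps * lam q) chart_open _ hl).
exact: (smooth_mul chart_open (smooth_cst chart_open eps) smooth_lam).
Qed.

Let nf q := normalized_form S c q.
(** The forms w, g and the endomorphism K of the introduction, in the chart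
    c. *)
Definition Wf q := lf (nf q).
Definition Kf q : E -> E := assoc_K S c q.
Definition Gf q := wK (Wf q) (Kf q).

Let WE q : Wf q = scl (r q) (A q).
Proof.
apply/funext => xs; rewrite /Wf /A /scl /lf; case: ifP => _; last by rewrite mulr0.
by rewrite /nf /normalized_form /normalize mulrC.
Qed.

Let fnf q : U q -> is_form (nf q).
Proof.
move=> Uq; have [ml al] := fw Uq.
have nfE N : nf q N = w q N / rho q by [].
split.
  move=> i M B C b d h1 h2 h3; rewrite !nfE.
  by rewrite (ml i M B C b d h1 h2 h3); ring.
by move=> M i j ij h; rewrite !nfE (al M i j ij h) mul0r.
Qed.

Lemma alt_W q : U q -> altR 3 (Wf q).
Proof. by move=> Uq; exact: form_alt (fnf Uq). Qed.

Let KvecE q x : U q -> Kf q x = Kvec (O q) (Wf q) x.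
Proof. by move=> Uq; exact: (hitchinK_Kvec (fOm Uq) (fnf Uq) (nd Uq)). Qed.

Let hK q x : U q -> ctr (Kf q x) (vol (O q)) = wdg (ctr x (Wf q)) (Wf q).
Proof. by move=> Uq; rewrite KvecE //; exact: (Kvec_vol (fOm Uq) (fnf Uq) (nd Uq)). Qed.

Let ath q : U q -> altR 6 (vol (O q)).
Proof. by move=> Uq; exact: (vol_alt (fOm Uq)). Qed.

Let th0 q : U q -> vol (O q) (bas R 6) != 0.
Proof. by move=> Uq; exact: (vol_bas_neq0 (fOm Uq) (nd Uq)). Qed.

Let KE q x : U q -> Kf q x = (r q ^+ 2) *: K0 q x.
Proof.
move=> Uq; apply: (ctr_th_inj (ath Uq) (th0 Uq)); rewrite hK //.
have := ctr_lin (r q ^+ 2) 0 (K0 q x) 0 (ath Uq).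
rewrite scale0r addr0 rmorph0 scl0 ladd0 => ->.
rewrite /K0 (Kvec_vol (fOm Uq) (fw Uq) (nd Uq)) WE -[ctr x _]/(scl (r q) (ctr x (A q))).
by rewrite wdZl wdZr sclA -expr2.
Qed.

Lemma Kf_lin q b d x y : U q -> Kf q (b *: x + d *: y) = b *: Kf q x + d *: Kf q y.
Proof. by move=> Uq; exact: (K_lin (ath Uq) (alt_W Uq) (th0 Uq) (fun z => hK z Uq)). Qed.

Lemma Kf_sq q x : U q -> Kf q (Kf q x) = eps *: x.
Proof.
move=> Uq; rewrite !KE // -[_ *: K0 q x]addr0 -(scale0r 0) K0_lin // K0K0 //.
rewrite scale0r addr0 !scalerA; congr (_ *: _).
have e2 := eps_sq; have h := r4 Uq.
apply: (eq_comb2 eps (- (r q ^+ 4 * lam q)) h e2).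
set a := r q; set b := lam q; ring.
Qed.

Lemma Kf_sym q x y s : U q -> Wf q [:: Kf q x, y & s] = Wf q [:: x, Kf q y & s].
Proof. by move=> Uq; exact: (K_sym (ath Uq) (alt_W Uq) (th0 Uq) (fun z => hK z Uq)). Qed.

Lemma alt_G q : U q -> altR 3 (Gf q).
Proof. by move=> Uq; exact: (alt_wK (ath Uq) (alt_W Uq) (th0 Uq) (fun z => hK z Uq)). Qed.

Lemma Wf_nondeg q x : U q -> (forall s, Wf q (x :: s) = 0) -> x = 0.
Proof.
move=> Uq h; have : Kf q x = 0.
  apply: (ctr_th0 (ath Uq) (th0 Uq)); rewrite hK // (_ : ctr x _ = @l0 _ _ _) ?wd0l //.
  by apply/funext => s; exact: h.
have K00 : Kf q 0 = 0 by have := Kf_lin 0 0 0 0 Uq; rewrite !scale0r addr0.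
have en : eps != 0 by case: heps => ->; rewrite ?oppr_eq0 oner_eq0.
move=> Kx; have := Kf_sq x Uq; rewrite Kx K00 => /esym/eqP.
by rewrite scaler_eq0 (negPf en) => /eqP.
Qed.

Lemma smooth_W xs : smooth_on U (fun q => Wf q xs).
Proof.
rewrite (_ : (fun q => _) = fun q => r q * A q xs).
  exact: (smooth_mul chart_open smooth_r (smooth_lf _ _)).
by apply/funext => q; rewrite WE.
Qed.

Lemma smooth_K x : smooth_map_on U (fun q => Kf q x).
Proof.
move=> j; apply: (smooth_congr chart_open (f := fun q => r q ^+ 2 * K0 q x 0 j)).
  by move=> q Uq; rewrite KE // [RHS]mxE.
apply: (smooth_mul chart_open); last exact: smooth_K0.
rewrite (_ : (fun q => _) = fun q => r q * r q); 
  first exact: (smooth_mul chart_open smooth_r smooth_r).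
by apply/funext => q; rewrite expr2.
Qed.

Lemma smooth_G xs : smooth_on U (fun q => Gf q xs).
Proof.
case: xs => [|x xs]; first exact: (smooth_cst chart_open).
apply: (slot_smooth chart_open (l := fun q y => Wf q (y :: xs)) (Y := fun q => Kf q x)).
- by move=> q y Uq; exact: (alt_exp [::] _ _ (alt_W Uq)).
- by move=> y; exact: smooth_W.
exact: smooth_K.
Qed.

(** K^* w = w (K ., K ., K .) = w (K K K ., ., .) by the symmetry of K, and
    K o K = eps. *)
Lemma lf_Kform q : U q -> lf (assoc_Kform S c q) = scl eps (Gf q).
Proof.
move=> Uq; apply/funext => xs; rewrite /scl.
have [|hx] := eqVneq (size xs) 3%N; last first.
  by rewrite (alt_deg (alt_G Uq)) // mulr0 lf_deg.
case: xs => [|x [|y [|z []]]] // _.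
rewrite /lf /= /assoc_Kform /pullback -(lf_rws (normalized_form S c q)).
rewrite -/(Wf q).
have -> : rws (\matrix_(i < 3) assoc_K S c q (row i (mxl 3 [:: x; y; z]))) =
    [:: Kf q x; Kf q y; Kf q z].
  by rewrite /rws !enum_ordSl enum_ord0 /= !rowK.
rewrite Kf_sym // Kf_sq //.
have anti a b d : Wf q [:: a; b; d] = - Wf q [:: a; d; b].
  exact: (alt_anti [:: a] [::] _ _ (alt_W Uq)).
have sc a s b : Wf q [:: a, eps *: b & s] = eps * Wf q [:: a, b & s].
  have := alt_lin (alt_W Uq) [:: a] s eps 0 b 0.
  by rewrite scale0r addr0 /= mul0r addr0.
rewrite sc; congr (_ * _).
by rewrite anti -Kf_sym // anti opprK.
Qed.

(** The dual form of the original 3-form A is eps wK / sqrt (eps lam), wK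
    has degree 3 in A, and the normalisation factor r satisfies r ^ 2 sqrt
    (eps lam) = 1. *)
Lemma lf_dual q : U q -> lf (normalized_dual S c q) = scl eps (Gf q).
Proof.
move=> Uq.
have hat : lf (hitchin_dual (Om q) (w q)) =
    scl (eps * (Num.sqrt (eps * lam q))^-1) (wK (A q) (K0 q)).
  have := hl Uq; case: heps => ->; rewrite ?mul1r ?mulN1r => h.
    exact: (hyper_dual (fOm Uq) (fw Uq) (nd Uq) h).
  by rewrite (ell_dual (fOm Uq) (fw Uq) (nd Uq)) ?mulN1r // -oppr_gt0.
have -> : lf (normalized_dual S c q) = scl (r q) (lf (hitchin_dual (Om q) (w q))).
  apply/funext => xs; rewrite /scl /lf; case: ifP => _; last by rewrite mulr0.
  by rewrite /normalized_dual /normalize mulrC.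
rewrite hat; set t := Num.sqrt _.
have t0 : 0 < t by rewrite sqrtr_gt0 hl.
have tt : t ^+ 2 = eps * lam q by rewrite sqr_sqrtr // ltW // hl.
have rt : r q ^+ 2 * t = 1.
  have h1 : 0 < r q ^+ 2 * t by rewrite mulr_gt0 // exprn_gt0 // r_gt0.
  apply/eqP; rewrite -(eqrXn2 (n := 2)) ?ltW // expr1n exprMn tt -exprM.
  by rewrite r4.
have tE : t^-1 = r q ^+ 2.
  by apply: (mulIf (lt0r_neq0 t0)); rewrite rt mulVf // lt0r_neq0.
apply/funext => -[|x xs]; rewrite /scl /=; first by rewrite !mulr0.
have -> : Wf q (Kf q x :: xs) = r q * (r q ^+ 2 * A q (K0 q x :: xs)).
  rewrite KE // WE /scl; congr (_ * _).
  have := alt_lin (aA Uq) [::] xs (r q ^+ 2) 0 (K0 q x) 0.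
  by rewrite scale0r addr0 /= mul0r addr0.
rewrite tE; set a := r q; set b := A q _; ring.
Qed.

End ChartFacts.

(** * The exterior derivative on lists of vectors *)

Section FourFormD4.
Variables (R : realType) (n : nat).
Local Notation E := 'rV[R]_n.
Variable U : set E.
Hypothesis oU : open U.
Variable b : E -> lform R R n.
Hypothesis ab : forall q, U q -> altform (idR R) 3 (b q).
Hypothesis sb : forall xs, smooth_on U (fun q => b q xs).
Variable p : E.
Hypothesis Up : U p.

Lemma derive_dir_lin (f : E -> R) (c d : R) (x y : E) : smooth_on U f ->
  'D_(c *: x + d *: y) f p = c * 'D_x f p + d * 'D_y f p.
Proof.
move=> sf; have [_ ->] := smooth_derive (c *: x + d *: y) oU sf Up.
have [_ ->] := smooth_derive x oU sf Up; have [_ ->] := smooth_derive y oU sf Up.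
rewrite !mulr_sumr -big_split /=; apply: eq_bigr => i _.
by rewrite !mxE; ring.
Qed.

Lemma derive_slot_lin s1 s2 (c d : R) (x y e : E) :
  'D_e (fun q => b q (s1 ++ (c *: x + d *: y) :: s2)) p =
  c * 'D_e (fun q => b q (s1 ++ x :: s2)) p + d * 'D_e (fun q => b q (s1 ++ y :: s2)) p.
Proof.
rewrite -!(derive_scale oU) //.
rewrite (@derive_eq_on _ _ U oU (fun q => b q (s1 ++ (c *: x + d *: y) :: s2))
   ((fun q => c * b q (s1 ++ x :: s2)) +
   (fun q => d * b q (s1 ++ y :: s2))) p e) //; last first.
  by move=> q Uq; exact: (alt_lin (ab Uq) s1 s2 c d x y).
by rewrite deriveD //; apply: (smooth_derivable oU) => //; apply: (smooth_mul oU) => //;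
  exact: (smooth_cst oU).
Qed.

Lemma derive_zero_on s e : (forall q, U q -> b q s = 0) -> 'D_e (fun q => b q s) p = 0.
Proof. by move=> h; rewrite (@derive_eq_on _ _ U oU _ (cst 0) p e) // derive_cst. Qed.

Definition d4_form : lform R R n :=
  fun xs => if xs is [:: x; y; z; t] then d4 b p x y z t else 0.

Lemma alt_d4_form : altform (idR R) 4 d4_form.
Proof.
split.
- by case=> [|? [|? [|? [|? []]]]].
- move=> s1 s2 c d x y; rewrite -[idR R c]/c -[idR R d]/d.
  case: s1 => [|a1 [|a2 [|a3 [|a4 s1]]]]; last first.
  + by case: s1 => [|? ?] /=; rewrite !mulr0 addr0.
  + case: s2 => [|e1 s2] /=; last by rewrite !mulr0 addr0.
    have /= h1 := derive_slot_lin [:: a2; a3] [::] c d x y a1.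
    have /= h2 := derive_slot_lin [:: a1; a3] [::] c d x y a2.
    have /= h3 := derive_slot_lin [:: a1; a2] [::] c d x y a3.
    by rewrite /d4 h1 h2 h3 (derive_dir_lin c d x y (sb [:: a1; a2; a3])); gen_derive; ring.
  + case: s2 => [|e1 [|e2 s2]] /=; rewrite ?mulr0 ?addr0 //.
    have /= h1 := derive_slot_lin [:: a2] [:: e1] c d x y a1.
    have /= h2 := derive_slot_lin [:: a1] [:: e1] c d x y a2.
    have /= h3 := derive_slot_lin [:: a1; a2] [::] c d x y e1.
    by rewrite /d4 h1 h2 h3 (derive_dir_lin c d x y (sb [:: a1; a2; e1])); gen_derive; ring.
  + case: s2 => [|e1 [|e2 [|e3 s2]]] /=; rewrite ?mulr0 ?addr0 //.
    have /= h1 := derive_slot_lin [::] [:: e1; e2] c d x y a1.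
    have /= h2 := derive_slot_lin [:: a1] [:: e2] c d x y e1.
    have /= h3 := derive_slot_lin [:: a1] [:: e1] c d x y e2.
    by rewrite /d4 h1 h2 h3 (derive_dir_lin c d x y (sb [:: a1; e1; e2])); gen_derive; ring.
  case: s2 => [|e1 [|e2 [|e3 [|e4 s2]]]] /=; rewrite ?mulr0 ?addr0 //.
  have /= h1 := derive_slot_lin [::] [:: e2; e3] c d x y e1.
  have /= h2 := derive_slot_lin [::] [:: e1; e3] c d x y e2.
  have /= h3 := derive_slot_lin [::] [:: e1; e2] c d x y e3.
  by rewrite /d4 h1 h2 h3 (derive_dir_lin c d x y (sb [:: e1; e2; e3])); gen_derive; ring.
move=> s1 s2 x.
have Z1 y q : U q -> b q [:: x; x; y] = 0 by move=> Uq; exact: (alt_alt (ab Uq) [::]).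
have Z2 y q : U q -> b q [:: y; x; x] = 0 by move=> Uq; exact: (alt_alt (ab Uq) [:: _]).
case: s1 => [|a1 [|a2 [|a3 s1]]]; last by case: s1 => [|? [|? ?]].
- case: s2 => [|e1 [|e2 []]] //=.
  by rewrite /d4 !(derive_zero_on _ (Z1 _)) !subrr addr0.
- case: s2 => [|e1 []] //=.
  by rewrite /d4 !(derive_zero_on _ (Z1 _)) !(derive_zero_on _ (Z2 _)) sub0r subr0 addNr.
case: s2 => [|e1 s2] //=.
by rewrite /d4 !(derive_zero_on _ (Z2 _)) !subrr addr0.
Qed.

Lemma d4_scl (c : R) x y z t :
  d4 (fun q => scl c (b q)) p x y z t = c * d4 b p x y z t.
Proof. by rewrite /d4 /scl !(derive_scale oU) //; gen_derive; ring. Qed.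

Lemma d4_congr (b' : E -> lform R R n) x y z t :
  (forall q, U q -> b q = b' q) -> d4 b p x y z t = d4 b' p x y z t.
Proof.
move=> h; have D e xs : 'D_e (fun q => b q xs) p = 'D_e (fun q => b' q xs) p.
  by apply: (derive_eq_on oU e _ Up) => q Uq; rewrite h.
by rewrite /d4 !D.
Qed.

Lemma d4_add (b' : E -> lform R R n) x y z t : (forall xs, smooth_on U (fun q => b' q xs)) ->
  d4 (fun q => ladd (b q) (b' q)) p x y z t = d4 b p x y z t + d4 b' p x y z t.
Proof.
move=> sb'.
have A e xs : 'D_e (fun q => ladd (b q) (b' q) xs) p =
    'D_e (fun q => b q xs) p + 'D_e (fun q => b' q xs) p.
  by apply: deriveD; exact: (smooth_derivable oU).
by rewrite /d4 !A; gen_derive; ring.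
Qed.

End FourFormD4.

Section ExteriorDerivative.
Variables (R : realType) (n : nat).
Local Notation E := 'rV[R]_n.

Lemma ext_d_d4 (a : E -> form R R n 3) p (M : 'M[R]_(4, n)) :
  ext_d a p M = d4 (fun q => lf (a q)) p (nth 0 (rws M) 0) (nth 0 (rws M) 1)
     (nth 0 (rws M) 2) (nth 0 (rws M) 3).
Proof.
have EF i : (fun q => a q (row' i M)) = (fun q => lf (a q) (rws (row' i M))).
  by apply/funext => q; rewrite lf_rws.
have rr (i : 'I_4) (j : 'I_3) : row j (row' i M) = row (lift i j) M.
  by apply/rowP => k; rewrite !mxE.
rewrite /ext_d; under eq_bigr do rewrite EF.
rewrite !big_ord_recl big_ord0 /rws !enum_ordSl enum_ord0 /= !rr.
pose i1 : 'I_4 := lift ord0 ord0; pose i2 : 'I_4 := lift ord0 (lift ord0 ord0).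
pose i3 : 'I_4 := lift ord0 (lift ord0 (lift ord0 ord0)).
pose j1 : 'I_3 := lift ord0 ord0; pose j2 : 'I_3 := lift ord0 (lift ord0 ord0).
have l10 : lift i1 (ord0 : 'I_3) = ord0 by exact: val_inj.
have l11 : lift i1 j1 = i2 by exact: val_inj.
have l12 : lift i1 j2 = i3 by exact: val_inj.
have l20 : lift i2 (ord0 : 'I_3) = ord0 by exact: val_inj.
have l21 : lift i2 j1 = i1 by exact: val_inj.
have l22 : lift i2 j2 = i3 by exact: val_inj.
have l30 : lift i3 (ord0 : 'I_3) = ord0 by exact: val_inj.
have l31 : lift i3 j1 = i1 by exact: val_inj.
have l32 : lift i3 j2 = i2 by exact: val_inj.
rewrite -/i1 -/i2 -/i3 -/j1 -/j2 l10 l11 l12 l20 l21 l22 l30 l31 l32.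
rewrite /d4 /bump /= !exprS expr0; gen_derive.
by ring.
Qed.

End ExteriorDerivative.

Section Closedness.
Variables (R : realType) (X : manifold R 6).
Local Notation E := 'rV[R]_6.

Lemma ext_d_mxl (a : E -> form R R 6 3) p x y z t :
  ext_d a p (mxl 4 [:: x; y; z; t]) = d4 (fun q => lf (a q)) p x y z t.
Proof. by rewrite ext_d_d4 mxlK. Qed.

Lemma closed_d4 (a : tensor_field X (form R R 6 3)) :
  closed_form a <-> forall c p, chart_img c p ->
    forall x y z t, d4 (fun q => lf (a c q)) p x y z t = 0.
Proof.
split=> [h c p Up x y z t | h c p Up M]; first by rewrite -ext_d_mxl h.
by rewrite ext_d_d4 h.
Qed.

End Closedness.

(** * Brackets of eigenfields *)

Section Involutivity.
Variables (R : realType) (X : manifold R 6) (S : monge_ampere X) (c : chart X) (eps : R).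
Local Notation E := 'rV[R]_6.
Local Notation U := (chart_img c).
Hypothesis heps : eps = 1 \/ eps = -1.
Hypothesis hl : forall q, U q -> 0 < eps * pfaffian (symp S c q) (ma_form S c q).
Local Notation W := (Wf S c).
Local Notation G := (Gf S c).
Local Notation K := (Kf S c).

Lemma smooth_sub (U1 U2 : set E) (f : E -> R) : U1 `<=` U2 -> smooth_on U2 f -> smooth_on U1 f.
Proof. by move=> h sf s p Up; exact: sf (h _ Up). Qed.

Section OpenSubset.
Variables (N : set E) (s : R).
Hypotheses (oN : open N) (NU : N `<=` U) (s2 : s ^+ 2 = 1).
Variables (u v u' v' : E -> E) (p : E).
Hypotheses (su : smooth_map_on N u) (sv : smooth_map_on N v).
Hypotheses (su' : smooth_map_on N u') (sv' : smooth_map_on N v').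
Hypothesis hu : forall q, N q -> u' q = s *: K q (u q).
Hypothesis hv : forall q, N q -> v' q = s *: K q (v q).
Hypothesis Np : N p.

Let alt_cons q b d x y xs : N q ->
  W q (b *: x + d *: y :: xs) = b * W q (x :: xs) + d * W q (y :: xs).
Proof. by move=> Nq; exact: (alt_lin (alt_W S (NU Nq)) [::] xs b d x y). Qed.

Let W_s q x xs : N q -> W q (s *: x :: xs) = s * W q (x :: xs).
Proof. by move=> Nq; have := alt_cons s 0 x 0 xs Nq; rewrite scale0r addr0 mul0r addr0. Qed.

Let W_s2 q x y xs : N q -> W q [:: x, s *: y & xs] = s * W q [:: x, y & xs].
Proof.
move=> Nq; have := alt_lin (alt_W S (NU Nq)) [:: x] xs s 0 y 0.
by rewrite scale0r addr0 /= mul0r addr0.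
Qed.

(** [key_identity] for the endomorphism s K, with s = 1 or s = - 1; the sign
    selects the eigendistribution. *)
Lemma key_chart a b z t : a = lie_bracket u v p + eps *: lie_bracket u' v' p ->
  b = lie_bracket u v' p + lie_bracket u' v p ->
  d4 W p (u p) (v p) z t + eps * d4 W p (u' p) (v' p) z t
   - eps * (s * d4 G p (u p) (v' p) z t) - eps * (s * d4 G p (u' p) (v p) z t) =
  - W p [:: a; z; t] + eps * (s * G p [:: b; z; t]).
Proof.
move=> -> ->.
have sG xs : smooth_on N (fun q => G q xs).
  exact: (smooth_sub NU (smooth_G heps hl xs)).
rewrite -!(d4_scl oN sG Np s).
apply: (@key_identity R 6 N oN W (fun q => scl s (G q)) (fun q x => s *: K q x) eps
  _ _ _ _ _ _ _ _ u v u' v' z t p su sv su' sv' hu hv Np).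
- by move=> q Nq; exact: (alt_W S (NU Nq)).
- by move=> q Nq; apply: alt_scl; exact: (alt_G S (NU Nq)).
- by move=> xs; exact: (smooth_sub NU (smooth_W heps hl xs)).
- by move=> xs; exact: (smooth_mul oN (smooth_cst oN s) (sG xs)).
- exact: eps_sq.
- by move=> q x xs Nq; rewrite W_s.
- move=> q x Nq; have := Kf_lin S s 0 (K q x) 0 (NU Nq).
  rewrite scale0r !addr0 scale0r addr0 => ->.
  by rewrite (Kf_sq heps hl _ (NU Nq)) !scalerA -expr2 s2 mul1r.
by move=> q x y xs Nq; rewrite W_s // W_s2 // (Kf_sym S _ _ _ (NU Nq)).
Qed.

(** With d w = d g = 0 the key identity says that the contraction of w with
    a - eps s K b vanishes, and w is non-degenerate ([Wf_nondeg]). *)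
Lemma bracket_eq a b : a = lie_bracket u v p + eps *: lie_bracket u' v' p ->
  b = lie_bracket u v' p + lie_bracket u' v p ->
  (forall x y z t, d4 W p x y z t = 0) -> (forall x y z t, d4 G p x y z t = 0) ->
  a = (eps * s) *: K p b.
Proof.
move=> ha hb dW dG; have key z t := key_chart z t ha hb.
clear ha hb; apply/eqP; rewrite -subr_eq0; apply/eqP.
apply: (Wf_nondeg heps hl (NU Np)) => xs.
have [|hx] := eqVneq (size xs) 2%N; last by rewrite (alt_deg (alt_W S (NU Np))).
case: xs => [|z [|t []]] // _.
have := key z t; rewrite !dW !dG !mulr0 !subr0 addr0 => /esym E.
have := alt_cons 1 (- (eps * s)) a (K p b) [:: z; t] Np.
rewrite scale1r scaleNr mul1r => ->.
have GE : G p [:: b; z; t] = W p [:: K p b; z; t] by [].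
by apply: (eq_comb1 (-1) E); rewrite GE; ring.
Qed.

End OpenSubset.
End Involutivity.

(** * The hyperbolic case *)

Section ClosedPair.
Variables (R : realType) (X : manifold R 6) (S : monge_ampere X) (eps : R).
Local Notation E := 'rV[R]_6.
Hypothesis heps : eps = 1 \/ eps = -1.
Hypothesis hl : forall (c : chart X) q, chart_img c q ->
  0 < eps * pfaffian (symp S c q) (ma_form S c q).

(** The condition d w = d g = 0, in the letters of the introduction. *)
Definition closed_WG := forall (c : chart X) p, chart_img c p ->
  (forall x y z t, d4 (Wf S c) p x y z t = 0) /\ (forall x y z t, d4 (Gf S c) p x y z t = 0).

Let sG c xs : smooth_on (chart_img c) (fun q => Gf S c q xs).
Proof. exact: (smooth_G heps (hl (c := c))). Qed.

Let sW c xs : smooth_on (chart_img c) (fun q => Wf S c q xs).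
Proof. exact: (smooth_W heps (hl (c := c))). Qed.

(** The normalised dual form is eps g. *)
Lemma closed_pairP :
  closed_form (normalized_form S) /\ closed_form (normalized_dual S) <-> closed_WG.
Proof.
have dualE c p x y z t : chart_img c p ->
    d4 (fun q => lf (normalized_dual S c q)) p x y z t = eps * d4 (Gf S c) p x y z t.
  move=> Up; rewrite -(d4_scl (@chart_open _ _ c) (@sG c) Up).
  apply: (d4_congr (@chart_open _ _ c) Up) => q Uq; exact: (lf_dual heps (hl (c := c)) Uq).
split=> [[/closed_d4 h1 /closed_d4 h2] c p Up | h].
  split=> x y z t; first exact: h1.
  have := h2 c p Up x y z t; rewrite dualE // => /eqP; rewrite mulf_eq0 => /orP[/eqP e0|/eqP //].
  by case: heps => /eqP; rewrite e0 eq_sym ?oppr_eq0 oner_eq0.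
split; apply/closed_d4 => c p Up x y z t; have [h1 h2] := h c p Up; first exact: h1.
by rewrite dualE // h2 mulr0.
Qed.

End ClosedPair.

Section Hyperbolic.
Variables (R : realType) (X : manifold R 6) (S : monge_ampere X).
Hypothesis hyp : hyperbolic S.
Local Notation E := 'rV[R]_6.
Let heps : (1 : R) = 1 \/ (1 : R) = -1. Proof. by left. Qed.
Let hl (c : chart X) q : chart_img c q ->
  0 < 1 * pfaffian (symp S c q) (ma_form S c q).
Proof. by rewrite mul1r; exact: hyp. Qed.

Let sG c xs : smooth_on (chart_img c) (fun q => Gf S c q xs).
Proof. exact: (smooth_G heps (hl (c := c))). Qed.
Let sW c xs : smooth_on (chart_img c) (fun q => Wf S c q xs).
Proof. exact: (smooth_W heps (hl (c := c))). Qed.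

Let d4_comb (s : R) (a : tensor_field X (form R R 6 3)) c p x y z t :
  (forall q M, chart_img c q ->
     a c q M = 2%:R^-1 * (normalized_form S c q M + s * assoc_Kform S c q M)) ->
  chart_img c p ->
  d4 (fun q => lf (a c q)) p x y z t =
  2%:R^-1 * (d4 (Wf S c) p x y z t + s * d4 (Gf S c) p x y z t).
Proof.
move=> ha Up; have oU := @chart_open _ _ c.
have sGs xs : smooth_on (chart_img c) (fun q => scl s (Gf S c q) xs).
  by apply: (smooth_mul oU) => //; exact: (smooth_cst oU).
have sL xs : smooth_on (chart_img c) (fun q => ladd (Wf S c q) (scl s (Gf S c q)) xs).
  exact: (smooth_add oU (@sW c xs) (sGs xs)).
rewrite -(d4_scl oU (@sG c) Up) -(d4_add oU (@sW c) Up _ _ _ _ sGs) -(d4_scl oU sL Up).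
apply: (d4_congr oU Up) => q Uq; apply/funext => xs.
have := congr1 (fun h => h xs) (lf_Kform heps (hl (c := c)) Uq).
rewrite {1}/scl mul1r => GE; rewrite /scl /ladd -GE /Wf /lf; case: ifP => _; first by rewrite ha.
by rewrite mulr0 addr0 mulr0.
Qed.

(** Closedness of alpha and beta is that of w and g. For eigenfields Y and Z
    with eigenvalue s, [bracket_eq] with u' = u = Y and v' = v = Z says that
    2 [Y, Z] = s K (2 [Y, Z]). *)
Lemma hyperbolic_case : integrable_real_CY (assoc_hyperbolic S) <-> closed_WG S.
Proof.
have alphaE c p x y z t (Up : chart_img c p) := @d4_comb 1 (CY_alpha (assoc_hyperbolic S))
  c p x y z t (fun q M _ => congr1 (fun u => 2%:R^-1 * (normalized_form S c q M + u))
    (esym (mul1r (assoc_Kform S c q M)))) Up.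
have betaE c p x y z t (Up : chart_img c p) := @d4_comb (-1) (CY_beta (assoc_hyperbolic S))
  c p x y z t (fun q M _ => congr1 (fun u => 2%:R^-1 * (normalized_form S c q M + u))
    (esym (mulN1r (assoc_Kform S c q M)))) Up.
split=> [[_ /closed_d4 ca /closed_d4 cb] c p Up | h].
  have ab x y z t : d4 (Wf S c) p x y z t = 0 /\ d4 (Gf S c) p x y z t = 0.
    have := ca c p Up x y z t; have := cb c p Up x y z t.
    rewrite alphaE // betaE //; set d1 := d4 _ _ _ _ _ _; set d2 := d4 _ _ _ _ _ _.
    move=> h1 h2; split.
      by apply: (eq_comb2 1 1 h1 h2); field.
    by apply: (eq_comb2 (-1) 1 h1 h2); field.
  by split=> x y z t; have [] := ab x y z t.
split; last 2 first.
- apply/closed_d4 => c p Up x y z t; have [h1 h2] := h c p Up.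
  by rewrite alphaE // h1 h2 mulr0 addr0 mulr0.
- apply/closed_d4 => c p Up x y z t; have [h1 h2] := h c p Up.
  by rewrite betaE // h1 h2 mulr0 addr0 mulr0.
have inv (s : R) : s ^+ 2 = 1 -> involutive_dist (eigendist (CY_K (assoc_hyperbolic S)) s).
  move=> s2 c N oN NU Y Z sY sZ hY hZ p Np.
  have [h1 h2] := h c p (NU _ Np).
  have fix_ V q : N q -> (forall q, N q -> eigendist (CY_K (assoc_hyperbolic S)) s c q (V q)) ->
      V q = s *: Kf S c q (V q).
    by move=> Nq hV; have : Kf S c q (V q) = s *: V q := hV q Nq;
      move=> ->; rewrite scalerA -expr2 s2 scale1r.
  have := bracket_eq heps (hl (c := c)) oN NU s2 sY sZ sY sZ
    (fun q Nq => fix_ Y q Nq hY) (fun q Nq => fix_ Z q Nq hZ) Np erefl erefl h1 h2.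
  rewrite mul1r scale1r; move: (lie_bracket Y Z p) => b.
  have UNp := NU _ Np.
  have KD : Kf S c p (b + b) = Kf S c p b + Kf S c p b.
    by have := Kf_lin S 1 1 b b UNp; rewrite !scale1r.
  rewrite KD -!mulr2n -scaler_nat -[in RHS]scaler_nat scalerA mulrC -scalerA.
  have two : (2%:R : R) != 0 by rewrite pnatr_eq0.
  move/(scalerI two) => E.
  have EE : Kf S c p b = s *: b by rewrite {2}E scalerA -expr2 s2 scale1r.
  exact: EE.
by split; apply: inv; rewrite ?expr1n // sqrrN expr1n.
Qed.

End Hyperbolic.

(** * The elliptic case *)

Section TypeThreeZero.
Variables (R : realType).
Local Notation V := 'rV[R]_6.
Variable K : V -> V.

(** Complex linearity of A for K means that A does not distinguish x from
    its (1,0) part x / 2 - i K x / 2. *)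
Lemma tp0_cx k (A : lform R R[i] 6) xs : altform (rC R) k A ->
  (forall s1 s2 x, A (s1 ++ K x :: s2) = 'i%C * A (s1 ++ x :: s2)) ->
  tp K 0 (cx A) xs = A xs.
Proof.
have ii : 'i%C ^+ 2 = -1 :> R[i] by exact: sqr_i.
elim: xs k A => [|x xs IH] k A h hi //=; rewrite addr0.
have -> : (fun zs => cx A (part10 K x :: zs)) = cx (ctr x A).
  apply/funext => zs; rewrite /part10.
  have := alt_lin (alt_cx h) [::] zs 2%:R^-1 0 (cvec x (- K x)) 0.
  rewrite scale0r addr0 rmorph0 mul0r addr0 [_ ++ _]/= [X in _ = _ * cx _ X]/= => ->.
  rewrite cx_cvec.
  have -> : ctr (- K x) A = scl (- 'i%C) (ctr x A).
    apply/funext => ys; have := alt_lin h [::] ys (-1) 0 (K x) 0.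
    rewrite scale0r addr0 rmorph0 mul0r addr0 scaleN1r rmorphN1 (hi [::]) /= => E.
    by rewrite /ctr /scl E; ring.
  rewrite cx_scl -[idC R _]/(2%:R^-1); set c := cx _ _.
  by apply: (eq_comb1 (- 2%:R^-1 * c) ii); field.
rewrite (IH k.-1) //; first exact: alt_ctr_pred.
by move=> s1 s2 y; exact: (hi (x :: s1)).
Qed.

(** Eigenvectors for - s i are the vectors x + i s K x. *)
Lemma ceigP (s : R) (z : 'rV[R[i]]_6) : s ^+ 2 = 1 ->
  complexify_end K z = (- s%:C%C * 'i%C) *: z <->
  K (re_vec z) = s *: im_vec z /\ K (im_vec z) = - s *: re_vec z.
Proof.
move=> s2.
have E : (- s%:C%C * 'i%C) *: z = cvec (s *: im_vec z) (- s *: re_vec z).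
  apply/rowP => j; rewrite [LHS]mxE [RHS]mxE !mxE.
  case: (z 0 j) => a b; apply/eqP.
  by rewrite eq_complex /=; apply/andP; split; apply/eqP; ring.
rewrite E /complexify_end; split=> [h | [-> ->] //].
have := congr1 (@re_vec R 6) h; have := congr1 (@im_vec R 6) h.
by rewrite !re_cvec !im_cvec => -> ->.
Qed.

End TypeThreeZero.

Section Elliptic.
Variables (R : realType) (X : manifold R 6) (S : monge_ampere X).
Hypothesis ell : elliptic S.
Local Notation E := 'rV[R]_6.
Let heps : (-1 : R) = 1 \/ (-1 : R) = -1. Proof. by right. Qed.
Let hl (c : chart X) q : chart_img c q ->
  0 < -1 * pfaffian (symp S c q) (ma_form S c q).
Proof. by move=> Uq; rewrite mulN1r oppr_gt0; exact: ell. Qed.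

Let sG c xs : smooth_on (chart_img c) (fun q => Gf S c q xs).
Proof. exact: (smooth_G heps (hl (c := c))). Qed.
Let sW c xs : smooth_on (chart_img c) (fun q => Wf S c q xs).
Proof. exact: (smooth_W heps (hl (c := c))). Qed.

Let alpha := CY_alpha (assoc_elliptic S).
Let a0 : R := 4%:R / 3%:R.

Let alphaE c q M : alpha c q M =
  (a0 * normalized_form S c q M)%:C%C + 'i%C * (a0 * assoc_Kform S c q M)%:C%C.
Proof.
have a0C : a0%:C%C = 4%:R / 3%:R :> R[i] by rewrite /a0 rmorphM fmorphV !rmorph_nat.
have rm x : (a0 * x)%:C%C = 4%:R / 3%:R * x%:C%C :> R[i].
  by rewrite -a0C; exact: (rmorphM (rC R)).
by rewrite !rm mulrCA -mulrDr.
Qed.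

Let re_alpha c q : re_form (alpha c q) = (fun M => a0 * normalized_form S c q M).
Proof. by apply/funext => M; rewrite /re_form alphaE; simpc. Qed.

Let im_alpha c q : im_form (alpha c q) = (fun M => a0 * assoc_Kform S c q M).
Proof. by apply/funext => M; rewrite /im_form alphaE; simpc. Qed.

Let KformE c q : chart_img c q -> lf (assoc_Kform S c q) = scl (-1) (Gf S c q).
Proof. by move=> Uq; exact: (lf_Kform heps (hl (c := c)) Uq). Qed.

Let lf_scale (d : R) (a : form R R 6 3) : lf (fun M => d * a M) = scl d (lf a).
Proof. by apply/funext => xs; rewrite /scl /lf; case: ifP; rewrite ?mulr0. Qed.

Let d_re c p M : chart_img c p ->
  ext_d (fun q => re_form (alpha c q)) p M = a0 * d4_form (Wf S c) p (rws M).
Proof.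
move=> Up; rewrite ext_d_d4 /d4_form /rws !enum_ordSl enum_ord0 /=.
rewrite -(d4_scl (@chart_open _ _ c) (@sW c) Up).
by apply: (d4_congr (@chart_open _ _ c) Up) => q Uq; rewrite re_alpha lf_scale.
Qed.

Let d_im c p M : chart_img c p ->
  ext_d (fun q => im_form (alpha c q)) p M = - a0 * d4_form (Gf S c) p (rws M).
Proof.
move=> Up; rewrite ext_d_d4 /d4_form /rws !enum_ordSl enum_ord0 /=.
rewrite -(d4_scl (@chart_open _ _ c) (@sG c) Up).
apply: (d4_congr (@chart_open _ _ c) Up) => q Uq.
by rewrite im_alpha lf_scale KformE // sclA mulrN1.
Qed.

Let Phi c p : lform R R[i] 6 := ladd (mapf (rC R) (scl a0 (d4_form (Wf S c) p)))
  (scl 'i%C (mapf (rC R) (scl (- a0) (d4_form (Gf S c) p)))).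

Let rC_mul0 (d x : R) : x = 0 -> rC R (d * x) = 0.
Proof. by move=> ->; rewrite mulr0 rmorph0. Qed.

Let lf_d c p : chart_img c p -> lf (ext_dC (alpha c) p) = Phi c p.
Proof.
move=> Up; apply/funext => xs; rewrite /Phi /ladd /scl /mapf.
have [hs|hs] := eqVneq (size xs) 4%N; last first.
  have w0 := alt_deg (alt_d4_form (@chart_open _ _ c) (fun q => @alt_W R X S c q) (@sW c) Up) hs.
  have g0 := alt_deg (alt_d4_form (@chart_open _ _ c) (fun q => @alt_G R X S c q) (@sG c) Up) hs.
  by rewrite lf_deg // (rC_mul0 _ w0) (rC_mul0 _ g0) mulr0 addr0.
by rewrite /lf hs eqxx /ext_dC d_re // d_im // mxlK.
Qed.

(** An eigenfield has the form u + i s K u; [bracket_eq] is then the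
    eigenvalue equation for the bracket. The form alpha is closed, and K
    acts on it as multiplication by i, so it has type (3,0). *)
Lemma elliptic_integrable : closed_WG S -> integrable_CY (assoc_elliptic S).
Proof.
move=> h.
have inv (s : R) : s ^+ 2 = 1 ->
    cinvolutive_dist (ceigendist (CY_K (assoc_elliptic S)) (- s%:C%C * 'i%C)).
  move=> s2 c N oN NU Y Z [sY1 sY2] [sZ1 sZ2] hY hZ p Np.
  have [h1 h2] := h c p (NU _ Np).
  have fix_ (T : E -> 'rV[R[i]]_6) q : N q -> (forall q, N q ->
      ceigendist (CY_K (assoc_elliptic S)) (- s%:C%C * 'i%C) c q (T q)) ->
      im_vec (T q) = s *: Kf S c q (re_vec (T q)).
    move=> Nq hT; have /(ceigP _ _ s2)[hr _] := hT q Nq.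
    by rewrite -[Kf S c q]/(CY_K (assoc_elliptic S) c q) hr scalerA -expr2 s2 scale1r.
  suff gen a b : a = lie_bracket (@re_vec R 6 \o Y) (@re_vec R 6 \o Z) p
        - lie_bracket (@im_vec R 6 \o Y) (@im_vec R 6 \o Z) p ->
      b = lie_bracket (@re_vec R 6 \o Y) (@im_vec R 6 \o Z) p
        + lie_bracket (@im_vec R 6 \o Y) (@re_vec R 6 \o Z) p ->
      ceigendist (CY_K (assoc_elliptic S)) (- s%:C%C * 'i%C) c p (cvec a b).
    exact: (gen _ _ erefl erefl).
  move=> ha hb; rewrite -scaleN1r in ha.
  have E := @bracket_eq R X S c (-1) heps (hl (c := c)) N s oN NU s2 _ _ _ _ p sY1 sZ1 sY2 sZ2
    (fun q Nq => fix_ Y q Nq hY) (fun q Nq => fix_ Z q Nq hZ) Np a b ha hb h1 h2.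
  apply/(ceigP _ _ s2).
  rewrite re_cvec im_cvec.
  have UNp := NU _ Np.
  have KZ d x : Kf S c p (d *: x) = d *: Kf S c p x.
    by have := Kf_lin S d 0 x 0 UNp; rewrite !scale0r !addr0.
  rewrite -[CY_K (assoc_elliptic S) c p]/(Kf S c p).
  split.
    rewrite {1}E KZ (Kf_sq heps (hl (c := c)) _ UNp) scalerA; congr (_ *: _); ring.
  rewrite E scalerA [X in X *: _](_ : _ = 1) ?scale1r //.
  by apply: (eq_comb1 1 s2); ring.
split.
  split; first by have := inv (-1); rewrite sqrrN expr1n => /(_ erefl); rewrite rmorphN1 opprK mul1r.
  by have := inv 1; rewrite expr1n => /(_ erefl); rewrite rmorph1 mulN1r.
move=> c p Up; split=> M; last first.
  rewrite /dbar /type_part big1 // => T _; rewrite complexify_formE.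
  rewrite -/alpha lf_d // (_ : Phi c p = @l0 _ _ _) ?cx_0 //.
  apply/funext => xs; rewrite /Phi /ladd /scl /mapf /l0.
  have [h1 h2] := h c p Up.
  have D40 b : (forall x y z t, d4 b p x y z t = 0) -> d4_form b p xs = 0.
    by move=> hb; case: xs => [|? [|? [|? [|? []]]]] //=.
  have w0 := D40 _ h1; have g0 := D40 _ h2.
  by rewrite (rC_mul0 _ w0) (rC_mul0 _ g0) mulr0 addr0.
rewrite -/alpha type_partE.
have lfa : lf (alpha c p) = ladd (mapf (rC R) (scl a0 (Wf S c p)))
    (scl 'i%C (mapf (rC R) (scl (- a0) (Gf S c p)))).
  apply/funext => xs; rewrite /ladd /scl /mapf.
  have := congr1 (fun h => h xs) (KformE Up); rewrite {1}/scl mulN1r => GE.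
  rewrite mulNr -mulrN -GE /Wf /lf; case: ifP => _; first by rewrite alphaE.
  by rewrite mulr0 rmorph0 mulr0 addr0.
have aa : altform (rC R) 3 (lf (alpha c p)).
  rewrite lfa; apply: alt_add; [|apply: alt_scl]; apply: alt_map; apply: alt_scl.
    exact: (alt_W S Up).
  exact: (alt_G S Up).
rewrite (tp0_cx _ aa) ?lf_rws // => s1 s2 x.
have ii : 'i%C ^+ 2 = -1 :> R[i] by exact: sqr_i.
suff first_slot y ys : lf (alpha c p) (assoc_K S c p y :: ys) = 'i%C * lf (alpha c p) (y :: ys).
  rewrite !(alt_move _ _ _ aa) /= first_slot; ring.
rewrite lfa /ladd /scl /mapf -[assoc_K S c p]/(Kf S c p).
have -> : Wf S c p (Kf S c p y :: ys) = Gf S c p (y :: ys) by [].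
have -> : Gf S c p (Kf S c p y :: ys) = - Wf S c p (y :: ys).
  rewrite /Gf /= (Kf_sq heps (hl (c := c)) _ Up).
  have := alt_lin (alt_W S Up) [::] ys (-1) 0 y 0.
  by rewrite scale0r addr0 /= mul0r addr0 mulN1r.
rewrite mulrNN mulNr !rmorphN /=.
set u := rC R _; set v := rC R _.
by apply: (eq_comb1 u ii); ring.
Qed.

(** Involutivity on the fields x + i K x, with x constant, feeds the key
    identity and shows that d alpha kills two vectors of type (0,1);
    [form4_eq0] does the rest. *)
Lemma elliptic_closed : integrable_CY (assoc_elliptic S) -> closed_WG S.
Proof.
move=> [[_ inv] holo] c p Up.
have oU := @chart_open _ _ c.
have aD4W := alt_d4_form oU (fun q => @alt_W R X S c q) (@sW c) Up.
have aD4G := alt_d4_form oU (fun q => @alt_G R X S c q) (@sG c) Up.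
have aPhi : altform (rC R) 4 (Phi c p).
  by apply: alt_add; [|apply: alt_scl]; apply: alt_map; apply: alt_scl.
have KK x : Kf S c p (Kf S c p x) = - x by rewrite (Kf_sq heps (hl (c := c)) _ Up) scaleN1r.
(* Up to a constant factor, the left-hand side is the real part of d alpha (u
   + i K u, v + i K v, z, t); the imaginary part is the same expression at K u
   and v. *)
have key u v z t : d4_form (Wf S c) p [:: u; v; z; t] - d4_form (Wf S c) p [:: Kf S c p u; Kf S c p v; z; t]
   + d4_form (Gf S c) p [:: u; Kf S c p v; z; t] + d4_form (Gf S c) p [:: Kf S c p u; v; z; t] = 0.
  pose Y (x : E) := fun q => cvec x (Kf S c q x).
  have sc (x : E) : smooth_map_on (chart_img c) (fun=> x).
    by move=> j; exact: (smooth_cst oU).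
  have reY x : (@re_vec R 6 \o Y x) = (fun=> x) by apply/funext => q /=; rewrite re_cvec.
  have imY x : (@im_vec R 6 \o Y x) = (fun q => Kf S c q x) by apply/funext => q /=; rewrite im_cvec.
  have sY x : csmooth_on (chart_img c) (Y x).
    by split; rewrite ?reY ?imY //; exact: (smooth_K heps (hl (c := c))).
  have mY x q : chart_img c q -> ceigendist (CY_K (assoc_elliptic S)) (- 'i%C) c q (Y x q).
    move=> Uq; rewrite /ceigendist /= -[- 'i%C]mulN1r -(rmorph1 (rC R)).
    apply/ceigP; rewrite ?expr1n // /Y re_cvec im_cvec scale1r; split => //.
    by rewrite -[assoc_K S c q]/(Kf S c q) (Kf_sq heps (hl (c := c)) _ Uq).
  pose a := lie_bracket (fun=> u) (fun=> v) p -
    lie_bracket (fun q => Kf S c q u) (fun q => Kf S c q v) p.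
  pose b := lie_bracket (fun=> u) (fun q => Kf S c q v) p +
    lie_bracket (fun q => Kf S c q u) (fun=> v) p.
  have br : clie_bracket (Y u) (Y v) p = cvec a b by rewrite /clie_bracket !reY !imY.
  have ha : a = lie_bracket (fun=> u) (fun=> v) p +
      -1 *: lie_bracket (fun q => Kf S c q u) (fun q => Kf S c q v) p by rewrite scaleN1r.
  have hb : b = lie_bracket (fun=> u) (fun q => Kf S c q v) p +
    lie_bracket (fun q => Kf S c q u) (fun=> v) p by [].
  clearbody a b.
  have := inv c _ oU (fun=> id) (Y u) (Y v) (sY u) (sY v) (mY u) (mY v) p Up.
  rewrite /ceigendist /= br -[- 'i%C]mulN1r -(rmorph1 (rC R)) => /ceigP.
  move=> /(_ (expr1n _ _)); rewrite re_cvec im_cvec => -[_ Kb].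
  have := @key_chart R X S c (-1) heps (hl (c := c)) (chart_img c) 1 oU (fun=> id) (expr1n _ _)
    (fun=> u) (fun=> v) (fun q => Kf S c q u) (fun q => Kf S c q v) p (sc u) (sc v)
    (smooth_K heps (hl (c := c)) u) (smooth_K heps (hl (c := c)) v)
    (fun q _ => esym (scale1r _)) (fun q _ => esym (scale1r _)) Up a b z t ha hb.
  have -> : Gf S c p [:: b; z; t] = - Wf S c p [:: a; z; t].
    have Kb' : Kf S c p b = -1 *: a by exact: Kb.
    rewrite /Gf /= Kb'.
    have := alt_lin (alt_W S Up) [::] [:: z; t] (-1) 0 a 0.
    by rewrite scale0r addr0 /= mul0r addr0 mulN1r.
  rewrite /d4_form; move: (d4 _ _ _ _ _ _) (d4 _ _ _ _ _ _) (d4 _ _ _ _ _ _) (d4 _ _ _ _ _ _) => d1 d2 d3 d4'.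
  by move: (Wf S c p _) => y E; apply: (eq_comb1 1 E); ring.
have neg b : altform (idR R) 4 b -> forall x s, b (- x :: s) = - b (x :: s).
  move=> hb x s; have := alt_lin hb [::] s (-1) 0 x 0.
  by rewrite scale0r addr0 scaleN1r /= mul0r addr0 mulN1r.
have H02 u v z t : Phi c p [:: u; v; z; t] - Phi c p [:: Kf S c p u; Kf S c p v; z; t]
   + 'i%C * (Phi c p [:: u; Kf S c p v; z; t] + Phi c p [:: Kf S c p u; v; z; t]) = 0.
  have e1 := key u v z t; have e2 := key (Kf S c p u) v z t.
  rewrite KK !neg // in e2.
  rewrite /Phi /ladd /scl /mapf.
  move: e1 e2.
  move: (d4_form (Wf S c) p [:: u; v; z; t]) (d4_form (Wf S c) p [:: Kf S c p u; Kf S c p v; z; t])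
    (d4_form (Wf S c) p [:: u; Kf S c p v; z; t]) (d4_form (Wf S c) p [:: Kf S c p u; v; z; t])
    (d4_form (Gf S c) p [:: u; v; z; t]) (d4_form (Gf S c) p [:: Kf S c p u; Kf S c p v; z; t])
    (d4_form (Gf S c) p [:: u; Kf S c p v; z; t]) (d4_form (Gf S c) p [:: Kf S c p u; v; z; t]).
  move=> w1 w2 w3 w4 g1 g2 g3 g4 e1 e2.
  apply/eqP; rewrite eq_complex /=; apply/andP; split; apply/eqP.
    by apply: (eq_comb1 a0 e1); ring.
  by apply: (eq_comb1 a0 e2); ring.
have P0 : Phi c p = @l0 _ _ _.
  apply: (@form4_eq0 R (Kf S c p) (Phi c p)) => //.
    by move=> b d x y; exact: (Kf_lin S b d x y Up).
  move=> xs hs; have [_ h] := holo c p Up; have := h (mxl 4 xs).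
  by rewrite /dbar type_partE -/alpha lf_d // mxlK.
have a0n : a0 != 0 by rewrite /a0 mulf_neq0 ?invr_eq0 ?pnatr_eq0.
have D0 xs : d4_form (Wf S c) p xs = 0 /\ d4_form (Gf S c) p xs = 0.
  have := congr1 (fun h => h xs) P0; rewrite /Phi /ladd /scl /mapf /l0.
  move: (d4_form _ _ _) (d4_form _ _ _) => d e E.
  have := congr1 (@complex.Re R) E; have := congr1 (@complex.Im R) E.
  rewrite /= => h1 h2; split; apply: (mulfI a0n).
    by apply: (eq_comb1 1 h2); ring.
  by apply: (eq_comb1 (-1) h1); ring.
by split=> x y z t; have [] := D0 [:: x; y; z; t].
Qed.

Lemma elliptic_case : integrable_CY (assoc_elliptic S) <-> closed_WG S.
Proof. by split; [exact: elliptic_closed | exact: elliptic_integrable]. Qed.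

End Elliptic.

Theorem proposition1p3 (R : realType) (X : manifold R 6) (S : monge_ampere X) :
  (elliptic S ->
     (integrable_CY (assoc_elliptic S) <->
      closed_form (normalized_form S) /\ closed_form (normalized_dual S)))
  /\
  (hyperbolic S ->
     (integrable_real_CY (assoc_hyperbolic S) <->
      closed_form (normalized_form S) /\ closed_form (normalized_dual S))).
Proof.
split=> h.
  have hl (c : chart X) q : chart_img c q ->
      0 < -1 * pfaffian (symp S c q) (ma_form S c q).
    by move=> Uq; rewrite mulN1r oppr_gt0; exact: h.
  exact: iff_trans (elliptic_case h) (iff_sym (closed_pairP (or_intror erefl) hl)).
have hl (c : chart X) q : chart_img c q ->
    0 < 1 * pfaffian (symp S c q) (ma_form S c q).
  by move=> Uq; rewrite mul1r; exact: h.
exact: iff_trans (hyperbolic_case h) (iff_sym (closed_pairP (or_introl erefl) hl)).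
Qed.
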